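(* For any $\sigma_0$ with $\frac12<\sigma_0<1$ and any sufficiently small $\delta>0$ (i.e. for all $0<\delta<\delta_0$ with some $\delta_0>0$ depending on $\sigma_0$), we have $$\liminf_{T\to\infty}\frac1T N(\sigma_0-\delta,\sigma_0+\delta,T)>0.$$
   Context: The Euler double zeta-function is $\zeta_2(s_1,s_2)=\sum_{n_1=1}^{\infty}\sum_{n_2=1}^{\infty}\frac{1}{n_1^{s_1}(n_1+n_2)^{s_2}}$, absolutely convergent for $\operatorname{Re}(s_1+s_2)>2$, $\operatorname{Re} s_2>1$, and continued meromorphically to $\mathbb{C}^2$. The function $\zeta_2(s,s)$ of one complex variable $s$ is obtained by putting $s_1=s_2=s$; it is the meromorphic function on $\mathbb{C}$ satisfying $\zeta_2(s,s)=\frac12\left(\zeta(s)^2-\zeta(2s)\right)$, where $\zeta$ is the Riemann zeta-function. $N(\sigma_1,\sigma_2,T)$ denotes the number of zeros of $\zeta_2(s,s)$ in the region $\{s \mid \sigma_1<\operatorname{Re} s<\sigma_2,\ 0\le\operatorname{Im} s\le T\}$. *)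

(* Defs.v *)
From HB Require Import structures.
From mathcomp Require Import all_boot all_order all_algebra complex.
From mathcomp Require Import all_classical all_reals all_analysis.
Import Order.TTheory GRing.Theory Num.Theory.
Import numFieldNormedType.Exports.

Set Implicit Arguments.
Unset Strict Implicit.
Unset Printing Implicit Defensive.

Local Open Scope classical_set_scope.
Local Open Scope complex_scope.
Local Open Scope ring_scope.

(* R[i] as a normed space over itself: its topology is that of the modulus,
   and derivability over it is complex differentiability. *)
HB.instance Definition _ (R : realType) := NormedModule.copy R[i] R[i]^o.

Definition cexp (R : realType) (z : R[i]) : R[i] :=
  (expR (complex.Re z))%:C * (cos (complex.Im z) +i* sin (complex.Im z)).

(* n ^ s = exp (s log n) with the real logarithm; only meant for n > 0. *)
Definition natcpow (R : realType) (n : nat) (s : R[i]) : R[i] :=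
  cexp (s * (ln (n%:R : R))%:C).

Definition zeta2_series (R : realType) (s1 s2 : R[i]) : R[i] :=
  \big[+%R/0]_(1 <= n1 <oo) \big[+%R/0]_(1 <= n2 <oo)
    ((natcpow n1 s1)^-1 * (natcpow (n1 + n2) s2)^-1).

Definition holomorphic_at (R : realType) (f : R[i] -> R[i]) (z : R[i]) :=
  \forall w \near z, derivable f w 1.

Definition pole_at (R : realType) (f : R[i] -> R[i]) (z : R[i]) :=
  exists (n : nat) (g : R[i] -> R[i]),
    [/\ (0 < n)%N, holomorphic_at g z, g z != 0 &
        \forall w \near z^', f w = g w / (w - z) ^+ n].

Definition meromorphic (R : realType) (f : R[i] -> R[i]) :=
  forall z : R[i], holomorphic_at f z \/ pole_at f z.

(* s |-> zeta_2(s, s): the meromorphic continuation to the whole plane of the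
   diagonal of the double series, whose half-plane of absolute convergence is
   Re s > 1. It also equals (zeta(s)^2 - zeta(2s)) / 2. Only the values of f at
   its poles are left unspecified. *)
Definition is_zeta2_diag (R : realType) (f : R[i] -> R[i]) :=
  meromorphic f /\
  forall s : R[i], 1 < complex.Re s -> f s = zeta2_series s s.

(* holomorphic_at discards the arbitrary values taken at the poles. *)
Definition zeros_in (R : realType) (f : R[i] -> R[i]) (sigma1 sigma2 T : R) :
    set R[i] :=
  [set s | [/\ holomorphic_at f s, f s = 0,
               sigma1 < complex.Re s < sigma2 & 0 <= complex.Im s <= T]].

(* The number of distinct zeros, +oo if there are infinitely many. A lower
   bound for it is a fortiori one for the count with multiplicity. *)
Definition zero_count (R : realType) (f : R[i] -> R[i]) (sigma1 sigma2 T : R) :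
    \bar R :=
  counting (zeros_in f sigma1 sigma2 T).

(* Main.v *)
Require Import Defs.
From mathcomp Require Import all_boot all_order all_algebra complex.
From mathcomp Require Import all_classical all_reals all_analysis.
From mathcomp Require Import ring lra zify.
Import Order.TTheory GRing.Theory Num.Theory.
Import numFieldNormedType.Exports.

Set Implicit Arguments.
Unset Strict Implicit.
Unset Printing Implicit Defensive.

Local Open Scope classical_set_scope.
Local Open Scope complex_scope.
Local Open Scope ring_scope.

Local Notation Re := complex.Re.
Local Notation Im := complex.Im.

(** The diagonal satisfies zeta_2(s, s) = (zeta(s)^2 - zeta(2s)) / 2. Formally it
    vanishes where
      zeta(2s) / zeta(s)^2 = prod_p (1 - p^-s) / (1 + p^-s)
    takes the value 1. Shifting s by it multiplies every p^-s by p^-it, and for a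
    positive proportion of t these factors are close to signs prescribed in advance
    for finitely many primes. Hence every real zero c in the strip of
    1 - prod_n (1 - eps_n p_n^-s) / (1 + eps_n p_n^-s) with eps_n = 1 or -1 yields a
    zero of zeta_2(s, s) near c + it for a positive proportion of t, and it remains to
    find signs for which such a c exists near sigma_0.

    The signs ([signed_product_zero]). Alternating signs make the product converge for
    Re s >= 1/2, because the two factors of a pair of consecutive primes nearly cancel;
    on the real axis such a product lies between fixed positive bounds and below 1.
    Inserting a long block of signs -1 multiplies the value at x by more than any
    prescribed constant, since the sum of 1/p diverges, whereas at y > x the same block,
    placed far out, contributes a factor as close to 1 as wished. With x and y on the
    two sides of sigma_0 the product is at least 2 at x and less than 1 at y, so it takes
    the value 1 in between.

    The transfer ([zero_at_good_shift]). In the strip zeta is not the limit of its Euler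
    product, so the comparison is made after multiplying by the finite product
    E(s) = prod_(n < M) (1 - p_n^-s). With eta(s) = (1 - 2^(1-s)) zeta(s), kappa(s) =
    1 - 2^(1-s) and Y = eta E - kappa,
      E^2 (zeta^2 - zeta(2s)) = (1 + Y / kappa)^2
        - (1 + o(1)) prod_(n < M) (1 - p_n^-s) / (1 + p_n^-s),
    which is [mollified_identity]; wherever Y is small and the p_n^-it are close to the
    signs, the left side at s + it is close to 1 minus the signed product, and a minimum
    modulus principle ([exists_zero]) transports the zero.

    The proportion of good t ([good_shift_mean]). Let t be weighted by a product of Fejer
    kernels in the phases of the p_n^-it. The weight concentrates on the t with the
    prescribed phases ([fejer_concentrated]), and it does not interfere with Dirichlet
    polynomials over integers prime to the p_n, such as the expansion of Y, whose mean
    square is therefore small ([mollified_mean_square]). Means are taken over finite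
    grids of t, so that no integration is needed ([mean_square]).

    The holomorphic functions involved are handled by discrete circle means: Goursat's
    theorem for dyadic Riemann sums gives the mean value property, from which follow the
    maximum principle, Riemann's theorem on removable singularities, the isolation of
    zeros and the holomorphy of locally bounded limits. *)

(** * The modulus as a real number *)

Section Modulus.
Variable R : realType.
Implicit Types (x y e : R) (z w : R[i]).

(** The norm of R[i] has its values in R[i] itself, where the order is partial; all
    estimates below are made in R. *)
Definition nm z : R := Num.sqrt (Re z ^+ 2 + Im z ^+ 2).

Lemma nmE z : `|z| = (nm z)%:C.
Proof. exact: normc_def. Qed.

Lemma nm_ge0 z : 0 <= nm z.
Proof. exact: sqrtr_ge0. Qed.

Lemma nmM z w : nm (z * w) = nm z * nm w.
Proof.
by apply: (@complexI R); rewrite -nmE normrM !nmE rmorphM.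
Qed.

Lemma nmD z w : nm (z + w) <= nm z + nm w.
Proof. by rewrite -lecR rmorphD /= -!nmE ler_normD. Qed.

Lemma nmN z : nm (- z) = nm z.
Proof. by apply: (@complexI R); rewrite -!nmE normrN. Qed.

Lemma nmB z w : nm (z - w) <= nm z + nm w.
Proof. by rewrite -(nmN w) nmD. Qed.

Lemma nmBC z w : nm (z - w) = nm (w - z).
Proof. by rewrite -nmN opprB. Qed.

Lemma nm0 : nm 0 = 0.
Proof. by apply: (@complexI R); rewrite -nmE normr0. Qed.

Lemma nm1 : nm 1 = 1.
Proof. by apply: (@complexI R); rewrite -nmE normr1. Qed.

Lemma nm_eq0 z : (nm z == 0) = (z == 0).
Proof. by rewrite -(inj_eq (@complexI R)) -nmE normr_eq0. Qed.

Lemma nm_gt0 z : (0 < nm z) = (z != 0).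
Proof. by rewrite lt_def nm_ge0 andbT nm_eq0. Qed.

Lemma nmV z : nm z^-1 = (nm z)^-1.
Proof. by apply: (@complexI R); rewrite -nmE normfV nmE fmorphV. Qed.

Lemma nmX z n : nm (z ^+ n) = nm z ^+ n.
Proof. by apply: (@complexI R); rewrite -nmE normrX nmE rmorphXn. Qed.

Lemma nmr x : nm x%:C = `|x|.
Proof. by rewrite /nm /= expr0n addr0 sqrtr_sqr. Qed.

Lemma nm_nat n : nm n%:R = n%:R.
Proof. by rewrite -(rmorph_nat (real_complex R)) nmr ger0_norm. Qed.

Lemma nm_sq z : nm z ^+ 2 = Re z ^+ 2 + Im z ^+ 2.
Proof. by rewrite sqr_sqrtr// addr_ge0// sqr_ge0. Qed.

Lemma nm_sqc z : (nm z ^+ 2)%:C = z * z^*.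
Proof.
case: z => a b; rewrite nm_sq /=.
by apply/eqP; rewrite eq_complex /= !expr2; apply/andP; split; apply/eqP; ring.
Qed.

Lemma nm_conj z : nm (z^*) = nm z.
Proof. by rewrite /nm; case: z => a b /=; rewrite sqrrN. Qed.

Lemma Re_le_nm z : `|Re z| <= nm z.
Proof. by rewrite -sqrtr_sqr ler_wsqrtr// lerDl sqr_ge0. Qed.

Lemma Im_le_nm z : `|Im z| <= nm z.
Proof. by rewrite -sqrtr_sqr ler_wsqrtr// lerDr sqr_ge0. Qed.

Lemma nm_le_ReIm z : nm z <= `|Re z| + `|Im z|.
Proof.
rewrite -[leRHS]ger0_norm ?addr_ge0// -sqrtr_sqr ler_wsqrtr//.
rewrite sqrrD !real_normK ?num_real//.
by have := mulr_ge0 (normr_ge0 (Re z)) (normr_ge0 (Im z)); lra.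
Qed.

Lemma nm_sum (I : Type) (r : seq I) (P : pred I) (F : I -> R[i]) :
  nm (\sum_(i <- r | P i) F i) <= \sum_(i <- r | P i) nm (F i).
Proof.
elim/big_rec2: _ => [|i y x _ h]; first by rewrite nm0.
by rewrite (le_trans (nmD _ _))// lerD2l.
Qed.

Lemma nm_prod (I : Type) (r : seq I) (P : pred I) (F : I -> R[i]) :
  nm (\prod_(i <- r | P i) F i) = \prod_(i <- r | P i) nm (F i).
Proof. by elim/big_rec2: _ => [|i y x _ h]; rewrite ?nm1 ?nmM ?h. Qed.

Lemma nm_lB z w : nm z - nm w <= nm (z - w).
Proof. by rewrite lerBlDr (le_trans _ (nmD _ _))// subrK. Qed.

Lemma nm_dist z w : `|nm z - nm w| <= nm (z - w).
Proof. by rewrite ler_norml nm_lB andbT lerNl opprB nmBC nm_lB. Qed.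

Lemma Re_sum (I : Type) (r : seq I) (P : pred I) (F : I -> R[i]) :
  Re (\sum_(i <- r | P i) F i) = \sum_(i <- r | P i) Re (F i).
Proof. by elim/big_rec2: _ => // i x [a b] _ /= <-; case: (F i). Qed.

Lemma nbhs_nmP z (P : set R[i]) :
  nbhs z P <-> exists2 d : R, 0 < d & forall w, nm (w - z) < d -> P w.
Proof.
rewrite -nbhs_ballE; split.
  move=> [e /= e0 h].
  exists (Re e) => [|w wz]; first by move: e0; rewrite ltcE => /andP[].
  apply: h; rewrite -ball_normE /= distrC nmE.
  move: e0; rewrite ltcE => /= /andP[/eqP ie _].
  by rewrite ltcE /= ie eqxx.
move=> [d d0 h]; exists d%:C => /=; first by rewrite ltcR.
by move=> w; rewrite -ball_normE /= distrC nmE ltcR; apply: h.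
Qed.

Lemma dnbhs_nmP z (P : set R[i]) :
  nbhs z^' P <->
  exists2 d : R, 0 < d & forall w, w != z -> nm (w - z) < d -> P w.
Proof.
have := nbhs_nmP z (fun w => w != z -> P w).
move=> [h1 h2]; split=> [/h1|] [d d0 h].
  by exists d => // w wz wd; exact: (h w).
by apply: h2; exists d => // w wd wz; exact: (h w).
Qed.

Lemma cont_nm_realP (f : R[i] -> R) z :
  {for z, continuous f} <-> forall e, 0 < e ->
    exists2 d, 0 < d & forall w, nm (w - z) < d -> `|f w - f z| < e.
Proof.
split.
  move=> cf e e0.
  have /cf : nbhs (f z) [set w | `|w - f z| < e].
    by apply/nbhs_ballP; exists e => //= y; rewrite -ball_normE /= distrC.
  by move=> /nbhs_nmP.
move=> h A /nbhs_ballP [e e0 eA].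
have [d d0 hd] := h _ e0.
apply/nbhs_nmP; exists d => // w wz; apply: eA.
by rewrite -ball_normE /= distrC; apply: hd.
Qed.

Lemma cvgn_nmP (u : nat -> R[i]) z :
  u @ \oo --> z <-> forall e, 0 < e ->
    exists n0, forall n, (n0 <= n)%N -> nm (u n - z) < e.
Proof.
split.
  move=> cu e e0.
  have /cu : nbhs z [set w | nm (w - z) < e] by apply/nbhs_nmP; exists e.
  by move=> [n0 _ hn]; exists n0 => n n0n; apply: hn.
move=> h A /nbhs_nmP [e e0 eA].
have [n0 hn] := h _ e0.
by exists n0 => // n /= n0n; apply: eA; exact: hn.
Qed.

Lemma cvgn_normP (u : nat -> R) (x : R) :
  u @ \oo --> x <-> forall e, 0 < e ->
    exists n0, forall n, (n0 <= n)%N -> `|u n - x| < e.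
Proof.
split.
  move=> /cvgrPdist_lt cu e e0; have [n0 _ hn] := cu e e0.
  by exists n0 => n n0n; rewrite distrC; apply: hn.
move=> h; apply/cvgrPdist_lt => e e0; have [n0 hn] := h e e0.
by exists n0 => // n /= n0n; rewrite distrC; apply: hn.
Qed.

Lemma nm_cauchy_cvg (u : nat -> R[i]) :
  (forall e, 0 < e -> exists n0, forall n m, (n0 <= n)%N -> (n0 <= m)%N ->
     nm (u n - u m) < e) -> exists z, u @ \oo --> z.
Proof.
move=> h.
have aux (g : R[i] -> R) : (forall z w, g (z - w) = g z - g w) ->
    (forall z, `|g z| <= nm z) -> exists x, (g \o u) @ \oo --> x.
  move=> gB gn.
  have : cauchy ((g \o u) @ \oo).
    apply/cauchy_ballP => e e0; have [n0 hn] := h e e0.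
    pose A := (g \o u) @` [set n | (n0 <= n)%N].
    exists (A, A); first by split; exists n0 => // n /= n0n; exists n.
    case=> _ _ /= [[n /= n0n <-] [m /= n0m <-]].
    by rewrite /= -ball_normE /= -gB (le_lt_trans (gn _))// hn.
  by move=> /cauchy_cvgP cv; exists (lim ((g \o u) @ \oo)).
have [a ca] := aux (@Re R) (fun z w => raddfB (@Re R : Rcomplex R -> R) z w) Re_le_nm.
have [b cb] := aux (@Im R) (fun z w => raddfB (@Im R : Rcomplex R -> R) z w) Im_le_nm.
exists (a +i* b); apply/cvgn_nmP => e e0.
have e20 : 0 < e / 2 by rewrite divr_gt0.
have [n1 h1] := (cvgn_normP _ _).1 ca _ e20.
have [n2 h2] := (cvgn_normP _ _).1 cb _ e20.
exists (maxn n1 n2) => n; rewrite geq_max => /andP[nn1 nn2].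
rewrite (le_lt_trans (nm_le_ReIm _))// [ltRHS](splitr e).
have -> : Re (u n - (a +i* b)) = Re (u n) - a by case: (u n).
have -> : Im (u n - (a +i* b)) = Im (u n) - b by case: (u n).
by rewrite ltrD ?h1 ?h2.
Qed.

Lemma cvgn_nm_le (u : nat -> R[i]) z (b : R) n0 :
  u @ \oo --> z -> (forall n, (n0 <= n)%N -> nm (u n) <= b) -> nm z <= b.
Proof.
move=> /cvgn_nmP cu hb; rewrite leNgt; apply/negP => bz.
have bz0 : 0 < nm z - b by rewrite subr_gt0.
have [n1 /(_ (maxn n0 n1) (leq_maxr _ _)) h] := cu _ bz0.
have := hb _ (leq_maxl n0 n1); have := nm_lB z (u (maxn n0 n1)).
by rewrite (nmBC z); lra.
Qed.

(** A closed disc is a closed part of the image of a square under (x, y) |-> x + iy. *)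
Lemma compact_cdisc z (r : R) : compact [set w | nm (w - z) <= r].
Proof.
have cf : continuous (fun p : R * R => p.1%:C + 'i * p.2%:C : R[i]).
  move=> p A /nbhs_nmP [e e0 eA].
  have e20 : 0 < e / 2 by rewrite divr_gt0.
  exists ([set x | `|x - p.1| < e / 2], [set x | `|x - p.2| < e / 2]) => /=.
    split; apply/nbhs_ballP; exists (e / 2) => // x /=;
      by rewrite -ball_normE /= distrC.
  case=> a b /= [ha hb]; apply: eA.
  rewrite (_ : _ - _ = (a - p.1) +i* (b - p.2)).
    by rewrite (le_lt_trans (nm_le_ReIm _))//= [ltRHS](splitr e) ltrD.
  by apply/eqP; rewrite eq_complex /=; apply/andP; split; apply/eqP; ring.
pose K := `[Re z - r, Re z + r] `*` `[Im z - r, Im z + r].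
have cK : compact K by apply: compact_setX; exact: segment_compact.
have cI : compact ((fun p : R * R => p.1%:C + 'i * p.2%:C : R[i]) @` K).
  by apply: continuous_compact => //; apply: continuous_subspaceT.
apply: (subclosed_compact _ cI).
  rewrite (_ : [set w | _] = ~` [set w | r < nm (w - z)]); last first.
    by apply/seteqP; split => w /=; rewrite leNgt => /negP.
  apply: open_closedC.
  rewrite openE => w /= rw; apply/nbhs_nmP.
  exists (nm (w - z) - r); first by rewrite subr_gt0.
  move=> v hv /=.
  have := nmD (w - v) (v - z); rewrite addrA subrK (nmBC w v); lra.
move=> w /= hw; exists (Re w, Im w); last by rewrite [RHS]complexE.
have := le_trans (Re_le_nm _) hw; have := le_trans (Im_le_nm _) hw.
rewrite !raddfB /= !ler_norml => /andP[h1 h2] /andP[h3 h4].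
by split; rewrite /= in_itv /=; lra.
Qed.

Lemma cdisc_max z (r : R) (f : R[i] -> R) : 0 <= r ->
  (forall w, nm (w - z) <= r -> {for w, continuous f}) ->
  exists2 c, nm (c - z) <= r & forall w, nm (w - z) <= r -> f w <= f c.
Proof.
move=> r0 cf.
have [||c] := compact_EVT_max (f:=f) _ (@compact_cdisc z r).
- by exists z; rewrite /= subrr nm0.
- apply: continuous_in_subspaceT => w; rewrite inE /=; exact: cf.
by rewrite inE /= => cz h; exists c => // w hw; apply: h; rewrite inE.
Qed.

End Modulus.

(** * Complex differentiability *)

Section Cdiff.
Variable R : realType.
Implicit Types (f g : R[i] -> R[i]) (z w c : R[i]).

Lemma mul_close z w (e : R) : 0 < e -> exists2 d : R, 0 < d & forall z' w',
  nm (z' - z) < d -> nm (w' - w) < d -> nm (z' * w' - z * w) < e.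
Proof.
move=> e0; pose K := nm z + nm w + 1.
have K0 : 0 < K by rewrite /K; have := nm_ge0 z; have := nm_ge0 w; lra.
exists (Num.min 1 (e / (2 * K))).
  by rewrite lt_min ltr01 divr_gt0// mulr_gt0.
move=> z' w'; rewrite !lt_min => /andP[z1 z2] /andP[w1 w2].
have -> : z' * w' - z * w = (z' - z) * w' + z * (w' - w) by ring.
rewrite (le_lt_trans (nmD _ _))// !nmM.
have w'K : nm w' <= 1 + nm w by have := nmD (w' - w) w; rewrite subrK; lra.
have h1 : nm (z' - z) * nm w' <= e / (2 * K) * (1 + nm w).
  by apply: ler_pM; rewrite ?nm_ge0// ltW.
have h2 : nm z * nm (w' - w) <= nm z * (e / (2 * K)).
  by rewrite ler_wpM2l ?nm_ge0// ltW.
have eK : e / 2 = e / (2 * K) * (nm z + nm w + 1).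
  by rewrite -/K; field; rewrite gt_eqF.
lra.
Qed.

Lemma inv_close z (e : R) : z != 0 -> 0 < e -> exists2 d : R, 0 < d & forall z',
  nm (z' - z) < d -> z' != 0 /\ nm (z'^-1 - z^-1) < e.
Proof.
move=> z0 e0; have n0 : 0 < nm z by rewrite nm_gt0.
exists (Num.min (nm z / 2) (e * nm z ^+ 2 / 2)).
  by rewrite lt_min !divr_gt0// mulr_gt0// exprn_gt0.
move=> z'; rewrite lt_min => /andP[z1 z2].
have z'h : nm z / 2 < nm z'.
  by have := nm_lB z z'; rewrite nmBC; lra.
have z'0 : z' != 0 by rewrite -nm_gt0; lra.
split=> //.
have -> : z'^-1 - z^-1 = (z - z') / (z' * z) by field; rewrite z0.
rewrite nmM nmV nmM nmBC ltr_pdivrMr ?mulr_gt0//; last by lra.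
by rewrite (lt_le_trans z2)// expr2 -!mulrA ler_pM2l//; nra.
Qed.

Definition ccont f z := forall e : R, 0 < e ->
  exists2 d : R, 0 < d & forall w, nm (w - z) < d -> nm (f w - f z) < e.

Lemma ccont_cst c z : ccont (fun=> c) z.
Proof. by move=> e e0; exists 1 => // w _; rewrite subrr nm0. Qed.

Lemma ccont_id z : ccont id z.
Proof. by move=> e e0; exists e. Qed.

Lemma ccontD f g z : ccont f z -> ccont g z -> ccont (fun w => f w + g w) z.
Proof.
move=> cf cg e e0; have e20 : 0 < e / 2 by rewrite divr_gt0.
have [d1 d10 h1] := cf _ e20; have [d2 d20 h2] := cg _ e20.
exists (Num.min d1 d2); first by rewrite lt_min d10.
move=> w; rewrite lt_min => /andP[w1 w2].
rewrite (_ : _ - _ = (f w - f z) + (g w - g z)); last by ring.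
by have := h1 _ w1; have := h2 _ w2; have := nmD (f w - f z) (g w - g z); lra.
Qed.

Lemma ccontN f z : ccont f z -> ccont (fun w => - f w) z.
Proof.
move=> cf e e0; have [d d0 h] := cf _ e0; exists d => // w /h.
by rewrite -opprD nmN.
Qed.

Lemma ccontB f g z : ccont f z -> ccont g z -> ccont (fun w => f w - g w) z.
Proof. by move=> cf cg; apply: ccontD => //; exact: ccontN. Qed.

Lemma ccontM f g z : ccont f z -> ccont g z -> ccont (fun w => f w * g w) z.
Proof.
move=> cf cg e e0; have [d d0 h] := mul_close (f z) (g z) e0.
have [d1 d10 h1] := cf _ d0; have [d2 d20 h2] := cg _ d0.
exists (Num.min d1 d2); first by rewrite lt_min d10.
by move=> w; rewrite lt_min => /andP[w1 w2]; apply: h; [exact: h1|exact: h2].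
Qed.

Lemma ccontV f z : f z != 0 -> ccont f z -> ccont (fun w => (f w)^-1) z.
Proof.
move=> fz cf e e0; have [d d0 h] := inv_close fz e0.
have [d1 d10 h1] := cf _ d0; exists d1 => // w /h1 /h; by case.
Qed.

Lemma ccont_comp f g z : ccont f (g z) -> ccont g z -> ccont (fun w => f (g w)) z.
Proof.
move=> cf cg e e0; have [d d0 h] := cf _ e0; have [d1 d10 h1] := cg _ d0.
by exists d1 => // w /h1 /h.
Qed.

Lemma ccont_nz f z : ccont f z -> f z != 0 ->
  exists2 d : R, 0 < d & forall w, nm (w - z) < d -> f w != 0.
Proof.
move=> cf fz; have [d d0 h] := inv_close fz ltr01; have [d1 d10 h1] := cf _ d0.
by exists d1 => // w /h1 /h [].
Qed.

(** Caratheodory's form of differentiability: a factorisation of the increment rather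
    than a limit of quotients, so that the rules of calculus become rules for continuous
    factors. [derivable_cdiff] relates it to derivability. *)
Definition cdiff f z :=
  exists2 g : R[i] -> R[i], ccont g z & forall w, f w = f z + g w * (w - z).

Lemma cdiff_cont f z : cdiff f z -> ccont f z.
Proof.
move=> [g cg fg].
have -> : f = (fun w => f z + g w * (w - z)) by apply/funext => w; rewrite {1}fg.
apply: ccontD; first exact: ccont_cst.
apply: ccontM => //.
by apply: ccontB; [exact: ccont_id|exact: ccont_cst].
Qed.

Lemma cdiff_cst c z : cdiff (fun=> c) z.
Proof.
exists (fun=> 0); first exact: ccont_cst.
by move=> w; rewrite mul0r addr0.
Qed.

Lemma cdiff_id z : cdiff id z.
Proof.
exists (fun=> 1); first exact: ccont_cst.
by move=> w; rewrite mul1r addrC subrK.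
Qed.

Lemma cdiffD f g z : cdiff f z -> cdiff g z -> cdiff (fun w => f w + g w) z.
Proof.
move=> [f' cf hf] [g' cg hg]; exists (fun w => f' w + g' w).
  exact: ccontD.
by move=> w; rewrite hf hg; ring.
Qed.

Lemma cdiffM f g z : cdiff f z -> cdiff g z -> cdiff (fun w => f w * g w) z.
Proof.
move=> df dg; have cg := cdiff_cont dg.
move: df dg => [f' cf hf] [g' cg' hg].
exists (fun w => f' w * g w + f z * g' w).
  apply: ccontD; first exact: ccontM.
  by apply: ccontM => //; exact: ccont_cst.
by move=> w; rewrite hf (hg w); ring.
Qed.

Lemma cdiffN f z : cdiff f z -> cdiff (fun w => - f w) z.
Proof.
move=> [f' cf hf]; exists (fun w => - f' w); first exact: ccontN.
by move=> w; rewrite hf; ring.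
Qed.

Lemma cdiffB f g z : cdiff f z -> cdiff g z -> cdiff (fun w => f w - g w) z.
Proof. by move=> df dg; apply: cdiffD => //; exact: cdiffN. Qed.

Lemma cdiffX f n z : cdiff f z -> cdiff (fun w => f w ^+ n) z.
Proof.
move=> df; elim: n => [|n ih]; first exact: (cdiff_cst 1).
have -> : (fun w => f w ^+ n.+1) = (fun w => f w * f w ^+ n).
  by apply/funext => w; rewrite exprS.
exact: cdiffM.
Qed.

Lemma cdiff_comp f g z : cdiff f (g z) -> cdiff g z -> cdiff (fun w => f (g w)) z.
Proof.
move=> df dg; have cg := cdiff_cont dg.
move: df dg => [f' cf hf] [g' cg' hg].
exists (fun w => f' (g w) * g' w).
  by apply: ccontM => //; exact: (ccont_comp _ cg).
by move=> w; rewrite hf -mulrA; congr (_ + _ * _); rewrite hg; ring.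
Qed.

(** The factor for g is its difference quotient off z, completed at z by the factor for f. *)
Lemma cdiff_near f g z (d : R) : 0 < d ->
  (forall w, nm (w - z) < d -> f w = g w) -> cdiff f z -> cdiff g z.
Proof.
move=> d0 fg [f' cf hf].
exists (fun w => if w == z then f' z else (g w - g z) / (w - z)).
  move=> e e0; have [d1 d10 hd] := cf _ e0.
  exists (Num.min d d1); first by rewrite lt_min d0.
  move=> w; rewrite lt_min eqxx => /andP[wd wd1].
  case: eqP => [_|/eqP wz]; first by rewrite subrr nm0.
  rewrite -!fg ?subrr ?nm0// hf (addrC (f z)) addrK mulfK ?subr_eq0//.
  exact: hd.
move=> w; case: eqP => [->|/eqP wz]; first by rewrite subrr mulr0 addr0.
by rewrite divfK ?subr_eq0// addrC subrK.
Qed.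

Lemma cdiff_inv z : z != 0 -> cdiff (fun w => w^-1) z.
Proof.
move=> z0.
have n0 : 0 < nm z by rewrite nm_gt0.
apply: (@cdiff_near (fun w => if w == 0 then z^-1 - z^-2 * (w - z) else w^-1) _ z _ n0).
  move=> w wz; case: eqP => // w0.
  by move: wz; rewrite w0 sub0r nmN ltxx.
exists (fun w => if w == 0 then - z^-2 else - (w^-1 * z^-1)).
  have h : ccont (fun w => - (w^-1 * z^-1)) z.
    apply: ccontN; apply: ccontM; last exact: ccont_cst.
    by apply: ccontV => //; exact: ccont_id.
  move=> e e0; have [d d0 hd] := h _ e0.
  exists (Num.min d (nm z)); first by rewrite lt_min d0.
  move=> w; rewrite lt_min (negbTE z0) => /andP[wd wz].
  case: eqP => [w0|_]; last exact: hd.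
  by move: wz; rewrite w0 sub0r nmN ltxx.
move=> w; rewrite (negbTE z0); case: eqP => [->|/eqP w0]; first by rewrite mulNr.
by field; rewrite z0 w0.
Qed.

Lemma cdiffV f z : f z != 0 -> cdiff f z -> cdiff (fun w => (f w)^-1) z.
Proof. by move=> fz df; apply: (@cdiff_comp (fun w => w^-1) f) => //; exact: cdiff_inv. Qed.

Lemma cdiff_div f g z : g z != 0 -> cdiff f z -> cdiff g z ->
  cdiff (fun w => f w / g w) z.
Proof. by move=> g0 df dg; apply: cdiffM => //; exact: cdiffV. Qed.

Lemma cdiff_sum (I : Type) (r : seq I) (P : pred I) (F : I -> R[i] -> R[i]) z :
  (forall i, P i -> cdiff (F i) z) -> cdiff (fun w => \sum_(i <- r | P i) F i w) z.
Proof.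
move=> h; elim: r => [|i r ih].
  have -> : (fun w => \sum_(i <- [::] | P i) F i w) = fun=> 0.
    by apply/funext => w; rewrite big_nil.
  exact: cdiff_cst.
have -> : (fun w => \sum_(j <- i :: r | P j) F j w) = (fun w =>
    if P i then F i w + \sum_(j <- r | P j) F j w else \sum_(j <- r | P j) F j w).
  by apply/funext => w; rewrite big_cons.
by case Pi: (P i) => //; apply: cdiffD => //; exact: h.
Qed.

Lemma cdiff_prod (I : Type) (r : seq I) (P : pred I) (F : I -> R[i] -> R[i]) z :
  (forall i, P i -> cdiff (F i) z) -> cdiff (fun w => \prod_(i <- r | P i) F i w) z.
Proof.
move=> h; elim: r => [|i r ih].
  have -> : (fun w => \prod_(i <- [::] | P i) F i w) = fun=> 1.
    by apply/funext => w; rewrite big_nil.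
  exact: cdiff_cst.
have -> : (fun w => \prod_(j <- i :: r | P j) F j w) = (fun w =>
    if P i then F i w * \prod_(j <- r | P j) F j w else \prod_(j <- r | P j) F j w).
  by apply/funext => w; rewrite big_cons.
by case Pi: (P i) => //; apply: cdiffM => //; exact: h.
Qed.

Lemma derivable_cdiff f z : derivable f z 1 <-> cdiff f z.
Proof.
split.
  move=> /cvg_ex [/= l /= hl].
  exists (fun w => if w == z then l else (f w - f z) / (w - z)).
    move=> e e0.
    have /hl : nbhs l [set w | nm (w - l) < e] by apply/nbhs_nmP; exists e.
    rewrite /nbhs /= => /dnbhs_nmP [d d0 hd]; exists d => // w wd; rewrite /= eqxx.
    have [_|wz] := eqVneq w z; first by rewrite subrr nm0.
    have := hd (w - z); rewrite subr_eq0 subr0 => /(_ wz wd).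
    by rewrite /= [_ *: 1]mulr1 subrK mulrC.
  move=> w; case: eqP => [->|/eqP wz]; first by rewrite subrr mulr0 addr0.
  by rewrite divfK ?subr_eq0// addrC subrK.
move=> [g cg hg]; apply/cvg_ex; exists (g z) => A /nbhs_nmP [e e0 eA].
have [d d0 hd] := cg _ e0.
apply/dnbhs_nmP; exists d => // h h0; rewrite subr0 => hh; apply: eA.
rewrite /= [_ *: 1]mulr1 hg addrAC subrr add0r addrK.
have -> : h^-1 *: (g (h + z) * h) = g (h + z) by rewrite [LHS]mulrCA mulVf ?mulr1.
by apply: hd; rewrite addrK.
Qed.

Lemma holomorphic_cdiff f z : holomorphic_at f z <->
  exists2 d, 0 < d & forall w, nm (w - z) < d -> cdiff f w.
Proof.
split=> [/nbhs_nmP [d d0 h]|[d d0 h]].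
  by exists d => // w /h /derivable_cdiff.
by apply/nbhs_nmP; exists d => // w /h /derivable_cdiff.
Qed.

End Cdiff.

(** * The exponential *)

Section Cexp.
Variable R : realType.
Implicit Types (x y e t : R) (z w c : R[i]).

Lemma sqr_norm x : `|x| ^+ 2 = x ^+ 2.
Proof. exact: real_normK (num_real x). Qed.

Lemma sign_norm1 x : x ^+ 2 = 1 -> `|x| = 1.
Proof.
move=> x2; move: x2; rewrite -sqr_norm => /eqP; rewrite sqrf_eq1 => /orP[/eqP//|/eqP h].
by have := normr_ge0 x; lra.
Qed.

Lemma expR_le_inv x : x < 1 -> expR x <= (1 - x)^-1.
Proof.
move=> x1; have h : 0 < 1 - x by lra.
rewrite -[leLHS]invrK -expRN lef_pV2 ?posrE ?expR_gt0//.
by have := expR_ge1Dx (- x).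
Qed.

Lemma expR_second_order x : `|x| <= 1 / 2 -> 0 <= expR x - 1 - x <= 2 * x ^+ 2.
Proof.
rewrite ler_norml => /andP[h1 h2].
have hx := expR_ge1Dx x.
have h : 0 < 1 - x by lra.
have := @expR_le_inv x ltac:(lra).
rewrite -[leRHS]mul1r ler_pdivlMr// => h3.
apply/andP; split; first by lra.
have : (expR x - 1 - x) * (1 - x) <= x ^+ 2 by rewrite expr2; nra.
by move=> h4; nra.
Qed.

(** From the mean value theorem on the segment between 0 and y. *)
Lemma sin_mean y : exists2 x, `|x| <= `|y| & sin y = y * cos x.
Proof.
have drv x : is_derive x 1 (@sin R) (cos x) by exact: is_derive_sin.
have cont : forall a b, {within `[a, b], continuous (@sin R)}.
  by move=> a b; apply: continuous_subspaceT; exact: continuous_sin.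
have [y0|y0|->] := ltgtP y 0; last first.
- by exists 0 => //; rewrite sin0 mul0r.
- have [x xy] := MVT_segment (ltW y0) (fun x _ => drv x) (cont _ _).
  rewrite sin0 !subr0 => ->; exists x; last by rewrite mulrC.
  by move: xy; rewrite in_itv /= => /andP[x0 xy]; rewrite !ger0_norm// ltW.
have [x xy] := MVT_segment (ltW y0) (fun x _ => drv x) (cont _ _).
rewrite sin0 => h; exists x; last by lra.
by move: xy; rewrite in_itv /= => /andP[x0 xy]; rewrite !ler0_norm//; lra.
Qed.

Lemma sin_le_norm y : `|sin y| <= `|y|.
Proof.
have [x _ ->] := sin_mean y; rewrite normrM.
by rewrite ler_piMr// cos_max.
Qed.

Lemma cos_ge_quad y : 1 - y ^+ 2 / 2 <= cos y.
Proof.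
have h2 := sin_le_norm (y / 2); have h1 := cos2Dsin2 (y / 2).
have h3 : sin (y / 2) ^+ 2 <= (y / 2) ^+ 2.
  by rewrite -[leLHS]sqr_norm -[leRHS]sqr_norm lerXn2r// nnegrE.
rewrite [in leRHS](splitr y) cosD; move: h1 h3; rewrite !expr2; nra.
Qed.

Lemma sin_ge_half y : 0 <= y <= 1 -> y / 2 <= sin y.
Proof.
move=> /andP[y0 y1]; have [x xy ->] := sin_mean y.
rewrite ler_wpM2l//; have := cos_ge_quad x.
have : x ^+ 2 <= 1 by rewrite -sqr_norm expr_le1// (le_trans xy)// ger0_norm.
lra.
Qed.

Definition cis t : R[i] := cos t +i* sin t.

Lemma nm_cis t : nm (cis t) = 1.
Proof. by rewrite /nm /= cos2Dsin2 sqrtr1. Qed.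

Lemma cexpE z : cexp z = (expR (Re z))%:C * cis (Im z).
Proof. by []. Qed.

Lemma cexp_cis t : cexp ('i * t%:C) = cis t.
Proof. by rewrite cexpE /= !mul0r !mul1r subrr add0r expR0 rmorph1 mul1r. Qed.

Lemma nm_cexp z : nm (cexp z) = expR (Re z).
Proof. by rewrite cexpE nmM nm_cis mulr1 nmr ger0_norm ?expR_ge0. Qed.

Lemma cexpD z w : cexp (z + w) = cexp z * cexp w.
Proof.
rewrite !cexpE (_ : Re (z + w) = Re z + Re w); last by case: z; case: w.
rewrite (_ : Im (z + w) = Im z + Im w); last by case: z; case: w.
rewrite expRD rmorphM mulrACA; congr (_ * _).
by apply/eqP; rewrite eq_complex /= cosD sinD; apply/andP; split; apply/eqP; ring.
Qed.

Lemma cexp0 : cexp 0 = 1 :> R[i].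
Proof. by rewrite cexpE expR0 mul1r /cis cos0 sin0. Qed.

Lemma cexp_neq0 z : cexp z != 0.
Proof. by rewrite -nm_gt0 nm_cexp expR_gt0. Qed.

Lemma cexpN z : cexp (- z) = (cexp z)^-1.
Proof.
apply: (mulfI (cexp_neq0 z)); rewrite -cexpD subrr cexp0 divff//.
exact: cexp_neq0.
Qed.

Lemma cexpMn z n : cexp (n%:R * z) = cexp z ^+ n.
Proof.
elim: n => [|n ih]; first by rewrite mul0r cexp0.
by rewrite -natr1 mulrDl mul1r cexpD ih exprSr.
Qed.

Lemma cexp_real x : cexp (x%:C) = (expR x)%:C.
Proof. by rewrite cexpE /= /cis cos0 sin0 mulr1. Qed.

Lemma cexp_2pi : cexp ('i * (pi *+ 2)%:C) = 1 :> R[i].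
Proof. by rewrite cexp_cis /cis cos2pi sin2pi. Qed.

(** This replaces the power series of the exponential: a second order estimate at 0,
    assembled from real ones, is all that differentiability needs. *)
Lemma cexp_second_order z : `|Re z| <= 1 / 2 -> `|Im z| <= 1 / 2 ->
  nm (cexp z - 1 - z) <= 4 * nm z ^+ 2.
Proof.
case: z => x y /= hx hy.
have /andP[e1 e2] := expR_second_order hx.
have c1 := cos_ge_quad y; have c2 := cos_le1 y.
have [t ty sy] := sin_mean y.
have s0 := sin_le_norm y.
have ct1 := cos_ge_quad t; have ct2 := cos_le1 t.
have t2 : t ^+ 2 <= y ^+ 2.
  by rewrite -sqr_norm -[leRHS]sqr_norm lerXn2r// nnegrE.
rewrite (le_trans (nm_le_ReIm _))// nm_sq /=.
rewrite !mul0r subr0 addr0 subr0.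
have [X1 X2] : - (1/2) <= x /\ x <= 1/2.
  by move: hx; rewrite ler_norml => /andP[].
have [Y1 Y2] : - (1/2) <= y /\ y <= 1/2.
  by move: hy; rewrite ler_norml => /andP[].
have ex2 : expR x <= 2 by have : 2 * x ^+ 2 <= 1/2 by [rewrite expr2; nra]; lra.
have ex0 := expR_gt0 x.
have A : `|expR x * cos y - 1 - x| <= 2 * x ^+ 2 + y ^+ 2.
  rewrite (_ : _ - x = (expR x - 1 - x) - expR x * (1 - cos y)); last by ring.
  rewrite (le_trans (ler_normB _ _))// lerD//; first by rewrite ger0_norm.
  rewrite ger0_norm; last by rewrite mulr_ge0//; lra.
  by nra.
have B : `|expR x * sin y + 0 - y| <= x ^+ 2 + 2 * y ^+ 2.
  rewrite (_ : _ - y = (expR x - 1) * sin y + (sin y - y)); last by ring.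
  rewrite (le_trans (ler_normD _ _))//.
  have b1 : `|expR x - 1| <= 2 * `|x|.
    have := normr_ge0 x; have : x ^+ 2 = `|x| ^+ 2 by rewrite sqr_norm.
    have := ler_norm x; have := ler_norm (- x); rewrite normrN => n1 n2 n3 n4.
    rewrite ler_norml; apply/andP; split; nra.
  have b2 : `|sin y - y| <= `|y| * (y ^+ 2 / 2).
    rewrite sy -[X in _ - X]mulr1 -mulrBr normrM ler_wpM2l//.
    by rewrite ler0_norm ?subr_le0//; lra.
  have b3 : `|expR x - 1| * `|sin y| <= 2 * `|x| * `|y| by rewrite ler_pM.
  rewrite normrM.
  have : y ^+ 2 = `|y| ^+ 2 by rewrite sqr_norm.
  have : x ^+ 2 = `|x| ^+ 2 by rewrite sqr_norm.
  have := normr_ge0 x; have := normr_ge0 y.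
  set p := `|x| in hx b3 *; set q := `|y| in hy b3 b2 *.
  move=> q0 p0 px qy.
  have : q * (y ^+ 2 / 2) <= q ^+ 2 by rewrite qy; nra.
  have : 2 * p * q <= p ^+ 2 + q ^+ 2 by have := sqr_ge0 (p - q); rewrite sqrrB; lra.
  lra.
have := sqr_ge0 x; have := sqr_ge0 y; rewrite ?addr0 in A B *; lra.
Qed.

Lemma cdiff_cexp z : cdiff (@cexp R) z.
Proof.
suff d0 : cdiff (@cexp R) 0.
  have -> : @cexp R = (fun w => cexp z * cexp (w - z)).
    by apply/funext => w; rewrite -cexpD addrC subrK.
  apply: cdiffM; first exact: cdiff_cst.
  apply: (@cdiff_comp _ (@cexp R)); first by rewrite subrr.
  by apply: cdiffB; [exact: cdiff_id|exact: cdiff_cst].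
exists (fun w => if w == 0 then 1 else (cexp w - 1) / w).
  move=> e e0; exists (Num.min (1 / 2) (e / 8)); first by rewrite lt_min; apply/andP; split; lra.
  move=> w; rewrite subr0 lt_min eqxx => /andP[w1 w2].
  have [_|w0] := eqVneq w 0; first by rewrite subrr nm0.
  have := @cexp_second_order w; have := Re_le_nm w; have := Im_le_nm w => hi hr.
  move=> /(_ ltac:(lra) ltac:(lra)) h.
  have -> : (cexp w - 1) / w - 1 = (cexp w - 1 - w) / w by field.
  have n0 : 0 < nm w by rewrite nm_gt0.
  by rewrite nmM nmV ltr_pdivrMr//; nra.
move=> w; rewrite subr0 cexp0; have [->|w0] := eqVneq w 0.
  by rewrite mulr0 addr0 cexp0.
by rewrite divfK// addrC subrK.
Qed.

Lemma nm_cis_sub1 t : nm (cis t - 1) <= `|t|.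
Proof.
rewrite -(ler_pXn2r (n:=2))// ?nnegrE ?nm_ge0// sqr_norm nm_sq /=.
rewrite subr0; have := cos2Dsin2 t; have := cos_ge_quad t.
rewrite !expr2; nra.
Qed.

Lemma nm_cis_sub1_ge t : `|t| <= 1 -> `|t| / 2 <= nm (cis t - 1).
Proof.
move=> t1; rewrite (le_trans _ (Im_le_nm _))//= subr0.
rewrite ler_norml in t1; case/andP: t1 => t1 t2.
have [t0|t0] := lerP 0 t.
  rewrite (ger0_norm t0) (le_trans (sin_ge_half _)) ?t0// ler_norm//.
rewrite (ltr0_norm t0).
have := @sin_ge_half (- t) ltac:(by apply/andP; split; lra).
by move=> h; rewrite (le_trans h)// sinN -normrN ler_norm.
Qed.

Lemma cisD s t : cis (s + t) = cis s * cis t.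
Proof. by rewrite -!cexp_cis -cexpD -mulrDr -rmorphD. Qed.

End Cexp.

(** * Goursat's theorem for dyadic Riemann sums *)

Section Goursat.
Variable R : realType.
Implicit Types (x y e t : R) (z w c a b d : R[i]) (f : R[i] -> R[i]).

(** A Riemann sum with left endpoints for the integral of f from z to z + d. With a
    dyadic subdivision, halving the segment is an exact identity. *)
Definition edge_sum f n z d :=
  d / (2 ^+ n) * \sum_(k < 2 ^ n) f (z + k%:R * (d / 2 ^+ n)).

(** The same for the boundary of the parallelogram with sides a and b at z. *)
Definition loop_sum f n z a b :=
  edge_sum f n z a + edge_sum f n (z + a) b
  - edge_sum f n (z + b) a - edge_sum f n z b.

Lemma edge_sumS f n z d :
  edge_sum f n.+1 z d = edge_sum f n z (d / 2) + edge_sum f n (z + d / 2) (d / 2).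
Proof.
have e2 : d / 2 ^+ n.+1 = d / 2 / 2 ^+ n.
  by rewrite exprS invfM mulrA.
rewrite /edge_sum e2 -mulrDr; congr (_ * _).
rewrite -(big_mkord xpredT (fun k => f (z + k%:R * (d / 2 / 2 ^+ n)))).
rewrite (big_cat_nat (n := 2 ^ n)%N) //=; last by rewrite leq_exp2l.
rewrite big_mkord; congr (_ + _).
rewrite -{1}[(2 ^ n)%N]add0n big_addn expnS mul2n -addnn addnK big_mkord.
apply: eq_bigr => k _; congr (f _); rewrite natrD natrX -addrA; congr (_ + _).
rewrite mulrDl addrC; congr (_ + _); field.
by rewrite expf_eq0 pnatr_eq0 andbF.
Qed.

Lemma loop_sumS f n z a b :
  loop_sum f n.+1 z a b =
  loop_sum f n z (a / 2) (b / 2) + loop_sum f n (z + a / 2) (a / 2) (b / 2)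
  + loop_sum f n (z + b / 2) (a / 2) (b / 2)
  + loop_sum f n (z + a / 2 + b / 2) (a / 2) (b / 2).
Proof.
rewrite /loop_sum !edge_sumS.
move: (splitr a) (splitr b); move: (a / 2) (b / 2) => a2 b2 -> ->.
have -> : z + (b2 + b2) + a2 = z + a2 + b2 + b2 by ring.
have -> : z + (a2 + a2) + b2 = z + a2 + b2 + a2 by ring.
have -> : z + (a2 + a2) = z + a2 + a2 by ring.
have -> : z + (b2 + b2) = z + b2 + b2 by ring.
have -> : z + b2 + a2 = z + a2 + b2 by ring.
ring.
Qed.

Lemma edge_sumD f g n z d :
  edge_sum (fun w => f w + g w) n z d = edge_sum f n z d + edge_sum g n z d.
Proof. by rewrite /edge_sum big_split mulrDr. Qed.

Lemma loop_sumD f g n z a b :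
  loop_sum (fun w => f w + g w) n z a b = loop_sum f n z a b + loop_sum g n z a b.
Proof. by rewrite /loop_sum !edge_sumD; ring. Qed.

(** On opposite sides an affine function differs by a constant, and the two pairs of sides
    contribute opposite multiples of a b: the discretisation makes no error here. *)
Lemma loop_sum_affine (p q : R[i]) n z a b :
  loop_sum (fun w => p + q * w) n z a b = 0.
Proof.
have h u d : edge_sum (fun w => p + q * w) n u d =
    d * (p + q * u) + d ^+ 2 * (q / (2 ^+ n) ^+ 2 * \sum_(k < 2 ^ n) k%:R).
  rewrite /edge_sum.
  under eq_bigr do rewrite mulrDr addrA (mulrCA q).
  rewrite big_split /= -mulr_suml sumr_const card_ord -[_ *+ (2 ^ n)]mulr_natr natrX.
  by field; rewrite expf_eq0 pnatr_eq0 andbF.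
by rewrite /loop_sum !h; ring.
Qed.

Lemma edge_sum_le f n z d (B : R) :
  (forall s : R, 0 <= s <= 1 -> nm (f (z + s%:C * d)) <= B) ->
  nm (edge_sum f n z d) <= nm d * B.
Proof.
move=> hB; rewrite /edge_sum nmM nmM nmV nmX nm_nat -mulrA ler_wpM2l ?nm_ge0//.
rewrite ler_pdivrMl ?exprn_gt0//.
rewrite (le_trans (nm_sum _ _ _))//.
apply: le_trans (_ : \sum_(k < 2 ^ n) B <= _).
  apply: ler_sum => k _.
  have := hB (k%:R / 2 ^+ n); rewrite divr_ge0 ?exprn_ge0//=.
  rewrite ler_pdivrMr ?exprn_gt0// mul1r -natrX ler_nat ltnW// => /(_ isT).
  rewrite rmorphM rmorph_nat fmorphV rmorph_nat natrX.
  by rewrite mulrA mulrAC.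
by rewrite sumr_const card_ord -[_ *+ (2 ^ n)]mulr_natr natrX mulrC.
Qed.

Lemma loop_sum_le f n z a b (B : R) :
  (forall s t : R, 0 <= s <= 1 -> 0 <= t <= 1 ->
     nm (f (z + s%:C * a + t%:C * b)) <= B) ->
  nm (loop_sum f n z a b) <= 2 * (nm a + nm b) * B.
Proof.
move=> hB.
have h0 : 0 <= (0 : R) <= 1 by rewrite lexx ler01.
have h1 : 0 <= (1 : R) <= 1 by rewrite lexx ler01.
have e1 : nm (edge_sum f n z a) <= nm a * B.
  by apply: edge_sum_le => s hs; have := hB s 0 hs h0; rewrite mul0r addr0.
have e2 : nm (edge_sum f n (z + a) b) <= nm b * B.
  by apply: edge_sum_le => s hs; have := hB 1 s h1 hs; rewrite mul1r.
have e3 : nm (edge_sum f n (z + b) a) <= nm a * B.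
  by apply: edge_sum_le => s hs; have := hB s 1 hs h1; rewrite mul1r addrAC.
have e4 : nm (edge_sum f n z b) <= nm b * B.
  by apply: edge_sum_le => s hs; have := hB 0 s h0 hs; rewrite mul0r addr0.
rewrite /loop_sum.
rewrite (le_trans (nmB _ _))//.
have := nmB (edge_sum f n z a + edge_sum f n (z + a) b) (edge_sum f n (z + b) a).
have := nmD (edge_sum f n z a) (edge_sum f n (z + a) b).
lra.
Qed.

Lemma affine_range (a x u h : R) : 0 <= h -> a <= x <= a + h -> 0 <= u <= 1 ->
  `|a + u * h - x| <= h.
Proof.
move=> h0 /andP[a1 a2] /andP[u0 u1].
have uh : u * h <= h by rewrite ler_piMl.
have uh0 : 0 <= u * h by rewrite mulr_ge0.
by rewrite ler_norml; apply/andP; split; lra.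
Qed.

Lemma nested_dyadic (s : nat -> R) :
  (forall k, s k <= s k.+1) ->
  (forall k, s k.+1 + 2^-1 ^+ k.+1 <= s k + 2^-1 ^+ k) ->
  exists x, forall k, s k <= x <= s k + 2^-1 ^+ k.
Proof.
move=> s1 s2.
have h2 k : 0 < (2^-1 : R) ^+ k by rewrite exprn_gt0// invr_gt0.
have mono i j : (i <= j)%N -> s i <= s j.
  move=> ij; rewrite -(subnK ij); elim: (j - i)%N => [|m ih] //.
  by rewrite addSn (le_trans ih).
have anti i j : (i <= j)%N -> s j + 2^-1 ^+ j <= s i + 2^-1 ^+ i.
  move=> ij; rewrite -(subnK ij); elim: (j - i)%N => [|m ih] //.
  by rewrite addSn (le_trans _ ih).
have ub k : ubound (range s) (s k + 2^-1 ^+ k).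
  move=> _ [i _ <-]; have [ik|ki] := leqP i k.
    by rewrite (le_trans (mono _ _ ik))// lerDl ltW.
  by rewrite (le_trans _ (anti _ _ (ltnW ki)))// lerDl ltW.
exists (sup (range s)) => k; apply/andP; split.
  apply: ub_le_sup; last by exists k.
  by exists (s 0%N + 2^-1 ^+ 0); exact: ub.
by apply: ge_sup; [exists (s 0%N); exists 0%N|exact: ub].
Qed.

(** Bisection: if the bound fails with a factor proportional to the area, it fails for
    one of the four quarters. The failing cells shrink to a point, where f is affine up to
    a term of smaller order, and the affine part contributes nothing. *)
Lemma goursat f z a b :
  (forall s t : R, 0 <= s <= 1 -> 0 <= t <= 1 ->
     cdiff f (z + s%:C * a + t%:C * b)) ->
  forall e, 0 < e -> exists n0, forall n, (n0 <= n)%N ->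
    nm (loop_sum f n z a b) <= e.
Proof.
move=> df.
pose L := nm a + nm b.
have L0 : 0 <= L by rewrite addr_ge0 ?nm_ge0.
pose h k : R := 2^-1 ^+ k.
have h0 k : 0 < h k by rewrite exprn_gt0// invr_gt0.
have hS k : h k = h k.+1 + h k.+1 by rewrite /h exprS; lra.
pose cell (p : R * R) := z + p.1%:C * a + p.2%:C * b.
suff main (e : R) : 0 < e -> exists n0, forall n, (n0 <= n)%N ->
    nm (loop_sum f n z a b) <= e * L ^+ 2.
  move=> e e0; have [n0 hn] := main (e / (L ^+ 2 + 1)) ltac:(
    by rewrite divr_gt0// ltr_wpDl// sqr_ge0).
  exists n0 => n /hn /le_trans; apply.
  rewrite mulrAC ler_pdivrMr ?ltr_wpDl ?sqr_ge0//.
  by rewrite ler_pM2l// lerDl.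
move=> e0; apply: contrapT => nh.
(* The bound is scaled by the square of the side, hence by 1/4 at every bisection. *)
pose bad k (p : R * R) := forall n0, exists2 n, (n0 <= n)%N &
  e * (h k * L) ^+ 2 < nm (loop_sum f n (cell p) ((h k)%:C * a) ((h k)%:C * b)).
pose inside k (p : R * R) := [/\ 0 <= p.1, p.1 + h k <= 1, 0 <= p.2 & p.2 + h k <= 1].
pose P k p := bad k p /\ inside k p.
have step k p : P k p -> exists p', [/\ P k.+1 p',
    (p.1 <= p'.1) /\ (p'.1 + h k.+1 <= p.1 + h k) &
    (p.2 <= p'.2) /\ (p'.2 + h k.+1 <= p.2 + h k)].
  move=> [bp [i1 i2 i3 i4]].
  have [h1 h2] := (h0 k.+1, hS k).
  pose p0 := p; pose p1 := (p.1 + h k.+1, p.2); pose p2 := (p.1, p.2 + h k.+1).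
  pose p3 := (p.1 + h k.+1, p.2 + h k.+1).
  suff [|[|[|]]] : bad k.+1 p0 \/ bad k.+1 p1 \/ bad k.+1 p2 \/ bad k.+1 p3.
  - by move=> bq; exists p0; split; [split => //; split|split|split]; rewrite /=; lra.
  - by move=> bq; exists p1; split; [split => //; split|split|split]; rewrite /=; lra.
  - by move=> bq; exists p2; split; [split => //; split|split|split]; rewrite /=; lra.
  - by move=> bq; exists p3; split; [split => //; split|split|split]; rewrite /=; lra.
  apply: contrapT => nb.
  have good q : ~ bad k.+1 q -> exists n0, forall n, (n0 <= n)%N ->
      nm (loop_sum f n (cell q) ((h k.+1)%:C * a) ((h k.+1)%:C * b)) <=
      e * (h k.+1 * L) ^+ 2.
    move=> /existsNP [n0 hn0]; exists n0 => n n0n.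
    by rewrite leNgt; apply/negP => bn; apply: hn0; exists n.
  have [n0 g0] := good p0 (fun q => nb (or_introl q)).
  have [n1 g1] := good p1 (fun q => nb (or_intror (or_introl q))).
  have [n2 g2] := good p2 (fun q => nb (or_intror (or_intror (or_introl q)))).
  have [n3 g3] := good p3 (fun q => nb (or_intror (or_intror (or_intror q)))).
  have [[|n]] := bp (maxn (maxn n0 n1) (maxn n2 n3)).+1; first by [].
  rewrite ltnS !geq_max => /andP[/andP[m0 m1] /andP[m2 m3]].
  rewrite loop_sumS.
  have half d : (h k)%:C * d / 2 = (h k.+1)%:C * d.
    by rewrite h2 rmorphD /=; field.
  rewrite !half.
  have -> : cell p + (h k.+1)%:C * a = cell p1.
    by rewrite /cell /p1 /= rmorphD /=; ring.
  have -> : cell p + (h k.+1)%:C * b = cell p2.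
    by rewrite /cell /p2 /= rmorphD /=; ring.
  have -> : cell p1 + (h k.+1)%:C * b = cell p3.
    by rewrite /cell /p3 /= !rmorphD /=; ring.
  rewrite ltNge => /negP; apply.
  have hh : e * (h k * L) ^+ 2 = 4 * (e * (h k.+1 * L) ^+ 2).
    by rewrite h2; ring.
  pose X q := loop_sum f n (cell q) ((h k.+1)%:C * a) ((h k.+1)%:C * b).
  have {g0}g0 : nm (X p0) <= _ := g0 _ m0; have {g1}g1 : nm (X p1) <= _ := g1 _ m1.
  have {g2}g2 : nm (X p2) <= _ := g2 _ m2; have {g3}g3 : nm (X p3) <= _ := g3 _ m3.
  rewrite -/(X p) -/(X p1) -/(X p2) -/(X p3) -[X p]/(X p0).
  have := nmD (X p0 + X p1 + X p2) (X p3); have := nmD (X p0 + X p1) (X p2).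
  have := nmD (X p0) (X p1); lra.
have P0 : P 0%N (0, 0).
  split; last by split => //=; rewrite /h expr0 add0r.
  move=> n0; apply: contrapT => hn; apply: nh; exists n0 => n n0n.
  rewrite leNgt; apply/negP => hh; apply: hn; exists n => //.
  by rewrite /cell /h expr0 !mul1r /= !mul0r !addr0.
pose nxt k (q : {p | P k p}) : {p | P k.+1 p} :=
  let c := cid (step k (sval q) (svalP q)) in
  exist _ (sval c) (let: And3 x _ _ := svalP c in x).
pose seqp := fix sp k : {p | P k p} :=
  match k with 0%N => exist _ (0, 0) P0 | k'.+1 => nxt k' (sp k') end.
pose s1 k := (sval (seqp k)).1; pose s2 k := (sval (seqp k)).2.
have stepP k : [/\ s1 k <= s1 k.+1, s1 k.+1 + h k.+1 <= s1 k + h k,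
    s2 k <= s2 k.+1 & s2 k.+1 + h k.+1 <= s2 k + h k].
  rewrite /s1 /s2 /= /nxt; case: (cid _) => p' /= [_ [? ?] [? ?]]; by split.
have [x hx] := nested_dyadic (fun k => let: And4 u _ _ _ := stepP k in u)
  (fun k => let: And4 _ u _ _ := stepP k in u).
have [y hy] := nested_dyadic (fun k => let: And4 _ _ u _ := stepP k in u)
  (fun k => let: And4 _ _ _ u := stepP k in u).
have x01 : 0 <= x <= 1 by have := hx 0%N; rewrite /s1 /= expr0 add0r.
have y01 : 0 <= y <= 1 by have := hy 0%N; rewrite /s2 /= expr0 add0r.
have [g cg hg] := df x y x01 y01.
set zs := z + _ + _ in cg hg.
have e40 : 0 < e / 4 by rewrite divr_gt0.
have [d d0 hd] := cg _ e40.
have [k hk] : exists k, h k * L < d.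
  have : (fun k : nat => 2^-1 ^+ k : R) @ \oo --> (0 : R).
    by apply: cvg_expr; rewrite ger0_norm ?invr_ge0// invf_lt1// ltr1n.
  move=> /cvgn_normP /(_ (d / (L + 1))) []; first by rewrite divr_gt0// ltr_wpDl.
  move=> n0 /(_ n0 (leqnn _)); rewrite subr0 ger0_norm ?(ltW (h0 _))//.
  rewrite ltr_pdivlMr ?ltr_wpDl// => hh; exists n0; rewrite (le_lt_trans _ hh)//.
  by rewrite ler_wpM2l ?(ltW (h0 _))// lerDl.
have [bk _] := svalP (seqp k).
have [n _] := bk 0%N.
set zk := cell _.
rewrite ltNge => /negP; apply.
(* The affine part of f at the limit point drops out of the sum. *)
have -> : f = (fun w => (f zs - g zs * zs + g zs * w) + (g w - g zs) * (w - zs)).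
  by apply/funext => w; rewrite {1}hg; ring.
rewrite loop_sumD loop_sum_affine add0r.
have hkL : nm ((h k)%:C * a) + nm ((h k)%:C * b) = h k * L.
  by rewrite !nmM nmr ger0_norm ?(ltW (h0 _))// -mulrDr.
have := hx k; have := hy k; rewrite -/(h k) => /andP[y1 y2] /andP[x1 x2].
apply: (le_trans (@loop_sum_le _ n _ _ _ (e / 4 * (h k * L)) _)); last first.
  rewrite hkL expr2; set q := h k * L.
  have : 0 <= e * (q * q) by rewrite mulr_ge0 ?(ltW e0)// -expr2 sqr_ge0.
  lra.
move=> u v /andP[u0 u1] /andP[v0 v1]; rewrite nmM.
set w := zk + _ + _.
have hw : nm (w - zs) <= h k * L.
  have -> : w - zs = (s1 k + u * h k - x)%:C * a + (s2 k + v * h k - y)%:C * b.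
    by rewrite /w /zs /zk /cell -/(s1 k) -/(s2 k) !rmorphB !rmorphD !rmorphM /=; ring.
  rewrite (le_trans (nmD _ _))// !nmM !nmr mulrDr lerD// ler_wpM2r ?nm_ge0//.
    by apply: affine_range; rewrite ?(ltW (h0 k)) ?u0 ?x1.
  by apply: affine_range; rewrite ?(ltW (h0 k)) ?v0 ?y1.
apply: ler_pM; rewrite ?nm_ge0//.
by apply/ltW/hd; exact: le_lt_trans hk.
Qed.

End Goursat.

(** * Means over circles *)

Section MeanValue.
Variable R : realType.
Implicit Types (x y e t r : R) (z w c : R[i]) (f : R[i] -> R[i]).

(** The k-th power of the primitive root of unity of order 2^n. *)
Definition root_pt n (k : nat) : R[i] := cexp (k%:R * ('i * (pi *+ 2)%:C / 2 ^+ n)).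

(** Means over 2^n equidistant points of the circle stand for integrals over it; along
    w |-> c + r exp(w) they are the sums of [edge_sum]. *)
Definition cmean n f c r : R[i] :=
  (2 ^+ n)^-1 * \sum_(k < 2 ^ n) f (c + r%:C * root_pt n k).

Definition rmean n (g : R[i] -> R) c r : R :=
  (2 ^+ n)^-1 * \sum_(k < 2 ^ n) g (c + r%:C * root_pt n k).

Lemma nm_root_pt n k : nm (root_pt n k) = 1.
Proof.
rewrite /root_pt (_ : _ * _ = 'i * (k%:R * (pi *+ 2) / 2 ^+ n)%:C).
  by rewrite cexp_cis nm_cis.
by rewrite !rmorphM fmorphV rmorphXn /= !rmorph_nat; ring.
Qed.

Lemma nm_circle c r n k : 0 <= r -> nm (c + r%:C * root_pt n k - c) = r.
Proof.
by move=> r0; rewrite addrAC subrr add0r nmM nm_root_pt mulr1 nmr ger0_norm.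
Qed.

Lemma cmeanB n f g c r :
  cmean n (fun w => f w - g w) c r = cmean n f c r - cmean n g c r.
Proof. by rewrite /cmean sumrB mulrBr. Qed.

Lemma cmeanZ n (p : R[i]) f c r : cmean n (fun w => p * f w) c r = p * cmean n f c r.
Proof. by rewrite /cmean -mulr_sumr mulrCA. Qed.

Lemma cmean_cst n p c r : cmean n (fun=> p) c r = p.
Proof.
by rewrite /cmean sumr_const card_ord -[p *+ _]mulr_natr natrX mulrCA mulVf ?mulr1.
Qed.

Lemma nm_cmean n f c r : nm (cmean n f c r) <= rmean n (fun w => nm (f w)) c r.
Proof.
rewrite /cmean /rmean nmM nmV nmX nm_nat ler_wpM2l ?invr_ge0 ?exprn_ge0//.
exact: nm_sum.
Qed.

Lemma rmean_le n (g h : R[i] -> R) c r : 0 <= r ->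
  (forall w, nm (w - c) = r -> g w <= h w) -> rmean n g c r <= rmean n h c r.
Proof.
move=> r0 gh; rewrite ler_wpM2l ?invr_ge0 ?exprn_ge0//.
by apply: ler_sum => k _; apply: gh; exact: nm_circle.
Qed.

Lemma rmean_cst n p c r : rmean n (fun=> p) c r = p.
Proof.
by rewrite /rmean sumr_const card_ord -[p *+ _]mulr_natr natrX mulrCA mulVf ?mulr1.
Qed.

Lemma rmeanZ n p (g : R[i] -> R) c r : rmean n (fun w => p * g w) c r = p * rmean n g c r.
Proof. by rewrite /rmean -mulr_sumr mulrCA. Qed.

Lemma nm_cmean_le n f c r (B : R) : 0 <= r ->
  (forall w, nm (w - c) = r -> nm (f w) <= B) -> nm (cmean n f c r) <= B.
Proof.
move=> r0 h; rewrite (le_trans (nm_cmean _ _ _ _))// -[leRHS](rmean_cst n B c r).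
exact: rmean_le.
Qed.

(** The map w |-> c + p exp(w) sends a rectangle of height 2 pi onto the annulus between
    the radii p and r. Its horizontal sides cancel by periodicity, so Goursat's theorem
    equates the means over the two circles, and p is so small that the inner one is close
    to f(c). *)
Lemma mean_value f c r : 0 < r ->
  (forall w, nm (w - c) <= r -> cdiff f w) ->
  forall e, 0 < e -> exists n0, forall n, (n0 <= n)%N ->
    nm (cmean n f c r - f c) <= e.
Proof.
move=> r0 df e e0.
have e20 : 0 < e / 2 by rewrite divr_gt0.
have [d d0 hd] := cdiff_cont (df c ltac:(by rewrite subrr nm0 ltW)) e20.
pose p := Num.min r (d / 2).
have p0 : 0 < p by rewrite lt_min r0 divr_gt0.
have pr : p <= r by rewrite ge_min lexx.
have pd : p < d by rewrite gt_min; apply/orP; right; lra.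
pose l := ln (r / p).
have rp1 : 1 <= r / p by rewrite ler_pdivlMr// mul1r.
have l0 : 0 <= l by rewrite ln_ge0.
have el : expR l = r / p by rewrite lnK// posrE divr_gt0.
(* The sides of the rectangle mapped onto the annulus. *)
pose a : R[i] := l%:C; pose b : R[i] := 'i * (pi *+ 2)%:C.
pose g w := f (c + p%:C * cexp w).
have dg s t : 0 <= s <= 1 -> 0 <= t <= 1 -> cdiff g (0 + s%:C * a + t%:C * b).
  move=> /andP[s0 s1] _; apply: (@cdiff_comp _ f).
    apply: df; rewrite addrAC subrr add0r nmM nmr (ger0_norm (ltW p0)) nm_cexp.
    rewrite (_ : complex.Re _ = s * l); last by rewrite /a /b /=; ring.
    rewrite -ler_pdivlMl// [leRHS]mulrC -el ler_expR; nra.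
  apply: cdiffD; first exact: cdiff_cst.
  by apply: cdiffM; [exact: cdiff_cst|exact: cdiff_cexp].
have [n0 hn0] := goursat dg e20.
exists n0 => n /hn0.
have -> : loop_sum g n 0 a b = b * (cmean n f c r - cmean n f c p).
  rewrite /loop_sum !add0r.
  have -> : edge_sum g n b a = edge_sum g n 0 a.
    rewrite /edge_sum; congr (_ * _); apply: eq_bigr => k _.
    by rewrite /g cexpD add0r cexp_2pi mul1r.
  rewrite [X in X - _]addrAC subrr add0r mulrBr /edge_sum /cmean !mulrA; congr (_ * _ - _ * _).
    apply: eq_bigr => k _; rewrite /g cexpD cexp_real mulrA -rmorphM el (mulrC p) divfK//.
    by rewrite gt_eqF.
  by apply: eq_bigr => k _; rewrite /g add0r.
rewrite nmM => hb.
have b1 : 1 <= nm b.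
  have pi2 : 0 <= (pi : R) *+ 2 by rewrite mulrn_wge0// pi_ge0.
  rewrite nmM nmr ger0_norm//.
  have -> : nm ('i : R[i]) = 1 by rewrite /nm /= expr0n add0r expr1n sqrtr1.
  by rewrite mul1r mulr2n; have := pi_ge2 R; lra.
have hA : nm (cmean n f c r - cmean n f c p) <= e / 2.
  by rewrite -[leLHS]mul1r (le_trans _ hb)// ler_wpM2r ?nm_ge0.
have hB : nm (cmean n f c p - f c) <= e / 2.
  rewrite -[X in _ - X](cmean_cst n (f c) c p) -cmeanB.
  apply: nm_cmean_le => [|w wp]; first exact: ltW.
  by apply/ltW/hd; rewrite wp.
rewrite (_ : _ - f c = (cmean n f c r - cmean n f c p) + (cmean n f c p - f c)); last by ring.
by rewrite (le_trans (nmD _ _))//; lra.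
Qed.

Lemma center_le_circle f c r (B : R) : 0 < r ->
  (forall w, nm (w - c) <= r -> cdiff f w) ->
  (forall w, nm (w - c) = r -> nm (f w) <= B) -> nm (f c) <= B.
Proof.
move=> r0 df hB; rewrite leNgt; apply/negP => h.
have e0 : 0 < (nm (f c) - B) / 2 by rewrite divr_gt0// subr_gt0.
have [n0 /(_ _ (leqnn _)) hn] := mean_value r0 df e0.
have := nm_cmean_le n0 (ltW r0) hB.
have := nm_lB (f c) (cmean n0 f c r); rewrite nmBC; lra.
Qed.

(** Otherwise 1/f is holomorphic on the disc and larger at the centre than on the circle. *)
Lemma exists_zero f c r (m : R) : 0 < r ->
  (forall w, nm (w - c) <= r -> cdiff f w) ->
  (forall w, nm (w - c) = r -> m <= nm (f w)) -> nm (f c) < m ->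
  exists2 w, nm (w - c) < r & f w = 0.
Proof.
move=> r0 df hm fcm; apply: contrapT => nz.
have m0 : 0 < m by rewrite (le_lt_trans _ fcm)// nm_ge0.
have f0 w : nm (w - c) <= r -> f w != 0.
  rewrite le_eqVlt => /predU1P[wr|wr]; last by apply/eqP => fw; apply: nz; exists w.
  by rewrite -nm_gt0 (lt_le_trans m0)// hm.
have dV w : nm (w - c) <= r -> cdiff (fun w => (f w)^-1) w.
  by move=> wr; apply: cdiffV; [exact: f0|exact: df].
have fc0 : 0 < nm (f c) by rewrite nm_gt0 f0// subrr nm0 ltW.
have := center_le_circle (B := m^-1) r0 dV.
rewrite nmV lef_pV2 ?posrE// => h.
suff : m <= nm (f c) by rewrite leNgt fcm.
by apply: h => w wr; rewrite nmV lef_pV2 ?posrE ?hm// nm_gt0 f0// wr.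
Qed.

(** The roots of unity sum to zero: multiplication by the root -1 pairs them off. *)
Lemma cmean_id n c r : (0 < n)%N -> cmean n id c r = c.
Proof.
case: n => // n _.
suff s0 : \sum_(k < 2 ^ n.+1) root_pt n.+1 k = 0.
  rewrite /cmean big_split /= -mulr_sumr s0 mulr0 addr0.
  by rewrite sumr_const card_ord -[c *+ _]mulr_natr natrX mulrCA mulVf ?mulr1.
have q1 : root_pt n.+1 (2 ^ n)%N = -1.
  rewrite /root_pt natrX (_ : _ * _ = 'i * pi%:C).
    by rewrite cexp_cis /cis cospi sinpi; apply/eqP; rewrite eq_complex /= oppr0 !eqxx.
  have h2n : (2 : R[i]) ^+ n != 0 by rewrite expf_neq0// pnatr_eq0.
  have -> : ((pi : R) *+ 2)%:C = pi%:C * 2 by rewrite [pi *+ 2]mulr2n rmorphD /=; ring.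
  by rewrite exprS; field; exact: h2n.
rewrite -(big_mkord xpredT (root_pt n.+1)).
rewrite (big_cat_nat (n := 2 ^ n)%N) //=; last by rewrite leq_exp2l.
rewrite -{2}[(2 ^ n)%N]add0n big_addn expnS mul2n -addnn addnK.
rewrite -big_split /= big1// => k _.
by rewrite /root_pt natrD mulrDl cexpD -/(root_pt _ _) -/(root_pt _ _) q1; ring.
Qed.

End MeanValue.

(** * The maximum principle and removable singularities *)

Section MaxModulus.
Variable R : realType.
Implicit Types (x y e t r B : R) (z w c a b : R[i]) (f g : R[i] -> R[i]).

Lemma ccont_nm f z : ccont f z -> {for z, continuous (fun w => nm (f w))}.
Proof.
move=> cf; apply/cont_nm_realP => e e0; have [d d0 hd] := cf _ e0.
by exists d => // w /hd; apply: le_lt_trans; exact: nm_dist.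
Qed.

Lemma rmean_sq n z c r : (0 < n)%N -> 0 <= r ->
  rmean n (fun w => nm (w - c) ^+ 2) z r = nm (z - c) ^+ 2 + r ^+ 2.
Proof.
move=> n0 r0.
have hid := cmean_id z r n0.
have key w : nm (w - z) = r -> nm (w - c) ^+ 2 =
    nm (z - c) ^+ 2 + r ^+ 2 + 2 * complex.Re ((z - c)^* * (w - z)).
  move=> <-; rewrite !nm_sq; case: w => w1 w2; case: z {hid} => z1 z2; case: c => c1 c2.
  by rewrite /=; ring.
rewrite /rmean (eq_bigr (fun k : 'I_(2 ^ n) => (nm (z - c) ^+ 2 + r ^+ 2) +
   2 * complex.Re ((z - c)^* * (z + r%:C * root_pt R n k - z)))); last first.
  by move=> k _; rewrite (key (z + r%:C * root_pt R n k)) ?nm_circle.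
rewrite big_split /= -mulr_sumr -Re_sum -mulr_sumr sumrB.
have hs : \sum_(k < 2 ^ n) (z + r%:C * root_pt R n k) = \sum_(k < 2 ^ n) z.
  move: hid; rewrite -{2}(cmean_cst n z z r) /cmean => /mulfI; apply.
  by rewrite invr_neq0// expf_neq0// pnatr_eq0.
rewrite hs subrr mulr0 mulr0 addr0 sumr_const card_ord -[_ *+ (2 ^ n)]mulr_natr natrX.
by rewrite mulrCA mulVf ?mulr1// expf_neq0// pnatr_eq0.
Qed.

(** An interior maximum of |f| need not be strict, so a small multiple of |w - c|^2 is
    added. Its circle means strictly exceed its value at the centre ([rmean_sq]), which
    contradicts the mean value property at an interior maximum of the sum. *)
Lemma max_modulus f c r B : 0 < r ->
  (forall w, nm (w - c) <= r -> cdiff f w) ->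
  (forall w, nm (w - c) = r -> nm (f w) <= B) ->
  forall w, nm (w - c) <= r -> nm (f w) <= B.
Proof.
move=> r0 df hB w1 hw1; rewrite leNgt; apply/negP => Bw1.
(* On the circle the added term e |w - c|^2 equals half of the excess |f(w1)| - B. *)
pose e := (nm (f w1) - B) / (2 * r ^+ 2).
have r20 : 0 < r ^+ 2 by rewrite exprn_gt0.
have e0 : 0 < e by rewrite divr_gt0 ?subr_gt0// mulr_gt0.
have er : e * r ^+ 2 = (nm (f w1) - B) / 2 by rewrite /e; field; rewrite gt_eqF.
pose u w := nm (f w) + e * nm (w - c) ^+ 2.
have cu w : nm (w - c) <= r -> {for w, continuous u}.
  move=> wr.
  have h1 := ccont_nm (cdiff_cont (df _ wr)).
  have h2 : {for w, continuous (fun w => e * nm (w - c) ^+ 2)}.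
    have h3 : {for w, continuous (fun w => nm (w - c))}.
      by apply: ccont_nm; apply: ccontB; [exact: ccont_id|exact: ccont_cst].
    have -> : (fun w => e * nm (w - c) ^+ 2) =
      (fun=> e) \* ((fun w => nm (w - c)) \* (fun w => nm (w - c))).
      by apply/funext => v; rewrite /= expr2.
    by apply: continuousM; [exact: cst_continuous|exact: continuousM].
  exact: (continuousD h1 h2).
have [z0 z0r z0max] := cdisc_max (ltW r0) cu.
have z0lt : nm (z0 - c) < r.
  rewrite lt_neqAle z0r andbT; apply/eqP => z0e.
  have := z0max _ hw1; rewrite /u z0e er; have := hB _ z0e.
  have : 0 <= e * nm (w1 - c) ^+ 2 by rewrite mulr_ge0 ?(ltW e0)// sqr_ge0.
  lra.
pose p := r - nm (z0 - c).
have p0 : 0 < p by rewrite subr_gt0.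
have sub w : nm (w - z0) <= p -> nm (w - c) <= r.
  by have := nmD (w - z0) (z0 - c); rewrite addrA subrK /p; lra.
have ep0 : 0 < e * p ^+ 2 / 2 by rewrite divr_gt0// mulr_gt0// exprn_gt0.
have [n0 hn0] := mean_value p0 (fun w hw => df w (sub w hw)) ep0.
have {}hn0 := hn0 n0.+1 (leqnSn _).
have h1 := nm_cmean n0.+1 f z0 p.
have h2 : rmean n0.+1 (fun w => nm (f w)) z0 p <= nm (f z0) - e * p ^+ 2.
  apply: le_trans (_ : rmean n0.+1 (fun w => u z0 - e * nm (w - c) ^+ 2) z0 p <= _).
    apply: rmean_le => [|w wp]; first exact: ltW.
    have : u w <= u z0 by apply/z0max/sub; rewrite wp.
    by rewrite /u; lra.
  rewrite /rmean sumrB mulrBr -/(rmean n0.+1 (fun=> u z0) z0 p) rmean_cst.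
  rewrite -/(rmean n0.+1 (fun w => e * nm (w - c) ^+ 2) z0 p) rmeanZ rmean_sq ?(ltW p0)//.
  by rewrite /u; lra.
have := nm_lB (f z0) (cmean n0.+1 f z0 p); rewrite nmBC; lra.
Qed.

Lemma geometric_small x e : 0 <= x < 1 -> 0 < e -> exists n, x ^+ n < e.
Proof.
move=> /andP[x0 x1] e0.
have : (fun k : nat => x ^+ k : R) @ \oo --> (0 : R) by apply: cvg_expr; rewrite ger0_norm.
move=> /cvgn_normP /(_ e e0) [n0 /(_ n0 (leqnn _))].
by rewrite subr0 ger0_norm ?exprn_ge0//; exists n0.
Qed.

(** The product p f^n with p(w) = (w - a)^2 (w - b)^2 is holomorphic at a and b as well,
    so |f|^n is bounded by B^n times a quantity independent of n; let n tend to infinity.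
    Two exceptional points occur for difference quotients of a function with a singularity. *)
Lemma max_modulus_except f c r B a b : 0 < r ->
  nm (a - c) < r -> nm (b - c) < r ->
  (forall w, nm (w - c) <= r -> w != a -> w != b -> cdiff f w) ->
  (exists2 d, 0 < d & exists K, forall w, w != a -> w != b -> nm (w - a) < d -> nm (f w) <= K) ->
  (exists2 d, 0 < d & exists K, forall w, w != a -> w != b -> nm (w - b) < d -> nm (f w) <= K) ->
  (forall w, nm (w - c) = r -> nm (f w) <= B) ->
  forall w, nm (w - c) <= r -> w != a -> w != b -> nm (f w) <= B.
Proof.
move=> r0 ar br df ba bb hB w1 w1r w1a w1b; rewrite leNgt; apply/negP => Bw1.
have B0 : 0 <= B.
  have := hB (c + r%:C) ; rewrite addrAC subrr add0r nmr ger0_norm ?(ltW r0)// => /(_ erefl).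
  by apply: le_trans; exact: nm_ge0.
pose F := nm (f w1); pose B' := (B + F) / 2.
have [B'0 BB' B'F] : [/\ 0 < B', B < B' & B' < F].
  by rewrite /B' /F; split; lra.
pose p w := (w - a) ^+ 2 * (w - b) ^+ 2.
have cX a' w : cdiff (fun w => (w - a') ^+ 2) w.
  by apply: cdiffX; apply: cdiffB; [exact: cdiff_id|exact: cdiff_cst].
have side a' b' n : (exists2 d, 0 < d & exists K, forall w, w != a' -> w != b' ->
    nm (w - a') < d -> nm (f w) <= K) ->
    cdiff (fun w => (w - a') ^+ 2 * (w - b') ^+ 2 * f w ^+ n) a'.
  move=> [d d0 [K hK]].
  exists (fun w => (w - a') * (w - b') ^+ 2 * f w ^+ n); last first.
    by move=> w; rewrite subrr expr0n mul0r mul0r add0r; ring.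
  have K0 : 0 <= Num.max 0 K by rewrite le_max lexx.
  pose M := (nm (a' - b') + 1) ^+ 2 * (Num.max 0 K) ^+ n + 1.
  have M0 : 0 < M.
    by rewrite ltr_wpDl// mulr_ge0 ?exprn_ge0// addr_ge0 ?nm_ge0.
  move=> e e0; exists (Num.min d (Num.min 1 (e / M))).
    by rewrite !lt_min d0 ltr01 divr_gt0.
  move=> w; rewrite !lt_min => /and3P[wd w1' we].
  rewrite subrr mul0r mul0r subr0.
  have [->|wx] := eqVneq w a'; first by rewrite subrr mul0r mul0r nm0.
  have [->|wy] := eqVneq w b'; first by rewrite subrr expr0n mulr0 mul0r nm0.
  rewrite -mulrA nmM; move: we; rewrite ltr_pdivlMr//; apply: le_lt_trans.
  rewrite ler_wpM2l ?nm_ge0// nmM !nmX /M.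
  apply: le_trans (_ : (nm (a' - b') + 1) ^+ 2 * (Num.max 0 K) ^+ n <= _); last by lra.
  apply: ler_pM; rewrite ?exprn_ge0 ?nm_ge0//.
    rewrite lerXn2r ?nnegrE ?nm_ge0 ?addr_ge0 ?nm_ge0//.
    by have := nmD (w - a') (a' - b'); rewrite addrA subrK; lra.
  by rewrite lerXn2r ?nnegrE ?nm_ge0// le_max hK ?orbT.
have dG n w : nm (w - c) <= r -> cdiff (fun w => p w * f w ^+ n) w.
  move=> wr; rewrite /p.
  have [->|wa] := eqVneq w a; first exact: side.
  have [->|wb] := eqVneq w b.
    have -> : (fun w => (w - a) ^+ 2 * (w - b) ^+ 2 * f w ^+ n) =
      (fun w => (w - b) ^+ 2 * (w - a) ^+ 2 * f w ^+ n).
      by apply/funext => v; congr (_ * _); rewrite mulrC.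
    apply: side; move: bb => [d d0 [K hK]]; exists d => //; exists K => v vb va.
    exact: hK.
  apply: cdiffM; last by apply: cdiffX; exact: df.
  by apply: cdiffM; exact: cX.
pose C := ((2 * r) ^+ 2 * (2 * r) ^+ 2).
have C0 : 0 < C by rewrite !mulr_gt0// exprn_gt0// mulr_gt0.
have Gb n : nm (p w1 * f w1 ^+ n) <= C * B ^+ n.
  apply: (max_modulus (f := fun w => p w * f w ^+ n) r0 (dG n)) => // w wr.
  rewrite /p nmM (nmM ((w - a) ^+ 2)) !nmX; apply: ler_pM; rewrite ?mulr_ge0 ?exprn_ge0 ?nm_ge0//; last first.
    by rewrite lerXn2r ?nnegrE ?nm_ge0// hB.
  have aux v : nm (v - c) < r -> nm (w - v) ^+ 2 <= (2 * r) ^+ 2.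
    move=> vr; rewrite lerXn2r ?nnegrE ?nm_ge0 ?mulr_ge0 ?(ltW r0)//.
    by have := nmD (w - c) (c - v); rewrite addrA subrK (nmBC c) wr; lra.
  by apply: ler_pM; [rewrite exprn_ge0 ?nm_ge0|rewrite exprn_ge0 ?nm_ge0|exact: aux|exact: aux].
have p1 : 0 < nm (p w1) by rewrite nm_gt0 mulf_neq0// expf_neq0// subr_eq0.
have F0 : 0 < F by lra.
have [n hn] : exists n, (B' / F) ^+ n < nm (p w1) / C.
  apply: geometric_small; last by rewrite divr_gt0.
  by rewrite divr_ge0 ?(ltW B'0) ?(ltW F0)//= ltr_pdivrMr// mul1r.
have := Gb n; rewrite nmM nmX -/F leNgt => /negP; apply.
move: hn; rewrite expr_div_n ltr_pdivrMr ?exprn_gt0// mulrAC ltr_pdivlMr//.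
rewrite mulrC; apply: le_lt_trans; rewrite ler_wpM2l ?(ltW C0)//.
by rewrite lerXn2r ?nnegrE// ?(ltW BB')// ltW.
Qed.

(** The maximum principle for the quotient (f(u) - f(v)) / (u - v) in u, which is bounded
    near both exceptional points c and v and at most 4B / r on the circle. *)
Lemma punctured_lipschitz f c r B : 0 < r ->
  (forall w, w != c -> nm (w - c) <= r -> cdiff f w) ->
  (forall w, w != c -> nm (w - c) <= r -> nm (f w) <= B) ->
  forall w v, w != c -> v != c -> nm (w - c) <= r / 2 -> nm (v - c) <= r / 2 ->
    nm (f w - f v) <= 4 * B / r * nm (w - v).
Proof.
move=> r0 df hB w v wc vc wr vr.
have vr' : nm (v - c) < r by lra.
have cr : nm (c - c) < r by rewrite subrr nm0.
have B0 : 0 <= B by have := hB v vc (ltW vr'); apply: le_trans; exact: nm_ge0.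
have [->|wv] := eqVneq w v; first by rewrite !subrr nm0 mulr0.
have vn0 : 0 < nm (v - c) by rewrite nm_gt0 subr_eq0.
have main := @max_modulus_except (fun u => (f u - f v) / (u - v)) c r (4 * B / r) c v
  r0 cr vr'.
have wv0 : 0 < nm (w - v) by rewrite nm_gt0 subr_eq0.
rewrite -ler_pdivrMr// -nmV -nmM.
apply: main => //; last by lra.
- move=> u ur uc uv; apply: cdiff_div; first by rewrite subr_eq0.
    by apply: cdiffB; [exact: df|exact: cdiff_cst].
  by apply: cdiffB; [exact: cdiff_id|exact: cdiff_cst].
- exists (Num.min r (nm (v - c) / 2)); first by rewrite lt_min r0 divr_gt0.
  exists (2 * B / (nm (v - c) / 2)) => u uc uv; rewrite lt_min => /andP[ur uv2].
  rewrite nmM nmV; apply: ler_pM; rewrite ?invr_ge0 ?nm_ge0//.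
    by rewrite (le_trans (nmB _ _))//; have := hB _ uc (ltW ur); have := hB _ vc (ltW vr'); lra.
  have h : nm (v - c) / 2 <= nm (u - v).
    by have := nmD (v - u) (u - c); rewrite addrA subrK (nmBC v); lra.
  by rewrite lef_pV2 ?posrE// ?divr_gt0// nm_gt0 subr_eq0.
- have [g cg hg] := df v vc (ltW vr').
  have [d d0 hd] := cg _ ltr01.
  exists d => //; exists (nm (g v) + 1) => u uc uv ud.
  rewrite hg addrAC subrr add0r mulfK ?subr_eq0//.
  by have := hd _ ud; have := nmD (g u - g v) (g v); rewrite subrK; lra.
move=> u ur; rewrite nmM nmV.
have uc : u != c by apply/eqP => uc; move: ur r0; rewrite uc subrr nm0 => <-; rewrite ltxx.
have -> : 4 * B / r = 2 * B * (r / 2)^-1 by field; rewrite gt_eqF.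
apply: ler_pM; rewrite ?invr_ge0 ?nm_ge0//.
  rewrite (le_trans (nmB _ _))//; have := hB _ vc (ltW vr').
  by have := hB _ uc; rewrite ur => /(_ (lexx _)); lra.
have h : r / 2 <= nm (u - v).
  by have := nmD (u - v) (v - c); rewrite addrA subrK ur; lra.
by rewrite lef_pV2 ?posrE// ?divr_gt0//; lra.
Qed.

Lemma lipschitz_limit f c r B : 0 < r -> 0 <= B ->
  (forall w v, w != c -> v != c -> nm (w - c) <= r -> nm (v - c) <= r ->
    nm (f w - f v) <= B * nm (w - v)) ->
  exists l, forall w, w != c -> nm (w - c) <= r -> nm (f w - l) <= B * nm (w - c).
Proof.
move=> r0 B0 hf.
pose p n : R := r * 2^-1 ^+ n.
have p0 n : 0 < p n by rewrite mulr_gt0// exprn_gt0// invr_gt0.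
have pr n : p n <= r by rewrite ler_piMr ?(ltW r0)// exprn_ile1// ?invr_ge0// invf_le1// ler1n.
have pmono n m : (n <= m)%N -> p m <= p n.
  move=> nm'; rewrite ler_pM2l// -(subnK nm') exprD ler_piMl ?exprn_ge0 ?invr_ge0//.
  by rewrite exprn_ile1// ?invr_ge0// invf_le1// ler1n.
have nmp n : nm (c + (p n)%:C - c) = p n.
  by rewrite addrAC subrr add0r nmr ger0_norm// ltW.
have pc n : c + (p n)%:C != c.
  by rewrite -subr_eq0 -nm_gt0 nmp.
have psmall e : 0 < e -> exists n0, B * p n0 < e.
  move=> e0; have [n hn] := @geometric_small 2^-1 (e / (B * r + 1)) ltac:(
    by rewrite invr_ge0 ler0n/= invf_lt1// ltr1n) ltac:(
    by rewrite divr_gt0// ltr_wpDl// mulr_ge0// ltW).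
  exists n; move: hn; rewrite ltr_pdivlMr ?ltr_wpDl ?mulr_ge0 ?(ltW r0)//.
  apply: le_lt_trans; rewrite /p mulrA mulrC ler_wpM2l ?exprn_ge0 ?invr_ge0//.
  by rewrite lerDl.
have [|l hl] := @nm_cauchy_cvg R (fun n => f (c + (p n)%:C)).
  move=> e e0; have [n0 hn0] := psmall (e / 2) ltac:(by rewrite divr_gt0).
  exists n0 => n m n0n n0m.
  rewrite (le_lt_trans (hf _ _ (pc n) (pc m) _ _)) ?nmp ?pr//.
  have h1 := pmono _ _ n0n; have h2 := pmono _ _ n0m.
  have := nmB (p n)%:C (p m)%:C; rewrite !nmr !(ger0_norm (ltW (p0 _))).
  have -> : c + (p n)%:C - (c + (p m)%:C) = (p n)%:C - (p m)%:C by ring.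
  move=> h3; have : B * nm ((p n)%:C - (p m)%:C) <= B * (p n0 + p n0).
    by rewrite ler_wpM2l//; lra.
  lra.
exists l => w wc wr; rewrite leNgt; apply/negP => hlt.
pose e := (nm (f w - l) - B * nm (w - c)) / 2.
have e0 : 0 < e by rewrite divr_gt0// subr_gt0.
have [n0 hn0] := (cvgn_nmP _ _).1 hl _ e0.
have [n1 hn1] := psmall _ e0.
have m0 := hn0 _ (leq_maxl n0 n1).
have m1 := pmono _ _ (leq_maxr n0 n1).
set m := maxn n0 n1 in m0 m1.
have := hf _ _ wc (pc m) wr; rewrite nmp pr => /(_ isT).
have := nmD (f w - f (c + (p m)%:C)) (f (c + (p m)%:C) - l); rewrite addrA subrK.
have : nm (w - (c + (p m)%:C)) <= nm (w - c) + p m.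
  rewrite opprD addrA (le_trans (nmB _ _))// nmr ger0_norm//.
  exact: ltW.
move=> h1 h2 h3.
have h4 : B * nm (w - (c + (p m)%:C)) <= B * (nm (w - c) + p n1).
  by rewrite ler_wpM2l//; lra.
by move: e0 hn1 m0; rewrite /e; lra.
Qed.

(** Being Lipschitz, f has a limit l at c; the quotient (f - l) / (w - c) is bounded by
    the same Lipschitz constant, hence Lipschitz with a limit as well, which is the derivative. *)
Lemma removable f c r B : 0 < r ->
  (forall w, w != c -> nm (w - c) <= r -> cdiff f w) ->
  (forall w, w != c -> nm (w - c) <= r -> nm (f w) <= B) ->
  exists l, cdiff (fun w => if w == c then l else f w) c.
Proof.
move=> r0 df hB.
have B0 : 0 <= B.
  have := hB (c + r%:C); rewrite -subr_eq0 addrAC subrr add0r nmr ger0_norm ?(ltW r0)//.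
  rewrite -nm_gt0 nmr ger0_norm ?(ltW r0)// => /(_ r0 (lexx _)).
  by apply: le_trans; exact: nm_ge0.
have r20 : 0 < r / 2 by rewrite divr_gt0.
have r40 : 0 < r / 2 / 2 by rewrite divr_gt0.
have L0 : 0 <= 4 * B / r by rewrite divr_ge0 ?mulr_ge0// ltW.
have [l hl] := lipschitz_limit r20 L0 (punctured_lipschitz r0 df hB).
pose K w := (f w - l) / (w - c).
have dK w : w != c -> nm (w - c) <= r / 2 -> cdiff K w.
  move=> wc wr; apply: cdiff_div; first by rewrite subr_eq0.
    by apply: cdiffB; [apply: df => //; lra|exact: cdiff_cst].
  by apply: cdiffB; [exact: cdiff_id|exact: cdiff_cst].
have bK w : w != c -> nm (w - c) <= r / 2 -> nm (K w) <= 4 * B / r.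
  move=> wc wr; rewrite nmM nmV ler_pdivrMr ?hl//.
  by rewrite nm_gt0 subr_eq0.
have L1 : 0 <= 4 * (4 * B / r) / (r / 2) by rewrite divr_ge0 ?(ltW r20)// mulr_ge0.
have [l2 hl2] := lipschitz_limit r40 L1 (punctured_lipschitz r20 dK bK).
exists l; exists (fun w => if w == c then l2 else K w); last first.
  move=> w; rewrite eqxx; have [->|wc] := eqVneq w c; first by rewrite subrr mulr0 addr0.
  by rewrite /K divfK ?subr_eq0// addrC subrK.
set L := 4 * _ / _ in L1 hl2.
move=> e e0; exists (Num.min (r / 2 / 2) (e / (L + 1))).
  by rewrite lt_min r40 divr_gt0// ltr_wpDl.
move=> w; rewrite lt_min eqxx => /andP[w1 w2].
have [_|wc] := eqVneq w c; first by rewrite subrr nm0.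
rewrite (le_lt_trans (hl2 _ wc (ltW w1)))//.
move: w2; rewrite ltr_pdivlMr ?ltr_wpDl//; apply: le_lt_trans.
by rewrite mulrC ler_wpM2l ?nm_ge0// lerDl.
Qed.

(** At z the difference quotient has a removable singularity; its value there is
    replaced, which the factor w - z hides. *)
Lemma dslope_exists f c r z : nm (z - c) < r ->
  (forall w, nm (w - c) <= r -> cdiff f w) ->
  exists2 s : R[i] -> R[i], (forall w, nm (w - c) <= r -> cdiff s w) &
    forall w, f w = f z + s w * (w - z).
Proof.
move=> zr df.
have [g cg hg] := df z (ltW zr).
have dg w : w != z -> nm (w - c) <= r -> cdiff g w.
  move=> wz wr.
  have n0 : 0 < nm (w - z) by rewrite nm_gt0 subr_eq0.
  apply: (@cdiff_near _ (fun v => (f v - f z) / (v - z)) g w _ n0).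
    move=> v vw; have vz : v != z by apply/eqP => vz; move: vw; rewrite vz nmBC ltxx.
    by rewrite hg addrAC subrr add0r mulfK// subr_eq0.
  apply: cdiff_div; first by rewrite subr_eq0.
    by apply: cdiffB; [exact: df|exact: cdiff_cst].
  by apply: cdiffB; [exact: cdiff_id|exact: cdiff_cst].
have [d d0 hd] := cg _ ltr01.
pose p := Num.min (d / 2) (r - nm (z - c)).
have p0 : 0 < p by rewrite lt_min divr_gt0//= subr_gt0.
have pd : p <= d / 2 by rewrite ge_min lexx.
have pr : p <= r - nm (z - c) by rewrite ge_min lexx orbT.
have [l dl] : exists l, cdiff (fun w => if w == z then l else g w) z.
  apply: (@removable g z p (nm (g z) + 1) p0) => w wz wp.
    by apply: dg => //; have := nmD (w - z) (z - c); rewrite addrA subrK; lra.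
  by have := hd w ltac:(lra); have := nmD (g w - g z) (g z); rewrite subrK; lra.
exists (fun w => if w == z then l else g w) => [w wr|w].
  have [->//|wz] := eqVneq w z.
  have n0 : 0 < nm (w - z) by rewrite nm_gt0 subr_eq0.
  apply: (cdiff_near n0 _ (dg w wz wr)) => v vw.
  by case: eqP => // vz; move: vw; rewrite vz nmBC ltxx.
case: eqP => [->|_]; first by rewrite subrr mulr0 addr0.
exact: hg.
Qed.

(** The difference quotients of the approximants at c are bounded by the maximum principle,
    hence Lipschitz uniformly in n. So is their pointwise limit, which therefore extends
    continuously to c. No uniform convergence is involved. *)
Lemma cdiff_lim (u : nat -> R[i] -> R[i]) f c r B : 0 < r ->
  (forall n w, nm (w - c) <= r -> cdiff (u n) w) ->
  (forall n w, nm (w - c) <= r -> nm (u n w) <= B) ->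
  (forall w, nm (w - c) <= r -> u ^~ w @ \oo --> f w) ->
  cdiff f c.
Proof.
move=> r0 du hB cu.
have cc : nm (c - c) <= r by rewrite subrr nm0 ltW.
have B0 : 0 <= B by rewrite (le_trans _ (hB 0%N _ cc))// nm_ge0.
have r20 : 0 < r / 2 by rewrite divr_gt0.
pose K n w := (u n w - u n c) / (w - c).
have dK n w : w != c -> nm (w - c) <= r -> cdiff (K n) w.
  move=> wc wr; apply: cdiff_div; first by rewrite subr_eq0.
    by apply: cdiffB; [exact: du|exact: cdiff_cst].
  by apply: cdiffB; [exact: cdiff_id|exact: cdiff_cst].
have bK n w : w != c -> nm (w - c) <= r -> nm (K n w) <= 2 * B / r.
  move=> wc wr.
  have near_c : exists2 d, 0 < d & exists M, forall w, w != c -> w != c ->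
      nm (w - c) < d -> nm (K n w) <= M.
    have [g cg hg] := du n c cc.
    have [d d0 hd] := cg _ ltr01.
    exists d => //; exists (nm (g c) + 1) => v vc _ vd.
    rewrite /K hg addrAC subrr add0r mulfK ?subr_eq0//.
    by have := hd _ vd; have := nmD (g v - g c) (g c); rewrite subrK; lra.
  apply: (@max_modulus_except (K n) c r (2 * B / r) c c) => //.
  - by rewrite subrr nm0.
  - by rewrite subrr nm0.
  - by move=> v vr vc _; exact: dK.
  move=> v vr; rewrite /K nmM nmV vr ler_pM2r ?invr_gt0//.
  rewrite (le_trans (nmB _ _))//.
  have := hB n v; rewrite vr => /(_ (lexx _)).
  by have := hB n c cc; lra.
have lipK n := punctured_lipschitz r0 (dK n) (bK n).
have L1 : 0 <= 4 * (2 * B / r) / r.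
  by rewrite divr_ge0 ?(ltW r0)// mulr_ge0// divr_ge0 ?(ltW r0)// mulr_ge0.
pose Kf w := (f w - f c) / (w - c).
have cK w : nm (w - c) <= r -> K ^~ w @ \oo --> Kf w.
  move=> wr; apply/cvgn_nmP => e e0.
  have [->|wc] := eqVneq w c.
    by exists 0%N => n _; rewrite /K /Kf !subrr ?mul0r ?subrr nm0.
  have n0 : 0 < nm (w - c) by rewrite nm_gt0 subr_eq0.
  have e'0 : 0 < e * nm (w - c) / 2 by rewrite divr_gt0// mulr_gt0.
  have [n1 h1] := (cvgn_nmP _ _).1 (cu w wr) _ e'0.
  have [n2 h2] := (cvgn_nmP _ _).1 (cu c cc) _ e'0.
  exists (maxn n1 n2) => n; rewrite geq_max => /andP[/h1 {}h1 /h2 {}h2].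
  rewrite /K /Kf -mulrBl nmM nmV ltr_pdivrMr//.
  have -> : u n w - u n c - (f w - f c) = (u n w - f w) - (u n c - f c) by ring.
  by rewrite (le_lt_trans (nmB _ _))//; lra.
have lipf w v : w != c -> v != c -> nm (w - c) <= r / 2 -> nm (v - c) <= r / 2 ->
    nm (Kf w - Kf v) <= 4 * (2 * B / r) / r * nm (w - v).
  move=> wc vc wr vr.
  have wr' : nm (w - c) <= r by lra.
  have vr' : nm (v - c) <= r by lra.
  rewrite leNgt; apply/negP => hlt.
  have e0 : 0 < (nm (Kf w - Kf v) - 4 * (2 * B / r) / r * nm (w - v)) / 2.
    by rewrite divr_gt0// subr_gt0.
  have [n1 h1] := (cvgn_nmP _ _).1 (cK w wr') _ e0.
  have [n2 h2] := (cvgn_nmP _ _).1 (cK v vr') _ e0.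
  have {}h1 := h1 _ (leq_maxl n1 n2); have {}h2 := h2 _ (leq_maxr n1 n2).
  have := lipK (maxn n1 n2) _ _ wc vc wr vr.
  move: h1 h2; set a1 := K _ w; set a2 := K _ v => h1 h2.
  have := nmD (Kf w - a1) (a1 - a2); have := nmD (Kf w - a1 + (a1 - a2)) (a2 - Kf v).
  have -> : Kf w - a1 + (a1 - a2) + (a2 - Kf v) = Kf w - Kf v by ring.
  by rewrite (nmBC (Kf w) a1); lra.
have [l hl] := lipschitz_limit r20 L1 lipf.
exists (fun w => if w == c then l else Kf w); last first.
  move=> w; have [->|wc] := eqVneq w c; first by rewrite subrr mulr0 addr0.
  by rewrite /Kf divfK ?subr_eq0// addrC subrK.
set L := 4 * _ / _ in L1 hl.
move=> e e0; exists (Num.min (r / 2) (e / (L + 1))).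
  by rewrite lt_min r20 divr_gt0// ltr_wpDl.
move=> w; rewrite lt_min eqxx => /andP[w1 w2].
have [_|wc] := eqVneq w c; first by rewrite subrr nm0.
rewrite (le_lt_trans (hl _ wc (ltW w1)))//.
move: w2; rewrite ltr_pdivlMr ?ltr_wpDl//; apply: le_lt_trans.
by rewrite mulrC ler_wpM2l ?nm_ge0// lerDl.
Qed.

End MaxModulus.

(** * Zeros and local bounds of holomorphic functions *)

Section Zeros.
Variable R : realType.
Implicit Types (x y e t r B : R) (z w c a b : R[i]) (f g : R[i] -> R[i]).

Lemma conjcM z w : (z * w)^* = z^* * w^*.
Proof. exact: rmorphM. Qed.

Lemma conjcB z w : (z - w)^* = z^* - w^*.
Proof. exact: rmorphB. Qed.

Lemma conjcV z : (z^-1)^* = (z^*)^-1.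
Proof. exact: fmorphV. Qed.

Lemma conjc_invol z : (z^*)^* = z.
Proof. exact: conjcK. Qed.

Lemma conjc_realE x : (x%:C)^* = x%:C :> R[i].
Proof. exact: conjc_real. Qed.

Lemma conjc_natE n : (n%:R)^* = n%:R :> R[i].
Proof. exact: conjc_nat. Qed.

Lemma conjcX z n : (z ^+ n)^* = z^* ^+ n.
Proof. exact: rmorphXn. Qed.

Lemma conjc_sum (I : Type) (s : seq I) (P : pred I) (F : I -> R[i]) :
  (\sum_(i <- s | P i) F i)^* = \sum_(i <- s | P i) (F i)^*.
Proof. exact: rmorph_sum. Qed.

Lemma bounded_on_disc f c r : 0 <= r ->
  (forall w, nm (w - c) <= r -> cdiff f w) ->
  exists2 B, 0 <= B & forall w, nm (w - c) <= r -> nm (f w) <= B.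
Proof.
move=> r0 df.
have [z zr hz] := @cdisc_max R c r (fun w => nm (f w)) r0
  (fun w wr => ccont_nm (cdiff_cont (df w wr))).
by exists (nm (f z)); rewrite ?nm_ge0.
Qed.

(** If f = (w - c)^k g then |g| <= B / r^k by the maximum principle, hence
    |f(w)| <= B (|w - c| / r)^k for every k. *)
Lemma zero_of_all_orders f c r : 0 < r ->
  (forall w, nm (w - c) <= r -> cdiff f w) ->
  (forall k, exists2 g, (forall w, nm (w - c) <= r -> cdiff g w) &
     forall w, nm (w - c) <= r -> w != c -> f w = (w - c) ^+ k * g w) ->
  forall w, nm (w - c) < r -> w != c -> f w = 0.
Proof.
move=> r0 df hg w wr wc; apply/eqP; rewrite -nm_eq0 eq_le nm_ge0 andbT.
rewrite leNgt; apply/negP => fw0.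
have [B B0 hB] := bounded_on_disc (ltW r0) df.
have B10 : 0 < B + 1 by lra.
have [k hk] : exists k, (nm (w - c) / r) ^+ k < nm (f w) / (B + 1).
  apply: geometric_small; last by rewrite divr_gt0.
  by rewrite divr_ge0 ?nm_ge0 ?(ltW r0)//= ltr_pdivrMr// mul1r.
have [g dg fg] := hg k.
have gB v : nm (v - c) = r -> nm (g v) <= B / r ^+ k.
  move=> vr; rewrite ler_pdivlMr ?exprn_gt0//.
  have vc : v != c by apply/eqP => vc; move: vr r0; rewrite vc subrr nm0 => <-; rewrite ltxx.
  by have := hB v; rewrite fg ?vr// nmM nmX vr mulrC; apply.
have := max_modulus r0 dg gB (ltW wr).
have := fg w (ltW wr) wc => fe.
move: hk; rewrite ltr_pdivlMr// {1}fe nmM nmX expr_div_n => h1 h2.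
have p0 : 0 <= nm (w - c) ^+ k by rewrite exprn_ge0// nm_ge0.
have rk : 0 < r ^+ k by rewrite exprn_gt0.
have : nm (w - c) ^+ k * nm (g w) <= nm (w - c) ^+ k * (B / r ^+ k) by rewrite ler_wpM2l.
have -> : nm (w - c) ^+ k * (B / r ^+ k) = nm (w - c) ^+ k / r ^+ k * B by field; rewrite gt_eqF.
have : 0 <= nm (w - c) ^+ k / r ^+ k by rewrite divr_ge0 ?(ltW rk).
lra.
Qed.

Lemma identity_disc f c r d : 0 < r -> 0 < d ->
  (forall w, nm (w - c) <= r -> cdiff f w) ->
  (forall w, nm (w - c) < d -> f w = 0) ->
  forall w, nm (w - c) < r -> f w = 0.
Proof.
move=> r0 d0 df f0 w wr.
have [->|wc] := eqVneq w c; first by apply: f0; rewrite subrr nm0.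
apply: (zero_of_all_orders r0 df) => // k.
exists (fun v => f v / (v - c) ^+ k) => [v vr|v vr vc]; last first.
  by rewrite mulrC divfK// expf_neq0// subr_eq0.
have [->|vc] := eqVneq v c; last first.
  apply: cdiff_div; first by rewrite expf_neq0// subr_eq0.
    exact: df.
  by apply: cdiffX; apply: cdiffB; [exact: cdiff_id|exact: cdiff_cst].
apply: (@cdiff_near _ (fun=> 0) _ c _ d0); last exact: cdiff_cst.
by move=> u ud; rewrite f0// mul0r.
Qed.

(** If zeros accumulate at c, the factor w - c can be split off arbitrarily often, and f
    vanishes on the disc by [zero_of_all_orders]. *)
Lemma isolated_zeros f c r : 0 < r ->
  (forall w, nm (w - c) <= r -> cdiff f w) ->
  (exists2 w, nm (w - c) < r /\ w != c & f w != 0) ->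
  exists2 d, 0 < d & forall w, w != c -> nm (w - c) < d -> f w != 0.
Proof.
move=> r0 df [w0 [w0r w0c] fw0]; apply: contrapT => hn.
have cc : nm (c - c) <= r by rewrite subrr nm0 ltW.
move/negP: fw0; apply; apply/eqP; apply: (zero_of_all_orders r0 df) => //.
elim=> [|k [g dg fg]].
  by exists f => // w _ _; rewrite expr0 mul1r.
have gc : g c = 0.
  apply: contrapT => /eqP gc; apply: hn.
  have [d d0 hd] := ccont_nz (cdiff_cont (dg c cc)) gc.
  exists (Num.min d r); first by rewrite lt_min d0.
  move=> w wc; rewrite lt_min => /andP[wd wr].
  by rewrite fg ?(ltW wr)// mulf_neq0 ?hd// expf_neq0// subr_eq0.
have cr : nm (c - c) < r by rewrite subrr nm0.
have [s ds hs] := dslope_exists cr dg.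
exists s => // w wr wc.
by rewrite fg// hs gc add0r exprSr -mulrA [s w * _]mulrC.
Qed.

(** Cauchy's formula for circle means. The kernel k(w) = (w - c) / (w - z) has modulus at
    most 2, the function (w - c) (f(w) - f(z)) / (w - z) has mean close to its value 0 at
    the centre, and k has mean close to 1 because on the circle it is the conjugate of a
    holomorphic function equal to 1 at the centre. The bound is by an average, so it can
    be combined with mean values in t. *)
Lemma cauchy_mean_bound f c r z : 0 < r ->
  (forall w, nm (w - c) <= r -> cdiff f w) -> nm (z - c) <= r / 2 ->
  forall e, 0 < e -> exists n0, forall n, (n0 <= n)%N ->
    nm (f z) <= 2 * rmean n (fun w => nm (f w)) c r + e.
Proof.
move=> r0 df zr e e0.
have zr' : nm (z - c) < r by lra.
have [s ds hs] := dslope_exists zr' df.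
pose q := z - c.
pose G w := (w - c) * s w.
have dG w : nm (w - c) <= r -> cdiff G w.
  move=> wr; apply: cdiffM; last exact: ds.
  by apply: cdiffB; [exact: cdiff_id|exact: cdiff_cst].
have qr w : nm (w - c) <= r -> nm (q^* * (w - c)) <= r ^+ 2 / 2.
  move=> wr; rewrite nmM nm_conj.
  have -> : r ^+ 2 / 2 = r / 2 * r by ring.
  by rewrite ler_pM ?nm_ge0.
have r20 : 0 < r ^+ 2 by rewrite exprn_gt0.
have den w : nm (w - c) <= r -> (r ^+ 2)%:C - q^* * (w - c) != 0.
  move=> /qr h; rewrite -nm_gt0.
  have := nm_lB (r ^+ 2)%:C (q^* * (w - c)); rewrite nmr ger0_norm ?(ltW r20)//; lra.
(* The holomorphic function conjugate to the kernel on the circle, where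
   (w - c) (w - c)^* = r^2. *)
pose H w := (r ^+ 2)%:C / ((r ^+ 2)%:C - q^* * (w - c)).
have dH w : nm (w - c) <= r -> cdiff H w.
  move=> wr; apply: cdiff_div; [exact: den|exact: cdiff_cst|].
  apply: cdiffB; first exact: cdiff_cst.
  apply: cdiffM; first exact: cdiff_cst.
  by apply: cdiffB; [exact: cdiff_id|exact: cdiff_cst].
have Hc : H c = 1 by rewrite /H subrr mulr0 subr0 divff// -nm_gt0 nmr ger0_norm// ltW.
have Gc : G c = 0 by rewrite /G subrr mul0r.
pose k w := (w - c) / (w - z).
have wz w : nm (w - c) = r -> w - z != 0.
  move=> wr; rewrite -nm_gt0; have := nm_lB (w - c) (z - c).
  by rewrite opprB addrA subrK wr; lra.
have kH w : nm (w - c) = r -> k w = (H w)^*.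
  move=> wr; rewrite /k /H.
  have e1 : (r ^+ 2)%:C = (w - c) * (w - c)^* by rewrite -nm_sqc wr.
  have c0 : (w - c)^* != 0 by rewrite conjc_eq0 -nm_gt0 wr.
  rewrite conjcM conjcV conjcB conjcM conjc_invol conjc_realE e1.
  rewrite -mulrBl /q opprB addrA subrK invfM.
  by rewrite mulrACA divff// mulr1.
have kle w : nm (w - c) = r -> nm (k w) <= 2.
  move=> wr; rewrite nmM nmV wr ler_pdivrMr ?nm_gt0 ?wz//.
  have := nm_lB (w - c) (z - c); rewrite opprB addrA subrK wr; lra.
pose A := nm (f z) + 1.
have A0 : 0 < A by rewrite /A; have := nm_ge0 (f z); lra.
have ea0 : 0 < e / (2 * A) by rewrite divr_gt0// mulr_gt0.
have e20 : 0 < e / 2 by rewrite divr_gt0.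
have [n1 h1] := mean_value r0 dG e20.
have [n2 h2] := mean_value r0 dH ea0.
exists (maxn n1 n2) => n; rewrite geq_max => /andP[/h1 {}h1 /h2 {}h2].
rewrite Gc subr0 in h1; rewrite Hc in h2.
have eqG : cmean n G c r = cmean n (fun w => k w * f w) c r - f z * cmean n k c r.
  rewrite -cmeanZ -cmeanB /cmean; congr (_ * _); apply: eq_bigr => j _.
  have wr := nm_circle c n j (ltW r0).
  move: wr; set w := c + _ => wr.
  by rewrite /G /k hs; field; exact: wz.
have eqk : cmean n k c r = (cmean n H c r)^*.
  rewrite /cmean conjcM conjcV conjcX conjc_natE conjc_sum; congr (_ * _).
  by apply: eq_bigr => j _; apply: kH; apply: nm_circle; exact: ltW.
have h3 : nm (cmean n k c r - 1) <= e / (2 * A).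
  by rewrite eqk -nm_conj conjcB conjc_invol (conjc_natE 1).
have h4 : nm (cmean n (fun w => k w * f w) c r) <= 2 * rmean n (fun w => nm (f w)) c r.
  rewrite (le_trans (nm_cmean _ _ _ _))// -rmeanZ.
  apply: rmean_le => [|w wr]; first exact: ltW.
  by rewrite nmM ler_wpM2r ?nm_ge0 ?kle.
have -> : f z = cmean n (fun w => k w * f w) c r - cmean n G c r
   - f z * (cmean n k c r - 1) by rewrite eqG; ring.
have h5 : nm (f z * (cmean n k c r - 1)) <= e / 2.
  rewrite nmM; have -> : e / 2 = A * (e / (2 * A)) by field; rewrite gt_eqF.
  by apply: ler_pM; rewrite ?nm_ge0// /A lerDl.
have := nmB (cmean n (fun w => k w * f w) c r - cmean n G c r) (f z * (cmean n k c r - 1)).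
have := nmB (cmean n (fun w => k w * f w) c r) (cmean n G c r).
lra.
Qed.

(** The Cauchy-Schwarz inequality, as positivity of the variance. *)
Lemma rmean_sq_le n (g : R[i] -> R) c r : (rmean n g c r) ^+ 2 <= rmean n (fun w => g w ^+ 2) c r.
Proof.
rewrite /rmean.
have n0 : 0 < (2 : R) ^+ n by rewrite exprn_gt0.
pose m := (2 ^+ n)^-1 * \sum_(k < 2 ^ n) g (c + r%:C * root_pt R n k).
rewrite -/m.
have : 0 <= \sum_(k < 2 ^ n) (g (c + r%:C * root_pt R n k) - m) ^+ 2.
  by apply: sumr_ge0 => k _; exact: sqr_ge0.
have -> : \sum_(k < 2 ^ n) (g (c + r%:C * root_pt R n k) - m) ^+ 2 =
  \sum_(k < 2 ^ n) g (c + r%:C * root_pt R n k) ^+ 2 - 2 ^+ n * m ^+ 2.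
  transitivity (\sum_(k < 2 ^ n) (g (c + r%:C * root_pt R n k) ^+ 2 +
     (- (2 * m)) * g (c + r%:C * root_pt R n k) + m ^+ 2)).
    by apply: eq_bigr => k _; ring.
  rewrite !big_split /= -mulr_sumr sumr_const card_ord -[m ^+ 2 *+ _]mulr_natr natrX.
  have -> : \sum_(k < 2 ^ n) g (c + r%:C * root_pt R n k) = 2 ^+ n * m.
    by rewrite /m mulrA divff ?mul1r// gt_eqF.
  by ring.
by rewrite subr_ge0 ler_pdivlMl.
Qed.

End Zeros.

(** * The powers n^-s *)

Section Dirichlet.
Variable R : realType.
Implicit Types (x y e t r a b : R) (z w s : R[i]).

(** The exponents carry the sign of Dirichlet series: [ipow n s] is n^-s and [rpow n x] is
    n^-x. *)
Definition ipow (n : nat) s : R[i] := cexp (- (s * (ln (n%:R : R))%:C)).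
Definition rpow (n : nat) x : R := expR (- (x * ln (n%:R : R))).

Lemma Re_opp_scale s x : Re (- (s * x%:C)) = - (Re s * x).
Proof. by case: s => u v /=; ring. Qed.

Lemma Im_opp_scale s x : Im (- (s * x%:C)) = - (Im s * x).
Proof. by case: s => u v /=; ring. Qed.

Lemma natcpowV n s : (natcpow n s)^-1 = ipow n s.
Proof. by rewrite /natcpow /ipow cexpN. Qed.

Lemma nm_ipow n s : nm (ipow n s) = rpow n (Re s).
Proof.
by rewrite nm_cexp Re_opp_scale.
Qed.

Lemma ipow1 s : ipow 1 s = 1.
Proof. by rewrite /ipow ln1 mulr0 oppr0 cexp0. Qed.

Lemma rpow1 x : rpow 1 x = 1.
Proof. by rewrite /rpow ln1 mulr0 oppr0 expR0. Qed.

Lemma rpow_gt0 n x : 0 < rpow n x.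
Proof. exact: expR_gt0. Qed.

Lemma rpow_ge0 n x : 0 <= rpow n x.
Proof. exact: expR_ge0. Qed.

Lemma lnM_nat m n : (0 < m)%N -> (0 < n)%N ->
  ln ((m * n)%:R : R) = ln (m%:R : R) + ln (n%:R : R).
Proof. by move=> m0 n0; rewrite natrM lnM// posrE ltr0n. Qed.

Lemma ipowM m n s : (0 < m)%N -> (0 < n)%N -> ipow (m * n) s = ipow m s * ipow n s.
Proof.
by move=> m0 n0; rewrite /ipow lnM_nat// rmorphD /= -cexpD; congr cexp; ring.
Qed.

Lemma ipowD n s z : ipow n (s + z) = ipow n s * ipow n z.
Proof. by rewrite /ipow -cexpD; congr cexp; ring. Qed.

Lemma rpowD n x y : rpow n (x + y) = rpow n x * rpow n y.
Proof. by rewrite /rpow -expRD; congr expR; ring. Qed.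

Lemma ipow2 n s : ipow n (2 * s) = ipow n s ^+ 2.
Proof. by rewrite /ipow -cexpMn; congr cexp; ring. Qed.

Lemma ipow_it n t : ipow n ('i * t%:C) = cis (- (t * ln (n%:R : R))).
Proof. by rewrite /ipow -mulrA -rmorphM -mulrN -rmorphN cexp_cis. Qed.

Lemma ipow_real n x : ipow n x%:C = (rpow n x)%:C.
Proof. by rewrite /ipow -rmorphM -rmorphN cexp_real. Qed.

Lemma cdiff_ipow n s : cdiff (ipow n) s.
Proof.
apply: (@cdiff_comp _ (@cexp R)); first exact: cdiff_cexp.
by apply: cdiffN; apply: cdiffM; [exact: cdiff_id|exact: cdiff_cst].
Qed.

Lemma ln_nat_ge0 n : 0 <= ln (n%:R : R).
Proof. by case: n => [|n]; [rewrite ln0|rewrite ln_ge0// ler1n]. Qed.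

Lemma ler_ln_nat m n : (0 < m)%N -> (m <= n)%N -> ln (m%:R : R) <= ln (n%:R : R).
Proof. by move=> m0 mn; rewrite ler_ln ?posrE ?ltr0n ?ler_nat// (leq_trans m0). Qed.

Lemma rpow_le m n x : 0 <= x -> (0 < m)%N -> (m <= n)%N -> rpow n x <= rpow m x.
Proof. by move=> x0 m0 mn; rewrite ler_expR lerN2 ler_wpM2l// ler_ln_nat. Qed.

Lemma rpow_le1 n x : 0 <= x -> rpow n x <= 1.
Proof. by move=> x0; rewrite -expR0 ler_expR oppr_le0 mulr_ge0// ln_nat_ge0. Qed.

Lemma rpow_antimono n x y : x <= y -> rpow n y <= rpow n x.
Proof. by move=> xy; rewrite ler_expR lerN2 ler_wpM2r// ln_nat_ge0. Qed.

Lemma rpow_x1 n : (0 < n)%N -> rpow n 1 = n%:R^-1.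
Proof. by move=> n0; rewrite /rpow mul1r expRN lnK// posrE ltr0n. Qed.

Lemma rpow_sq n x : rpow n x ^+ 2 = rpow n (2 * x).
Proof. by rewrite expr2 -rpowD; congr rpow; ring. Qed.

(** The bound is a difference, so that sums of such terms telescope. *)
Lemma cexp_diff a b s : 0 < Re s -> a <= b ->
  nm (cexp (- (s * a%:C)) - cexp (- (s * b%:C))) <=
  (1 + `|Im s| / Re s) * (expR (- (Re s * a)) - expR (- (Re s * b))).
Proof.
move=> s0 ab; set sg := Re s in s0 *; set t := Im s.
pose d := b - a; have d0 : 0 <= d by rewrite subr_ge0.
have -> : cexp (- (s * b%:C)) = cexp (- (s * a%:C)) * cexp (- (s * d%:C)).
  by rewrite -cexpD; congr cexp; rewrite /d rmorphB /=; ring.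
have -> : expR (- (sg * b)) = expR (- (sg * a)) * expR (- (sg * d)).
  by rewrite -expRD; congr expR; rewrite /d; ring.
rewrite -{1}[cexp _]mulr1 -mulrBr nmM nm_cexp -[X in _ <= _ * (X - _)]mulr1 -mulrBr mulrCA.
rewrite Re_opp_scale ler_pM2l ?expR_gt0//.
have -> : 1 - cexp (- (s * d%:C)) = (1 - expR (- (sg * d)))%:C
   - (expR (- (sg * d)))%:C * (cis (- (t * d)) - 1).
  rewrite cexpE Re_opp_scale Im_opp_scale -/sg -/t.
  by move: (expR _) (cis _) => p q; rewrite rmorphB /=; ring.
have e1 : expR (- (sg * d)) <= 1 by rewrite expR_le1 oppr_le0 mulr_ge0// ltW.
rewrite (le_trans (nmB _ _))// nmM !nmr ger0_norm ?subr_ge0// ger0_norm ?expR_ge0//.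
rewrite mulrDl mul1r lerD2l.
have h1 := nm_cis_sub1 (- (t * d)).
rewrite normrN normrM (ger0_norm d0) in h1.
have h2 : expR (- (sg * d)) * (sg * d) <= 1 - expR (- (sg * d)).
  have := expR_ge1Dx (sg * d); have := expR_gt0 (- (sg * d)).
  have : expR (- (sg * d)) * expR (sg * d) = 1 by rewrite -expRD addNr expR0.
  nra.
have t0 := normr_ge0 t.
apply: (@le_trans _ _ (expR (- (sg * d)) * (`|t| * d))).
  by rewrite ler_wpM2l ?expR_ge0.
rewrite mulrAC ler_pdivlMr//.
have : `|t| * (expR (- (sg * d)) * (sg * d)) <= `|t| * (1 - expR (- (sg * d))) by rewrite ler_wpM2l.
lra.
Qed.

Lemma ipow_diff m n s : 0 < Re s -> (0 < m)%N -> (m <= n)%N ->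
  nm (ipow m s - ipow n s) <= (1 + `|Im s| / Re s) * (rpow m (Re s) - rpow n (Re s)).
Proof. by move=> s0 m0 mn; apply: cexp_diff => //; exact: ler_ln_nat. Qed.

(** The integral test in discrete form: k^-(1+a) is at most the difference of two
    consecutive values of k^-a / a. *)
Lemma rpow_tail a m n : 0 < a -> (0 < m)%N ->
  \sum_(m.+1 <= k < n) rpow k (1 + a) <= rpow m a / a.
Proof.
move=> a0 m0.
have step k : (0 < k)%N -> rpow k.+1 (1 + a) <= (rpow k a - rpow k.+1 a) / a.
  move=> k0; rewrite ler_pdivlMr// rpowD rpow_x1//.
  pose d := ln (k.+1%:R : R) - ln (k%:R : R).
  have k0' : (0 : R) < k%:R by rewrite ltr0n.
  have dk : (k.+1%:R : R)^-1 <= d.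
    have -> : d = - ln (k%:R / k.+1%:R).
      by rewrite ln_div ?posrE ?ltr0n// /d; ring.
    have := @le_ln1Dx R (- (k.+1%:R)^-1).
    rewrite ltrN2 invf_lt1 ?ltr0n// ltr1n ltnS => /(_ k0).
    have -> : 1 - (k.+1%:R : R)^-1 = k%:R / k.+1%:R.
      by rewrite -natr1; field; rewrite natr1 pnatr_eq0.
    by rewrite lerNr.
  have -> : rpow k a = rpow k.+1 a * expR (a * d).
    by rewrite /rpow -expRD; congr expR; rewrite /d; ring.
  have h1 : a * (k.+1%:R)^-1 <= a * d by rewrite ler_wpM2l// ltW.
  have h2 := expR_ge1Dx (a * d).
  move: h1 h2 (rpow_gt0 k.+1 a); move: (_%:R^-1) (expR _) (rpow _ _) => i E r h1 h2 h3.
  by nra.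
have [nm'|mn] := leqP n m.+1.
  by rewrite big_geq// divr_ge0 ?rpow_ge0// ltW.
apply: (@le_trans _ _ (\sum_(m.+1 <= k < n) (rpow k.-1 a - rpow k a) / a)).
  rewrite big_nat_cond [leRHS]big_nat_cond; apply: ler_sum => -[//|k].
  by rewrite andbT => /andP[mk _]; apply: step; exact: leq_trans m0 _.
rewrite -mulr_suml ler_pM2r ?invr_gt0//.
rewrite big_add1 /= (telescope_sumr_eq (fun k => - rpow k a)).
- by rewrite opprK addrC gerBl rpow_ge0.
- by case: n mn => // n; rewrite ltnS => /ltnW.
by move=> k _; ring.
Qed.

(** Cancellation in the alternating series. Consecutive terms satisfy u(n+1) = - q(n) u(n)
    with q(n) close to 1, hence u(n) = c(n) (u(n) - u(n+1)) with c(n) = 1 / (1 + q(n)), and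
    summation by parts leaves the variation of c. The hypothesis on N keeps
    q(n) in the right half-plane and bounds that variation. *)
Lemma alt_tail s N k : 0 < Re s -> (0 < N)%N -> Re s + `|Im s| <= N%:R ->
  nm (\sum_(j < k) (-1) ^+ (N + j) * ipow (N + j) s) <= 3 * rpow N (Re s).
Proof.
move=> s0 N0 hN.
case: k => [|k]; first by rewrite big_ord0 nm0 mulr_ge0// rpow_ge0.
set sg := Re s in s0 hN *; set t := Im s in hN *.
pose A n : R := ln (n.+1%:R) - ln (n%:R).
pose q n : R[i] := cexp (- (s * (A n)%:C)).
pose u n : R[i] := (-1) ^+ n * ipow n s.
pose c n : R[i] := (1 + q n)^-1.
have A0 n : (0 < n)%N -> 0 <= A n by move=> n0; rewrite subr_ge0 ler_ln_nat.
have A1 n : (0 < n)%N -> A n <= n%:R^-1.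
  move=> n0; have n0' : (0 : R) < n%:R by rewrite ltr0n.
  have -> : A n = ln (1 + n%:R^-1).
    rewrite /A -ln_div ?posrE ?ltr0n//; congr ln; rewrite -natr1; field.
    by rewrite pnatr_eq0 -lt0n.
  by apply: le_ln1Dx; rewrite (lt_trans (ltrN10 _))// invr_gt0.
have qS n : ipow n.+1 s = ipow n s * q n.
  by rewrite /ipow /q -cexpD; congr cexp; rewrite /A rmorphB /=; ring.
have uS n : u n.+1 = - (q n * u n) by rewrite /u qS exprS; ring.
have Req n : (N <= n)%N -> 1 <= nm (1 + q n).
  move=> Nn; have n0 : (0 < n)%N by exact: leq_trans Nn.
  rewrite (le_trans _ (Re_le_nm _))// (le_trans _ (ler_norm _))//.
  have -> : Re (1 + q n) = 1 + Re (q n) by case: (q n).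
  rewrite lerDl /q cexpE.
  rewrite Im_opp_scale -/t.
  rewrite /= mul0r subr0 mulr_ge0 ?expR_ge0// cosN.
  have := cos_ge_quad (t * A n).
  suff : (t * A n) ^+ 2 <= 1 by lra.
  rewrite -sqr_norm expr_le1// normrM (ger0_norm (A0 _ n0)).
  have tn : `|t| <= n%:R by rewrite (le_trans _ (_ : N%:R <= n%:R)) ?ler_nat//; lra.
  have n0' : (0 : R) < n%:R by rewrite ltr0n.
  have -> : (1 : R) = n%:R * n%:R^-1 by rewrite divff// gt_eqF.
  by apply: ler_pM; rewrite ?A0 ?A1.
have cn0 n : (N <= n)%N -> 1 + q n != 0.
  by move=> /Req h; rewrite -nm_gt0; lra.
have cle n : (N <= n)%N -> nm (c n) <= 1.
  by move=> /Req h; rewrite nmV invf_le1//; lra.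
have ule n : (N <= n)%N -> nm (u n) <= rpow N sg.
  move=> Nn; rewrite nmM nmX nmN nm1 expr1n mul1r nm_ipow.
  by apply: rpow_le => //; exact: ltW.
have uc n : (N <= n)%N -> u n + c n * u n.+1 = c n * u n.
  by move=> Nn; rewrite uS /c; field; exact: cn0.
have main : \sum_(j < k.+1) u (N + j)%N + c (N + k)%N * u (N + k).+1 =
   c N * u N + \sum_(j < k) (c (N + j).+1 - c (N + j)%N) * u (N + j).+1.
  elim: k => [|k ih].
    by rewrite big_ord_recl !big_ord0 addn0 !addr0 uc.
  rewrite big_ord_recr /= [in RHS]big_ord_recr /= [RHS]addrA -ih.
  rewrite -addrA addnS uc ?leqW ?leq_addr//; ring.
pose K := 1 + `|t| / sg.
have K0 : 0 <= K by rewrite addr_ge0// divr_ge0// ltW.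
have cdf j : nm (c (N + j).+1 - c (N + j)%N) <=
    K * (expR (- (sg * A (N + j).+1)) - expR (- (sg * A (N + j)%N))).
  have n0 : (0 < N + j)%N by rewrite ltn_addr.
  have h1 := Req _ (leq_addr j N); have h2 := Req _ (leqW (leq_addr j N)).
  rewrite /c (_ : _ - _ = (q (N + j)%N - q (N + j).+1) /
     ((1 + q (N + j).+1) * (1 + q (N + j)%N))); last first.
    by field; rewrite !cn0 ?leqW ?leq_addr.
  rewrite nmM nmV nmM.
  apply: (@le_trans _ _ (nm (q (N + j)%N - q (N + j).+1))).
    rewrite ler_piMr ?nm_ge0// invf_le1; first by rewrite -[leLHS]mulr1 ler_pM.
    by rewrite mulr_gt0//; lra.
  rewrite nmBC; apply: cexp_diff => //.
  have p1 : (0 : R) < (N + j)%:R by rewrite ltr0n.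
  have p2 : (0 : R) < (N + j).+1%:R by rewrite ltr0n.
  have p3 : (0 : R) < (N + j).+2%:R by rewrite ltr0n.
  have : ((N + j)%:R : R) * (N + j).+2%:R <= (N + j).+1%:R * (N + j).+1%:R.
    by rewrite -!natr1; lra.
  rewrite -ler_ln ?posrE ?mulr_gt0// !lnM ?posrE// /A; lra.
have sumle : nm (\sum_(j < k) (c (N + j).+1 - c (N + j)%N) * u (N + j).+1) <= rpow N sg.
  rewrite (le_trans (nm_sum _ _ _))//.
  apply: (@le_trans _ _ (\sum_(j < k) (K * (expR (- (sg * A (N + j).+1))
      - expR (- (sg * A (N + j)%N)))) * rpow N sg)).
    apply: ler_sum => j _; rewrite nmM ler_pM ?nm_ge0//.
    by apply: ule; rewrite leqW// leq_addr.
  rewrite -mulr_suml -mulr_sumr ler_piMl ?rpow_ge0//.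
  have -> : \sum_(j < k) (expR (- (sg * A (N + j).+1)) - expR (- (sg * A (N + j)%N)))
      = expR (- (sg * A (N + k)%N)) - expR (- (sg * A N)).
    elim: k {main} => [|k ih]; first by rewrite big_ord0 addn0 subrr.
    by rewrite big_ord_recr /= ih addnS; ring.
  have e1 : expR (- (sg * A (N + k)%N)) <= 1.
    by rewrite expR_le1 oppr_le0 mulr_ge0 ?(ltW s0)// A0// ltn_addr.
  have e2 := expR_ge1Dx (- (sg * A N)).
  have hA := A1 _ N0.
  have N0' : (0 : R) < N%:R by rewrite ltr0n.
  apply: (@le_trans _ _ (K * (sg * N%:R^-1))).
    rewrite ler_wpM2l//.
    have : sg * A N <= sg * N%:R^-1 by rewrite ler_wpM2l// ltW.
    lra.
  rewrite mulrA ler_pdivrMr// mul1r /K mulrDl mul1r divfK ?gt_eqF//.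
rewrite -[X in nm X](addrK (c (N + k)%N * u (N + k).+1)).
have -> : \sum_(j < k.+1) (-1) ^+ (N + j) * ipow (N + j) s = \sum_(j < k.+1) u (N + j)%N by [].
rewrite main.
have h1 : nm (c N * u N) <= rpow N sg.
  by rewrite nmM -[leRHS]mul1r ler_pM ?nm_ge0 ?cle ?ule.
have h2 : nm (c (N + k)%N * u (N + k).+1) <= rpow N sg.
  by rewrite nmM -[leRHS]mul1r ler_pM ?nm_ge0 ?cle ?ule// ?leqW// leq_addr.
move: h1 h2 sumle; set x1 := c N * _; set x2 := c (N + k)%N * _; set x3 := \sum_(j < k) _.
have := nmB (x1 + x3) x2; have := nmD x1 x3; lra.
Qed.

End Dirichlet.

(** * Limits of complex sequences *)

Section SeqAlg.
Variable R : realType.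
Implicit Types (u v : nat -> R[i]) (z w : R[i]).

Lemma cvgn_cst z : (fun=> z : R[i]) @ \oo --> z.
Proof. by apply/cvgn_nmP => e e0; exists 0%N => n _; rewrite subrr nm0. Qed.

Lemma cvgn_add u v z w : u @ \oo --> z -> v @ \oo --> w ->
  (fun n => u n + v n) @ \oo --> z + w.
Proof.
move=> /cvgn_nmP hu /cvgn_nmP hv; apply/cvgn_nmP => e e0.
have e20 : 0 < e / 2 by rewrite divr_gt0.
have [n1 h1] := hu _ e20; have [n2 h2] := hv _ e20.
exists (maxn n1 n2) => n; rewrite geq_max => /andP[/h1 {}h1 /h2 {}h2].
rewrite (_ : _ - _ = (u n - z) + (v n - w)); last by ring.
have := nmD (u n - z) (v n - w); lra.
Qed.

Lemma cvgn_opp u z : u @ \oo --> z -> (fun n => - u n) @ \oo --> - z.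
Proof.
move=> /cvgn_nmP hu; apply/cvgn_nmP => e /hu [n0 h]; exists n0 => n /h.
by rewrite -opprD nmN.
Qed.

Lemma cvgn_sub u v z w : u @ \oo --> z -> v @ \oo --> w ->
  (fun n => u n - v n) @ \oo --> z - w.
Proof. by move=> hu hv; exact: (cvgn_add hu (cvgn_opp hv)). Qed.

Lemma cvgn_mul u v z w : u @ \oo --> z -> v @ \oo --> w ->
  (fun n => u n * v n) @ \oo --> z * w.
Proof.
move=> /cvgn_nmP hu /cvgn_nmP hv; apply/cvgn_nmP => e e0.
have [d d0 hd] := mul_close z w e0.
have [n1 h1] := hu _ d0; have [n2 h2] := hv _ d0.
exists (maxn n1 n2) => n; rewrite geq_max => /andP[/h1 {}h1 /h2 {}h2].
exact: hd.
Qed.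

Lemma cvgn_shift u z (g : nat -> nat) : (forall n, (n <= g n)%N) ->
  u @ \oo --> z -> (u \o g) @ \oo --> z.
Proof.
move=> hg /cvgn_nmP hu; apply/cvgn_nmP => e /hu [n0 h]; exists n0 => n n0n.
by apply: h; exact: leq_trans (hg n).
Qed.

Lemma cvgn_unique u z w : u @ \oo --> z -> u @ \oo --> w -> z = w.
Proof.
move=> /cvgn_nmP hz /cvgn_nmP hw; apply/eqP; rewrite -subr_eq0 -nm_eq0 eq_le nm_ge0 andbT.
rewrite leNgt; apply/negP => h.
have e0 : 0 < nm (z - w) / 2 by rewrite divr_gt0.
have [n1 h1] := hz _ e0; have [n2 h2] := hw _ e0.
have {}h1 := h1 _ (leq_maxl n1 n2); have {}h2 := h2 _ (leq_maxr n1 n2).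
move: h1 h2; set a := u _ => h1 h2.
have := nmD (z - a) (a - w); rewrite addrA subrK (nmBC z a); lra.
Qed.

Lemma cvgn_limE u z : u @ \oo --> z -> lim (u @ \oo) = z.
Proof.
move=> cu; have cv : cvg (u @ \oo) by apply/cvg_ex; exists z.
exact: (cvgn_unique cv cu).
Qed.

Lemma cvgn_ext u v z : u =1 v -> u @ \oo --> z -> v @ \oo --> z.
Proof. by move=> /funext ->. Qed.

End SeqAlg.

Arguments cvgn_cst {R} z.

(** * The functions eta and zeta *)

Section Zeta.
Variable R : realType.
Implicit Types (x y e t r a b : R) (z w s : R[i]).

Lemma nat_above x : exists n : nat, x < n%:R.
Proof.
have [x0|x0] := lerP 0 x; last by exists 0%N.
by exists (Num.bound x); exact: archi_boundP.
Qed.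

Lemma rpow_small a e : 0 < a -> 0 < e ->
  exists n0, forall n, (n0 <= n)%N -> rpow n a < e.
Proof.
move=> a0 e0; have [n0 hn0] := nat_above (expR (- ln e / a)).
exists n0 => n n0n.
have n0' : (0 : R) < n%:R.
  by rewrite (lt_le_trans (expR_gt0 (- ln e / a)))// (le_trans (ltW hn0))// ler_nat.
rewrite -[e]lnK ?posrE// ltr_expR ltrNl -ltr_pdivrMl//.
rewrite -ltr_expR lnK ?posrE// mulrC (lt_le_trans hn0)// ler_nat//.
Qed.

Definition altsum N s : R[i] := \sum_(1 <= n < N) (-1) ^+ n.+1 * ipow n s.
Definition psum N s : R[i] := \sum_(1 <= n < N.+1) ipow n s.

Lemma altsum_tail s N X : 0 < Re s -> (0 < N)%N -> Re s + `|Im s| <= N%:R ->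
  (N <= X)%N -> nm (altsum X s - altsum N s) <= 3 * rpow N (Re s).
Proof.
move=> s0 N0 hN NX.
have := alt_tail (X - N) s0 N0 hN.
rewrite -nmN -sumrN /altsum (big_cat_nat N0 NX)/= addrAC subrr add0r.
congr (nm _ <= _); rewrite -[in RHS](add0n N) big_addn big_mkord; apply: eq_bigr => j _.
by rewrite addnC exprS; ring.
Qed.

(** The alternating series converges for Re s > 0, which gives access to the strip without
    continuing zeta. *)
Definition eta s : R[i] := get [set z | altsum ^~ s @ \oo --> z].

Lemma cvg_eta s : 0 < Re s -> altsum ^~ s @ \oo --> eta s.
Proof.
move=> s0; rewrite /eta; case: xgetP => [z _ /= //|] h; exfalso.
have [|z hz] := @nm_cauchy_cvg R (altsum ^~ s); last exact: (h z).
move=> e e0.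
have e60 : 0 < e / 6 by rewrite divr_gt0.
have [n0 h0] := rpow_small s0 e60.
have [n1 h1] := nat_above (Re s + `|Im s|).
pose N := (maxn n0 n1).+1.
have hN : Re s + `|Im s| <= N%:R.
  by rewrite (le_trans (ltW h1))// ler_nat leqW// leq_maxr.
have {}h0 := h0 N (leqW (leq_maxl _ _)).
exists N => n m Nn Nm.
have := altsum_tail s0 (ltn0Sn _) hN Nn; have := altsum_tail s0 (ltn0Sn _) hN Nm.
have := nmB (altsum n s - altsum N s) (altsum m s - altsum N s).
rewrite (_ : _ - _ - _ = altsum n s - altsum m s); last by ring.
lra.
Qed.

Lemma eta_approx s N : 0 < Re s -> (0 < N)%N -> Re s + `|Im s| <= N%:R ->
  nm (eta s - altsum N s) <= 3 * rpow N (Re s).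
Proof.
move=> s0 N0 hN.
have hc := cvgn_sub (cvg_eta s0) (cvgn_cst (altsum N s)).
by apply: (cvgn_nm_le hc (n0 := N)) => n Nn; exact: altsum_tail.
Qed.

Lemma cdiff_altsum N s : cdiff (altsum N) s.
Proof.
apply: cdiff_sum => n _; apply: cdiffM; [exact: cdiff_cst|exact: cdiff_ipow].
Qed.

Lemma cdiff_psum N s : cdiff (psum N) s.
Proof. by apply: cdiff_sum => n _; exact: cdiff_ipow. Qed.

Lemma Re_near z w r : nm (w - z) <= r -> Re z - r <= Re w.
Proof.
move=> h; have := le_trans (Re_le_nm _) h; rewrite ler_norml => /andP[h1 _].
have : Re (w - z) = Re w - Re z by case: (w); case: (z).
by move=> h2; rewrite h2 in h1; lra.
Qed.

Lemma Re_near_le z w r : nm (w - z) <= r -> Re w <= Re z + r.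
Proof. by rewrite nmBC => /Re_near; lra. Qed.

Lemma Im_near z w r : nm (w - z) <= r -> `|Im w| <= `|Im z| + r.
Proof.
move=> h; have h1 := le_trans (Im_le_nm _) h.
have h2 : Im (w - z) = Im w - Im z by case: (w); case: (z).
rewrite h2 in h1; have := ler_normD (Im w - Im z) (Im z); rewrite subrK; lra.
Qed.

Lemma nm_altsum_le N w : 0 <= Re w -> nm (altsum N w) <= N%:R.
Proof.
move=> w0; rewrite /altsum (le_trans (nm_sum _ _ _))//.
apply: (@le_trans _ _ (\sum_(1 <= n < N) 1)).
  apply: ler_sum => n _; rewrite nmM nmX nmN nm1 expr1n mul1r nm_ipow.
  exact: rpow_le1.
by rewrite sumr_const_nat ler_nat leq_subr.
Qed.

(** Locally bounded pointwise limits of holomorphic functions are holomorphic. *)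
Lemma cdiff_eta s : 0 < Re s -> cdiff eta s.
Proof.
move=> s0; pose r := Re s / 2.
have r0 : 0 < r by rewrite divr_gt0.
have [N0 hN0] := nat_above (Re s + r + (`|Im s| + r)).
pose N := N0.+1.
have hN : Re s + r + (`|Im s| + r) <= N%:R.
  by rewrite (le_trans (ltW hN0))// ler_nat.
have pos w : nm (w - s) <= r -> 0 < Re w by move=> /Re_near; rewrite /r; lra.
have big w : nm (w - s) <= r -> Re w + `|Im w| <= N%:R.
  by move=> h; have := Re_near_le h; have := Im_near h; lra.
apply: (@cdiff_lim _ (fun n => altsum (N + n)) eta s r (3 + N%:R)) => //.
- by move=> n w _; exact: cdiff_altsum.
- move=> n w wr; have w0 := pos _ wr.
  have h1 := altsum_tail w0 (ltn0Sn _) (big _ wr) (leq_addr n N).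
  have h2 := nm_altsum_le N (ltW w0).
  have h3 := @rpow_le1 _ N _ (ltW w0).
  have := nmD (altsum (N + n) w - altsum N w) (altsum N w); rewrite subrK; lra.
move=> w wr; have := cvg_eta (pos _ wr).
apply: (@cvgn_shift _ (fun n => altsum n w) _ (fun n => N + n)%N) => n; exact: leq_addl.
Qed.

Lemma psum_tail s m n : 1 < Re s -> (0 < m)%N -> (m <= n)%N ->
  nm (psum n s - psum m s) <= rpow m (Re s - 1) / (Re s - 1).
Proof.
move=> s1 m0 mn; have a0 : 0 < Re s - 1 by rewrite subr_gt0.
apply: le_trans (rpow_tail n.+1 a0 m0).
rewrite /psum (@big_cat_nat _ _ _ m.+1)//= addrAC subrr add0r.
rewrite (le_trans (nm_sum _ _ _))//.
by apply: ler_sum => k _; rewrite nm_ipow subrKC.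
Qed.

Definition zeta s : R[i] := get [set z | psum ^~ s @ \oo --> z].

Lemma cvg_zeta s : 1 < Re s -> psum ^~ s @ \oo --> zeta s.
Proof.
move=> s1; rewrite /zeta; case: xgetP => [z _ /= //|] h; exfalso.
have [|z hz] := @nm_cauchy_cvg R (psum ^~ s); last exact: (h z).
move=> e e0; have a0 : 0 < Re s - 1 by rewrite subr_gt0.
have ea0 : 0 < e * (Re s - 1) / 2 by rewrite divr_gt0// mulr_gt0.
have [n0 h0] := rpow_small a0 ea0.
exists n0.+1 => n m nn nm'.
have {}h0 := h0 _ (leqnSn n0).
have h1 := psum_tail s1 (ltn0Sn n0) nn; have h2 := psum_tail s1 (ltn0Sn n0) nm'.
have h3 : rpow n0.+1 (Re s - 1) / (Re s - 1) < e / 2 by rewrite ltr_pdivrMr//; lra.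
have := nmB (psum n s - psum n0.+1 s) (psum m s - psum n0.+1 s).
rewrite (_ : _ - _ - _ = psum n s - psum m s); last by ring.
lra.
Qed.

Lemma cdiff_zeta s : 1 < Re s -> cdiff zeta s.
Proof.
move=> s1; pose r := (Re s - 1) / 2.
have r0 : 0 < r by rewrite divr_gt0// subr_gt0.
have big w : nm (w - s) <= r -> 1 + r <= Re w by move=> /Re_near; rewrite /r; lra.
apply: (@cdiff_lim _ (fun n => psum n.+1) zeta s r (1 + r^-1)) => //.
- by move=> n w _; exact: cdiff_psum.
- move=> n w wr; have wb := big _ wr.
  have w1 : 1 < Re w by lra.
  have h1 := psum_tail w1 (ltn0Sn 0) (leq_addl n 1).
  rewrite addn1 rpow1 mul1r in h1.
  have p1 : psum 1 w = 1 by rewrite /psum big_nat1 ipow1.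
  rewrite p1 in h1.
  have := nmD (psum n.+1 w - 1) 1; rewrite subrK nm1.
  have : (Re w - 1)^-1 <= r^-1 by rewrite lef_pV2 ?posrE//; lra.
  lra.
move=> w wr; have w1 : 1 < Re w by have := big _ wr; lra.
exact: (@cvgn_shift _ (psum ^~ w) _ succn _ (cvg_zeta w1)).
Qed.

(** The factor 1 - 2^(1-s) relating eta and zeta. *)
Definition kappa s : R[i] := 1 - 2 * ipow 2 s.

Lemma cdiff_kappa s : cdiff kappa s.
Proof.
apply: cdiffB; first exact: cdiff_cst.
by apply: cdiffM; [exact: cdiff_cst|exact: cdiff_ipow].
Qed.

(** Subtracting twice the even terms from the whole sum. *)
Lemma altsum_even k s : altsum (2 * k).+1 s = psum (2 * k) s - 2 * ipow 2 s * psum k s.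
Proof.
elim: k => [|k ih].
  by rewrite muln0 /altsum /psum !big_geq// mulr0 subr0.
have e : (2 * k.+1 = (2 * k).+2)%N by rewrite mulnS.
have psumS j : psum j.+1 s = psum j s + ipow j.+1 s by rewrite /psum big_nat_recr.
have altS j : altsum j.+2 s = altsum j.+1 s + (-1) ^+ j.+2 * ipow j.+1 s.
  by rewrite /altsum big_nat_recr.
rewrite e !altS !psumS ih.
have -> : ipow (2 * k).+2 s = ipow 2 s * ipow k.+1 s by rewrite -e ipowM.
have s1 : (-1) ^+ (2 * k).+2 = 1 :> R[i] by rewrite -e exprM sqrrN expr1n expr1n.
have s2 : (-1) ^+ (2 * k).+3 = -1 :> R[i] by rewrite exprS s1 mulr1.
rewrite s1 s2; ring.
Qed.

Lemma eta_zeta s : 1 < Re s -> eta s = kappa s * zeta s.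
Proof.
move=> s1; have s0 : 0 < Re s by lra.
have h1 : (fun k => altsum (2 * k).+1 s) @ \oo --> eta s.
  apply: (@cvgn_shift _ (altsum ^~ s) _ (fun k => (2 * k).+1) _ (cvg_eta s0)) => n.
  by rewrite mul2n -addnn -addnS leq_addr.
have h2 : (fun k => psum (2 * k) s) @ \oo --> zeta s.
  apply: (@cvgn_shift _ (psum ^~ s) _ (fun k => (2 * k)%N) _ (cvg_zeta s1)) => n.
  by rewrite mul2n -addnn leq_addr.
have h3 := cvgn_sub h2 (cvgn_mul (cvgn_cst (2 * ipow 2 s)) (cvg_zeta s1)).
have h4 := cvgn_ext (fun k => esym (altsum_even k s)) h3.
by rewrite (cvgn_unique h1 h4) /kappa; ring.
Qed.

(** The inner series is zeta minus a partial sum. Summed over n_1, the pairs j <= l fill half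
    of the square together with its diagonal. *)
Lemma zeta2_seriesE s : 1 < Re s ->
  zeta2_series s s = (zeta s ^+ 2 - zeta (2 * s)) / 2.
Proof.
move=> s1.
have s2 : 1 < Re (2 * s).
  by rewrite (_ : Re (2 * s) = 2 * Re s); [lra|case: (s) => a b /=; ring].
have inner n1 : \big[+%R/0]_(1 <= n2 <oo) ((natcpow n1 s)^-1 * (natcpow (n1 + n2) s)^-1)
    = ipow n1 s * (zeta s - psum n1 s).
  apply: cvgn_limE.
  have h := cvgn_mul (cvgn_cst (ipow n1 s)) (cvgn_sub
    (@cvgn_shift _ (psum ^~ s) _ (fun k => (k + n1)%N) (fun n => leq_addr n1 n) (cvg_zeta s1))
    (cvgn_cst (psum n1 s))).
  apply/cvgn_nmP => e e0; have [n0 hn0] := (cvgn_nmP _ _).1 h _ e0.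
  exists n0.+1 => -[//|n]; rewrite ltnS => /hn0; congr (nm (_ - _) < _).
  rewrite /= /psum -mulr_sumr natcpowV; congr (_ * _).
  rewrite (@big_cat_nat _ _ _ n1.+1)//=; last by rewrite ltnS leq_addl.
  rewrite addrAC subrr add0r -addSn -{1}[n1.+1]add1n big_addn addnK.
  by apply: eq_bigr => k _; rewrite natcpowV addnC.
(* Half of the square of the partial sum plus half of its diagonal. *)
have sq k : \sum_(1 <= j < k.+1) ipow j s * psum j s = (psum k s ^+ 2 + psum k (2 * s)) / 2.
  elim: k => [|k ih]; first by rewrite /psum !big_geq// expr0n addr0 mul0r.
  rewrite big_nat_recr//= ih.
  have psumS v : psum k.+1 v = psum k v + ipow k.+1 v by rewrite /psum big_nat_recr.
  by rewrite !psumS ipow2; field.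
have partial k : \sum_(1 <= j < k.+1) ipow j s * (zeta s - psum j s) =
    psum k s * zeta s - (psum k s * psum k s + psum k (2 * s)) * 2^-1.
  rewrite -expr2 -[X in _ - X]sq /psum big_distrl /= -sumrB.
  by apply: eq_bigr => j _; rewrite mulrBr.
have h : (fun k => \sum_(1 <= j < k.+1) ipow j s * (zeta s - psum j s)) @ \oo -->
    zeta s * zeta s - (zeta s * zeta s + zeta (2 * s)) * 2^-1.
  apply: (cvgn_ext (fun k => esym (partial k))).
  have hz := cvg_zeta s1; have hz2 := cvg_zeta s2.
  exact: (cvgn_sub (cvgn_mul hz (cvgn_cst _))
    (cvgn_mul (cvgn_add (cvgn_mul hz hz) hz2) (cvgn_cst _))).
rewrite /zeta2_series.
have -> : (zeta s ^+ 2 - zeta (2 * s)) / 2 =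
  zeta s * zeta s - (zeta s * zeta s + zeta (2 * s)) * 2^-1 by field.
apply: cvgn_limE; apply/cvgn_nmP => e e0.
have [n0 hn0] := (cvgn_nmP _ _).1 h _ e0.
exists n0.+1 => -[//|n]; rewrite ltnS => /hn0; congr (nm (_ - _) < _).
by apply: eq_bigr => j _; rewrite inner.
Qed.

End Zeta.

(** * The diagonal in the strip 1/2 < Re s < 1 *)

Section Continuation.
Variable R : realType.
Implicit Types (x y e t r a b : R) (z w s : R[i]).
Variable f : R[i] -> R[i].
Hypothesis f_zeta2 : is_zeta2_diag f.

Lemma ccont_zero (g : R[i] -> R[i]) z d : 0 < d -> ccont g z ->
  (forall w, w != z -> nm (w - z) < d -> g w = 0) -> g z = 0.
Proof.
move=> d0 cg g0; apply/eqP; apply: contrapT => /negP gz.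
have [d1 d10 hd1] := ccont_nz cg gz.
pose m := Num.min d d1 / 2.
have md : 0 < Num.min d d1 by rewrite lt_min d0.
have m0 : 0 < m by rewrite divr_gt0.
have hm : nm (z + m%:C - z) = m by rewrite addrAC subrr add0r nmr ger0_norm// ltW.
have mz : z + m%:C != z by rewrite -subr_eq0 -nm_gt0 hm.
have mlt : m < Num.min d d1 by rewrite /m; lra.
move: (mlt); rewrite lt_min => /andP[m1 m2].
have := hd1 (z + m%:C); rewrite hm => /(_ m2).
by rewrite g0 ?hm// eqxx.
Qed.

(** The function eta^2 - kappa^2 zeta(2s), holomorphic for Re s > 1/2, which turns out to be
    2 kappa^2 zeta_2(s, s) there. *)
Definition zeta2_numer s := eta s ^+ 2 - kappa s ^+ 2 * zeta (2 * s).

Lemma Re_mul2 s : Re (2 * s) = 2 * Re s.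
Proof. by case: s => a b /=; ring. Qed.

Lemma cdiff_zeta2_numer s : 1 / 2 < Re s -> cdiff zeta2_numer s.
Proof.
move=> s0; apply: cdiffB; first by apply: cdiffX; apply: cdiff_eta; lra.
apply: cdiffM; first by apply: cdiffX; exact: cdiff_kappa.
apply: (@cdiff_comp _ (@zeta R)); first by apply: cdiff_zeta; rewrite Re_mul2; lra.
by apply: cdiffM; [exact: cdiff_cst|exact: cdiff_id].
Qed.

Let agree z := exists2 d : R, 0 < d &
  forall w, w != z -> nm (w - z) < d -> 2 * kappa w ^+ 2 * f w = zeta2_numer w.

Lemma meromorphic_quotient z : exists (n : nat) (g : R[i] -> R[i]) (d : R),
  [/\ 0 < d, forall w, nm (w - z) < d -> cdiff g w &
   forall w, w != z -> nm (w - z) < d -> f w * (w - z) ^+ n = g w].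
Proof.
have [hm _] := f_zeta2; case: (hm z) => [/holomorphic_cdiff [d d0 hd]|].
  by exists 0%N, f, d; split => // w _ _; rewrite mulr1.
move=> [n [g [n0 /holomorphic_cdiff [d1 d10 h1] _ /dnbhs_nmP [d2 d20 h2]]]].
exists n, g, (Num.min d1 d2); split; first by rewrite lt_min d10.
  by move=> w; rewrite lt_min => /andP[/h1].
move=> w wz; rewrite lt_min => /andP[_ w2].
by rewrite h2// divfK// expf_neq0// subr_eq0.
Qed.

Lemma agree_right s : 1 < Re s -> agree s.
Proof.
move=> s1; have [_ fE] := f_zeta2; exists (Re s - 1); first by rewrite subr_gt0.
move=> w _ ws; have w1 : 1 < Re w.
  have := le_trans (Re_le_nm (w - s)) (lexx _); rewrite ler_norml => /andP[h _].
  have h2 : Re (w - s) = Re w - Re s by case: (w); case: (s).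
  by rewrite h2 in h; lra.
rewrite fE// zeta2_seriesE// /zeta2_numer eta_zeta//.
by field.
Qed.

Lemma agree_open z d : 0 < d ->
  (forall w, w != z -> nm (w - z) < d -> 2 * kappa w ^+ 2 * f w = zeta2_numer w) ->
  forall v, nm (v - z) < d -> agree v.
Proof.
move=> d0 h v vd; have [->|vz] := eqVneq v z; first by exists d.
have n0 : 0 < nm (v - z) by rewrite nm_gt0 subr_eq0.
exists (Num.min (nm (v - z)) (d - nm (v - z))); first by rewrite lt_min n0 subr_gt0.
move=> w _; rewrite lt_min => /andP[w1 w2]; apply: h.
  by apply/eqP => wz; move: w1; rewrite wz nmBC ltxx.
by have := nmD (w - v) (v - z); rewrite addrA subrK; lra.
Qed.

(** On a disc about z the function (w - z)^n times the difference of the two sides is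
    holomorphic. If it vanishes near one point of a smaller disc, it vanishes on a disc
    around that point which contains z. *)
Lemma agree_step z : 1 / 2 < Re z -> exists2 d : R, 0 < d &
  forall b : R[i], nm (b - z) < d -> agree b -> agree z.
Proof.
move=> z0; have [n [g [d [d0 dg fg]]]] := meromorphic_quotient z.
pose p := Num.min d (Re z - 1 / 2) / 8.
have m0 : 0 < Num.min d (Re z - 1 / 2) by rewrite lt_min d0 subr_gt0.
have p0 : 0 < p by rewrite divr_gt0.
have [pd pz] : 8 * p <= d /\ 8 * p <= Re z - 1 / 2.
  have -> : 8 * p = Num.min d (Re z - 1 / 2) by rewrite /p; field.
  by rewrite !ge_min !lexx orbT.
exists p => // b bp ab.
have [<-//|bz] := eqVneq b z.
(* The pole of order n is cleared by the factor (w - z)^n. *)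
pose D w := 2 * kappa w ^+ 2 * g w - (w - z) ^+ n * zeta2_numer w.
have dD w : nm (w - z) < 4 * p -> cdiff D w.
  move=> wp; apply: cdiffB; apply: cdiffM.
  - apply: cdiffM; first exact: cdiff_cst.
    by apply: cdiffX; exact: cdiff_kappa.
  - by apply: dg; lra.
  - by apply: cdiffX; apply: cdiffB; [exact: cdiff_id|exact: cdiff_cst].
  - by apply: cdiff_zeta2_numer; have := Re_near (ltW wp); lra.
have bn0 : 0 < nm (b - z) by rewrite nm_gt0 subr_eq0.
case: ab => d' d'0 hd'.
pose q := Num.min d' (nm (b - z)).
have q0 : 0 < q by rewrite lt_min d'0.
have tri w : nm (w - z) <= nm (w - b) + nm (b - z).
  by have := nmD (w - b) (b - z); rewrite addrA subrK.
have D0' w : w != b -> nm (w - b) < q -> D w = 0.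
  move=> wb; rewrite lt_min => /andP[w1 w2].
  have wz : w != z by apply/eqP => wz; move: w2; rewrite wz nmBC ltxx.
  rewrite /D -fg//; last by have := tri w; lra.
  by rewrite -hd'//; ring.
have D0 w : nm (w - b) < q -> D w = 0.
  move=> wq; have [->|wb] := eqVneq w b; last exact: D0'.
  apply: (ccont_zero q0 (cdiff_cont _) D0'); apply: dD; lra.
have p20 : 0 < 2 * p by rewrite mulr_gt0.
have Dz := identity_disc p20 q0 _ D0.
exists p => // w wz wp.
have fw := fg w wz ltac:(lra).
have : D w = 0.
  apply: Dz => [v vb|]; first by apply: dD; have := tri v; lra.
  by have := nmD (w - z) (z - b); rewrite addrA subrK (nmBC z); lra.
rewrite /D -fw => /eqP; rewrite subr_eq0 mulrA mulrC => /eqP.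
by apply: mulfI; rewrite expf_neq0// subr_eq0.
Qed.

(** On a horizontal line the identity holds for large real part, and [agree_step] lets it
    pass over the supremum of the points where it fails. *)
Lemma agree_all z : 1 / 2 < Re z -> agree z.
Proof.
case: z => x0 y /= x0h; apply: contrapT => nx0.
pose P t := agree (t +i* y).
have nmx t u : nm ((t +i* y) - (u +i* y)) = `|t - u|.
  by rewrite (_ : _ - _ = (t - u)%:C) ?nmr//; apply/eqP; rewrite eq_complex /= subrr !eqxx.
have P1 t : 1 < t -> P t by move=> t1; exact: agree_right.
pose S := [set t | x0 <= t /\ ~ P t].
have S0 : S x0 by [].
have Sub : ubound S 1 by move=> t [_ nt]; rewrite leNgt; apply/negP => /P1.
have hS : has_sup S by split; [exists x0|exists 1].
pose m := sup S.
have x0m : x0 <= m by apply: ub_le_sup => //; exists 1.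
have Pm t : m < t -> P t.
  move=> mt; apply: contrapT => nt; have : t <= m.
    apply: ub_le_sup; first by exists 1.
    by split=> //; lra.
  by rewrite leNgt mt.
have Pmm : P m.
  have [d d0 hd] := @agree_step (m +i* y) ltac:(rewrite /=; lra).
  apply: (hd ((m + d / 2) +i* y)); last by apply: Pm; lra.
  by rewrite nmx addrAC subrr add0r ger0_norm; lra.
have [d d0 hd] := Pmm.
have [t [tx nt] tm] := sup_adherent d0 hS.
have tm' : t <= m by apply: ub_le_sup; [exists 1|split].
apply: nt; apply: (agree_open d0 hd).
by rewrite nmx ler0_norm; rewrite -/m in tm; lra.
Qed.

Lemma kappa_neq0 s : Re s < 1 -> kappa s != 0.
Proof.
move=> s1; rewrite /kappa subr_eq0 eq_sym; apply/eqP => h.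
have := congr1 (@nm R) h; rewrite nmM nm_ipow nm1 nm_nat => h1.
have : rpow 2 1 < rpow 2 (Re s).
  by rewrite /rpow ltr_expR ltrN2 ltr_pM2r// ln_gt0// ltr1n.
by rewrite rpow_x1//; lra.
Qed.

(** The identity holds near s; since kappa does not vanish for Re s < 1 and the right side
    is bounded, s is not a pole. *)
Lemma zeta2_diag_strip s : 1 / 2 < Re s < 1 ->
  holomorphic_at f s /\ 2 * kappa s ^+ 2 * f s = zeta2_numer s.
Proof.
move=> /andP[s0 s1]; have [d d0 hd] := agree_all s0.
have k0 := kappa_neq0 s1.
have [hm _] := f_zeta2; case: (hm s) => [hs|].
  split=> //; apply/eqP; rewrite -subr_eq0; apply/eqP.
  have /holomorphic_cdiff [d1 d10 h1] := hs.
  apply: (@ccont_zero (fun w => 2 * kappa w ^+ 2 * f w - zeta2_numer w) s d d0).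
    apply: ccontB; last by apply: cdiff_cont; exact: cdiff_zeta2_numer.
    apply: cdiff_cont; apply: cdiffM; last by apply: h1; rewrite subrr nm0.
    apply: cdiffM; first exact: cdiff_cst.
    by apply: cdiffX; exact: cdiff_kappa.
  by move=> w ws wd; rewrite hd// subrr.
move=> [n [g [n0 /holomorphic_cdiff [d1 d10 h1] gs /dnbhs_nmP [d2 d20 h2]]]].
exfalso.
have : 2 * kappa s ^+ 2 * g s - zeta2_numer s * (s - s) ^+ n = 0.
  apply: (@ccont_zero (fun w => 2 * kappa w ^+ 2 * g w - zeta2_numer w * (w - s) ^+ n)
    s (Num.min d d2)).
  - by rewrite lt_min d0.
  - apply: cdiff_cont; apply: cdiffB; apply: cdiffM.
    + apply: cdiffM; first exact: cdiff_cst.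
      by apply: cdiffX; exact: cdiff_kappa.
    + by apply: h1; rewrite subrr nm0.
    + exact: cdiff_zeta2_numer.
    + by apply: cdiffX; apply: cdiffB; [exact: cdiff_id|exact: cdiff_cst].
  move=> w ws; rewrite lt_min => /andP[w1 w2].
  rewrite -hd// h2//; field.
  by rewrite expf_neq0// subr_eq0.
rewrite subrr expr0n gtn_eqF// mulr0 subr0 => /eqP.
by rewrite !mulf_eq0 (negbTE gs) (negbTE k0) !orbF pnatr_eq0.
Qed.

End Continuation.

(** * Mean squares of Dirichlet polynomials *)

Section LargeSieve.
Variable R : realType.
Implicit Types (x y e t r a b : R) (z w s : R[i]) (l : seq (R[i] * nat)).

Definition isq (m n : nat) : R := if m == n then 0 else ((m%:R - n%:R) ^+ 2)^-1.

Lemma isq_ge0 m n : 0 <= isq m n.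
Proof. by rewrite /isq; case: eqP => // _; rewrite invr_ge0 sqr_ge0. Qed.

Lemma isqC m n : isq m n = isq n m.
Proof. by rewrite /isq eq_sym -sqrrN opprB. Qed.

Lemma sum_inv_sq n : \sum_(0 <= d < n) ((d.+1%:R : R) ^+ 2)^-1 <= 2.
Proof.
suff h k : \sum_(0 <= d < k.+1) ((d.+1%:R : R) ^+ 2)^-1 <= 2 - (k.+1%:R)^-1.
  case: n => [|n]; first by rewrite big_geq.
  by rewrite (le_trans (h n))// gerBl invr_ge0.
elim: k => [|k ih]; first by rewrite big_nat1 expr1n invr1; lra.
rewrite big_nat_recr//= (le_trans (lerD ih (lexx _)))//.
have k0 : (0 : R) < k.+1%:R by rewrite ltr0n.
have e : (k.+2%:R : R) = k.+1%:R + 1 by rewrite -natr1.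
rewrite e; move: (k.+1%:R) k0 => x x0.
have -> : ((x + 1) ^+ 2)^-1 = (x + 1)^-1 * (x + 1)^-1 by rewrite expr2 invfM.
have h1 : x * x^-1 = 1 by rewrite divff// gt_eqF.
have h2 : (x + 1) * (x + 1)^-1 = 1 by rewrite divff// gt_eqF//; lra.
have h3 : 0 < (x + 1)^-1 by rewrite invr_gt0; lra.
have h4 : 0 < x^-1 by rewrite invr_gt0.
move: h1 h2 h3 h4; move: (x^-1) ((x + 1)^-1) => u v h1 h2 h3 h4.
have : u - v = u * v by nra.
nra.
Qed.

Lemma sum_isq_lt m B : \sum_(0 <= n < B) isq m n <= 4.
Proof.
have mono B' : (B <= B')%N -> \sum_(0 <= n < B) isq m n <= \sum_(0 <= n < B') isq m n.
  move=> BB'; rewrite [leRHS](@big_cat_nat _ _ _ B)//= lerDl.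
  by apply: sumr_ge0 => n _; exact: isq_ge0.
rewrite (le_trans (mono (m.+1 + B)%N _)) ?leq_addl//.
rewrite (@big_cat_nat _ _ _ m.+1) ?leq_addr//= big_nat_recr//=.
have -> : isq m m = 0 by rewrite /isq eqxx.
rewrite addr0 (_ : 4 = 2 + 2); last by ring.
apply: lerD.
  rewrite big_nat_rev/= add0n; apply: le_trans (sum_inv_sq m).
  rewrite le_eqVlt; apply/orP; left; apply/eqP.
  rewrite big_nat_cond [RHS]big_nat_cond; apply: eq_bigr => n; rewrite andbT => /andP[_ nm'].
  rewrite /isq gtn_eqF; last by rewrite ltn_subrL (leq_trans _ nm').
  by rewrite -natrB ?leq_subr// subKn.
rewrite -{1}[m.+1]add0n big_addn addKn; apply: le_trans (sum_inv_sq B).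
rewrite le_eqVlt; apply/orP; left; apply/eqP; apply: eq_bigr => n _.
rewrite /isq ltn_eqF; last by rewrite addnS ltnS leq_addl.
by rewrite -sqrrN opprB -natrB ?addnS ?subSn ?addnK ?leqW ?leq_addl.
Qed.

Lemma sum_uniq_le (F : nat -> R) (s : seq nat) : (forall n, 0 <= F n) -> uniq s ->
  exists B, \sum_(n <- s) F n <= \sum_(0 <= n < B) F n.
Proof.
move=> F0 us; exists (\max_(n <- s) n).+1.
have lt n : n \in s -> (n < (\max_(n <- s) n).+1)%N.
  by move=> ns; rewrite ltnS; exact: leq_bigmax_seq.
have -> : \sum_(n <- s) F n = \sum_(n <- [seq n <- index_iota 0 (\max_(n <- s) n).+1 | n \in s]) F n.
  apply: perm_big; apply: uniq_perm => //; first by rewrite filter_uniq// iota_uniq.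
  move=> n; rewrite mem_filter mem_index_iota /=; case ns: (n \in s) => //=.
  by rewrite lt.
rewrite big_filter [leRHS](bigID (fun n => n \in s))/= lerDl.
exact: sumr_ge0.
Qed.

Lemma sum_isq_uniq m (s : seq nat) : uniq s -> \sum_(n <- s) isq m n <= 4.
Proof.
move=> /(sum_uniq_le (isq_ge0 m)) [B h]; exact: le_trans h (sum_isq_lt _ _).
Qed.

(** A list of pairs (a, n) stands for the Dirichlet polynomial with terms a n^-it. *)
Definition dpoly l t : R[i] := \sum_(p <- l) p.1 * cis (- (t * ln (p.2%:R : R))).
Definition norm2 l : R := \sum_(p <- l) nm p.1 ^+ 2.

(** A grid of spacing 1 / N around height 2N. Indexing it by differences i - j makes the
    average of exp(itx), up to a phase, the squared modulus of a geometric sum, which decays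
    like x^-2; the single sum would only decay like x^-1. *)
Definition sample N (i j : nat) : R := (2 * N)%:R + (i%:R - j%:R) / N%:R.

Definition avg N (phi : R -> R) : R :=
  ((N * N)%:R ^+ 2)^-1 * \sum_(i < N * N) \sum_(j < N * N) phi (sample N i j).

Lemma avg_le N (phi psi : R -> R) :
  (forall i j, (i < N * N)%N -> (j < N * N)%N -> phi (sample N i j) <= psi (sample N i j)) ->
  avg N phi <= avg N psi.
Proof.
move=> h; rewrite ler_wpM2l ?invr_ge0 ?sqr_ge0//.
by apply: ler_sum => i _; apply: ler_sum => j _; exact: h.
Qed.

Lemma avgD N (phi psi : R -> R) :
  avg N (fun t => phi t + psi t) = avg N phi + avg N psi.
Proof.
rewrite /avg -mulrDr -big_split /=; congr (_ * _); apply: eq_bigr => i _.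
by rewrite big_split.
Qed.

Lemma avgZ N c (phi : R -> R) : avg N (fun t => c * phi t) = c * avg N phi.
Proof.
rewrite /avg mulrCA; congr (_ * _); rewrite mulr_sumr; apply: eq_bigr => i _.
by rewrite mulr_sumr.
Qed.

Lemma avg_cst N c : (0 < N)%N -> avg N (fun=> c) = c.
Proof.
move=> N0; rewrite /avg !sumr_const !card_ord.
rewrite -[c *+ _]mulr_natr -[c * _ *+ _]mulr_natr.
by field; rewrite pnatr_eq0 -lt0n N0.
Qed.

Definition gsum (K : nat) x : R[i] := \sum_(k < K) cis (k%:R * x).

Lemma gsum_le K x : 0 < `|x| <= 1 -> nm (gsum K x) <= 4 / `|x|.
Proof.
move=> /andP[x0 x1].
have h : gsum K x * (cis x - 1) = cis (K%:R * x) - 1.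
  rewrite /gsum; elim: K => [|K ih].
    by rewrite big_ord0 !mul0r /cis cos0 sin0 subrr.
  rewrite big_ord_recr /= mulrDl ih -natr1 mulrDl mul1r cisD; ring.
have h1 := nm_cis_sub1_ge x1.
have h2 : nm (gsum K x) * nm (cis x - 1) <= 2.
  by rewrite -nmM h (le_trans (nmB _ _))// nm_cis nm1; lra.
rewrite ler_pdivlMr//.
have : nm (gsum K x) * (`|x| / 2) <= nm (gsum K x) * nm (cis x - 1).
  by rewrite ler_wpM2l ?nm_ge0.
lra.
Qed.

Lemma gsum0 K : gsum K 0 = K%:R.
Proof.
rewrite /gsum (eq_bigr (fun=> 1)) => [|k _]; last by rewrite mulr0 /cis cos0 sin0.
by rewrite sumr_const card_ord.
Qed.

Lemma cis_conj x : (cis x)^* = cis (- x).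
Proof. by rewrite /cis /= cosN sinN. Qed.

(** The double sum factors into a geometric sum and its conjugate. *)
Lemma sum_sample N x :
  \sum_(i < N * N) \sum_(j < N * N) cis (sample N i j * x) =
  cis ((2 * N)%:R * x) * (gsum (N * N) (x / N%:R) * (gsum (N * N) (x / N%:R))^*).
Proof.
rewrite /gsum conjc_sum mulr_suml mulr_sumr; apply: eq_bigr => i _.
rewrite !mulr_sumr; apply: eq_bigr => j _.
by rewrite cis_conj -!cisD; congr cis; rewrite /sample; ring.
Qed.

Lemma ln_diff_ge (m n X : nat) : (0 < m)%N -> (0 < n)%N -> (m <= X)%N -> (n <= X)%N ->
  `|m%:R - n%:R| / X%:R <= `|ln (m%:R : R) - ln (n%:R : R)|.
Proof.
wlog mn : m n / (m <= n)%N => [hw|] m0 n0 mX nX.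
  have [mn|/ltnW nm'] := leqP m n; first exact: hw.
  by rewrite distrC [leRHS]distrC; exact: hw.
have [m0' n0'] : (0 : R) < m%:R /\ (0 : R) < n%:R by rewrite !ltr0n.
have mn' : (m%:R : R) <= n%:R by rewrite ler_nat.
rewrite distrC [leRHS]distrC ger0_norm ?subr_ge0// ger0_norm ?subr_ge0 ?ler_ln_nat//.
have X0 : (0 : R) < X%:R by rewrite ltr0n (leq_trans m0).
apply: (@le_trans _ _ ((n%:R - m%:R) / n%:R)).
  by rewrite ler_wpM2l ?subr_ge0// lef_pV2 ?posrE// ler_nat.
have -> : ln (n%:R : R) - ln m%:R = - ln (m%:R / n%:R).
  by rewrite ln_div ?posrE//; ring.
rewrite lerNr; have -> : m%:R / n%:R = 1 + (- ((n%:R - m%:R) / n%:R)) :> R.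
  by field; rewrite gt_eqF.
apply: le_ln1Dx; rewrite ltrN2 ltr_pdivrMr// mul1r; lra.
Qed.

(** The diagonal gives norm2. Off the diagonal the average of (m/n)^it is at most a constant
    times X^2 / (N^2 (m - n)^2), because log m - log n is at least (m - n) / X in modulus;
    the inverse squares are summable, so there is no loss by a logarithm. *)
Lemma mean_square l N (X : nat) : (0 < N)%N -> ln (X%:R : R) <= N%:R ->
  uniq [seq p.2 | p <- l] -> all (fun p => (0 < p.2 <= X)%N) l ->
  `|avg N (fun t => nm (dpoly l t) ^+ 2) - norm2 l| <=
  64 * (X%:R / N%:R) ^+ 2 * norm2 l.
Proof.
move=> N0 lnX ul /allP al.
have N0' : (0 : R) < N%:R by rewrite ltr0n.
pose K := (N * N)%N.
have K0 : (0 : R) < K%:R by rewrite ltr0n muln_gt0 N0.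
pose lam (p q : R[i] * nat) := ln (q.2%:R : R) - ln (p.2%:R : R).
pose G x := cis ((2 * N)%:R * x) * (gsum K (x / N%:R) * (gsum K (x / N%:R))^*).
have sq t : (nm (dpoly l t) ^+ 2)%:C =
    \sum_(p <- l) \sum_(q <- l) p.1 * q.1^* * cis (t * lam p q).
  rewrite nm_sqc /dpoly conjc_sum mulr_suml; apply: eq_bigr => p _.
  rewrite mulr_sumr; apply: eq_bigr => q _.
  rewrite conjcM cis_conj mulrACA -cisD; congr (_ * cis _); rewrite /lam; ring.
have tot : (\sum_(i < K) \sum_(j < K) nm (dpoly l (sample N i j)) ^+ 2)%:C =
    \sum_(p <- l) \sum_(q <- l) p.1 * q.1^* * G (lam p q).
  rewrite rmorph_sum; transitivity (\sum_(i < K) \sum_(p <- l) \sum_(j < K)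
     \sum_(q <- l) p.1 * q.1^* * cis (sample N i j * lam p q)).
    apply: eq_bigr => i _; rewrite rmorph_sum exchange_big /=.
    by apply: eq_bigr => j _; exact: sq.
  rewrite exchange_big /=; apply: eq_bigr => p _.
  transitivity (\sum_(i < K) \sum_(q <- l) \sum_(j < K)
      p.1 * q.1^* * cis (sample N i j * lam p q)).
    by apply: eq_bigr => i _; rewrite exchange_big.
  rewrite exchange_big /=; apply: eq_bigr => q _.
  rewrite /G -sum_sample mulr_sumr; apply: eq_bigr => i _.
  by rewrite mulr_sumr.
have G0 : G 0 = (K%:R ^+ 2)%:C.
  rewrite /G !mulr0 mul0r gsum0 conjc_natE rmorphXn /= rmorph_nat.
  by rewrite /cis cos0 sin0 mul1r.
have Gle p q : p \in l -> q \in l -> p.2 != q.2 ->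
    nm (G (lam p q)) <= 16 * (N%:R * X%:R) ^+ 2 * isq p.2 q.2.
  move=> /al /andP[p0 pX] /al /andP[q0 qX] pq.
  rewrite /G !nmM nm_cis mul1r nm_conj -expr2.
  have X0 : (0 : R) < X%:R by rewrite ltr0n (leq_trans p0).
  have d0 : 0 < `|p.2%:R - q.2%:R : R| by rewrite normr_gt0 subr_eq0 eqr_nat.
  have h1 := ln_diff_ge p0 q0 pX qX.
  have l0 : 0 < `|lam p q|.
    by rewrite distrC; apply: lt_le_trans h1; rewrite divr_gt0.
  have l1 : `|lam p q| <= N%:R.
    apply: le_trans lnX; rewrite ler_norml /lam.
    have := ln_nat_ge0 R p.2; have := ln_nat_ge0 R q.2.
    have := ler_ln_nat R p0 pX; have := ler_ln_nat R q0 qX.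
    by move=> *; apply/andP; split; lra.
  have nx : `|lam p q / N%:R| = `|lam p q| / N%:R by rewrite normrM normfV (ger0_norm (ltW N0')).
  have h2 : nm (gsum K (lam p q / N%:R)) <= 4 * (N%:R * X%:R) / `|p.2%:R - q.2%:R|.
    apply: le_trans (@gsum_le K (lam p q / N%:R) _) _.
      by rewrite nx divr_gt0//= ler_pdivrMr// mul1r.
    rewrite nx invf_div [X in X <= _]mulrA ler_pdivrMr// mulrAC ler_pdivlMr//.
    have h3 : `|p.2%:R - q.2%:R| <= `|lam p q| * X%:R.
      by rewrite -ler_pdivrMr// /lam [leRHS]distrC.
    have : N%:R * `|p.2%:R - q.2%:R| <= N%:R * (`|lam p q| * X%:R).
      by rewrite ler_wpM2l// ltW.
    lra.
  apply: (@le_trans _ _ ((4 * (N%:R * X%:R) / `|p.2%:R - q.2%:R|) ^+ 2)).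
    by rewrite lerXn2r ?nnegrE ?nm_ge0// divr_ge0// !mulr_ge0// ltW.
  rewrite /isq (negbTE pq) exprMn exprVn sqr_norm exprMn.
  by rewrite (_ : 4 ^+ 2 = 16)//; ring.
have key : nm ((\sum_(i < K) \sum_(j < K) nm (dpoly l (sample N i j)) ^+ 2)%:C
    - (K%:R ^+ 2 * norm2 l)%:C) <= 16 * (N%:R * X%:R) ^+ 2 * (4 * norm2 l).
  have inj p q : p \in l -> q \in l -> p.2 = q.2 -> p = q.
    move=> pl ql pq; move/uniqP: ul => ul'.
    have := ul' 0%N (index p l) (index q l).
    rewrite !inE size_map !index_mem => /(_ pl ql).
    rewrite !(nth_map (0, 0%N)) ?index_mem// !nth_index// => /(_ pq) ipq.
    by rewrite -(nth_index (0, 0%N) pl) ipq nth_index.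
  have ul2 : uniq l by apply: map_uniq ul.
  have diag : (K%:R ^+ 2 * norm2 l)%:C =
      \sum_(p <- l) \sum_(q <- l) (if q.2 == p.2 then p.1 * q.1^* * G (lam p q) else 0).
    rewrite /norm2 mulr_sumr rmorph_sum big_seq_cond [RHS]big_seq_cond.
    apply: eq_bigr => p; rewrite andbT => pl.
    rewrite (bigD1_seq p)//= eqxx big1_seq ?addr0 => [|q /andP[qp ql]]; last first.
      by case: eqP => // qp2; case/eqP: qp; exact: inj.
    by rewrite /lam subrr G0 -nm_sqc -rmorphM mulrC.
  rewrite diag tot -sumrB.
  apply: (@le_trans _ _ (\sum_(p <- l) \sum_(q <- l)
      (16 * (N%:R * X%:R) ^+ 2 * (isq p.2 q.2 * (nm p.1 * nm q.1))))).
    rewrite (le_trans (nm_sum _ _ _))//.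
    rewrite big_seq_cond [leRHS]big_seq_cond; apply: ler_sum => p; rewrite andbT => pl.
    rewrite -sumrB (le_trans (nm_sum _ _ _))//.
    rewrite big_seq_cond [leRHS]big_seq_cond; apply: ler_sum => q; rewrite andbT => ql.
    case: eqP => [_|/eqP qp].
      by rewrite subrr nm0 mulr_ge0 ?mulr_ge0 ?sqr_ge0 ?isq_ge0 ?nm_ge0.
    rewrite subr0 nmM nmM nm_conj mulrC mulrA.
    by rewrite ler_wpM2r ?mulr_ge0 ?nm_ge0// Gle// eq_sym.
  under eq_bigr do rewrite -mulr_sumr.
  rewrite -mulr_sumr ler_wpM2l ?mulr_ge0 ?sqr_ge0//.
  apply: (@le_trans _ _ (\sum_(p <- l) \sum_(q <- l)
      (isq p.2 q.2 * nm p.1 ^+ 2 / 2 + isq p.2 q.2 * nm q.1 ^+ 2 / 2))).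
    apply: ler_sum => p _; apply: ler_sum => q _.
    rewrite -mulrDl -mulrDr -mulrA ler_wpM2l ?isq_ge0//.
    have := sqr_ge0 (nm p.1 - nm q.1); rewrite sqrrB; lra.
  have half : \sum_(p <- l) \sum_(q <- l) isq p.2 q.2 * nm p.1 ^+ 2 / 2 <= 2 * norm2 l.
    rewrite /norm2 mulr_sumr; apply: ler_sum => p _.
    rewrite -!mulr_suml -(big_map (fun q : R[i] * nat => q.2) xpredT (isq p.2)).
    have := sum_isq_uniq p.2 ul; have := sqr_ge0 (nm p.1); nra.
  under eq_bigr do rewrite big_split.
  rewrite big_split /= (_ : 4 * norm2 l = 2 * norm2 l + 2 * norm2 l); last by ring.
  apply: lerD => //.
  rewrite exchange_big /=; apply: le_trans half.
  by apply: ler_sum => p _; apply: ler_sum => q _; rewrite isqC.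
rewrite -rmorphB nmr in key.
rewrite /avg -/K.
set S := \sum_(i < K) _ in key *.
have K2 : 0 < (K%:R : R) ^+ 2 by rewrite exprn_gt0.
rewrite -[norm2 l in X in `|X|](mulKf (lt0r_neq0 K2)) -mulrBr normrM normfV.
rewrite (ger0_norm (ltW K2)) ler_pdivrMl// (le_trans key)//.
rewrite /K natrM le_eqVlt; apply/orP; left; apply/eqP; field.
by rewrite gt_eqF.
Qed.

End LargeSieve.

(** * Sums over integers free of given primes *)

Section Sieve.
Variable R : realType.
Implicit Types (x y e t r a b : R) (z w s : R[i]) (l : seq (R[i] * nat)).

Definition rough (ps : seq nat) (n : nat) := all (fun p => ~~ (p %| n)%N) ps.

Definition rough_sum ps (N : nat) s : R[i] := \sum_(1 <= n < N.+1 | rough ps n) ipow n s.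

Definition eprod ps s : R[i] := \prod_(p <- ps) (1 - ipow p s).

Lemma rough_mul ps p m : prime p -> all prime ps -> p \notin ps ->
  rough ps (p * m) = rough ps m.
Proof.
move=> pp aps pps; rewrite /rough; apply: eq_in_all => q qps.
have pq : prime q by move/allP: aps; apply.
rewrite Euclid_dvdM// dvdn_prime2//.
by have -> : (q == p) = false by apply: contraNF pps => /eqP <-.
Qed.

Lemma sum_multiples (I : nmodType) (F : nat -> I) (P : pred nat) p N : (0 < p)%N ->
  \sum_(1 <= n < N.+1 | (p %| n)%N && P n) F n =
  \sum_(1 <= m < (N %/ p).+1 | P (p * m)%N) F (p * m)%N.
Proof.
move=> p0; rewrite -big_filter -[RHS]big_filter.
rewrite -(big_map (muln p) xpredT F) /=; apply: perm_big; apply: uniq_perm.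
- by rewrite filter_uniq// iota_uniq.
- rewrite map_inj_uniq ?filter_uniq ?iota_uniq//.
  by move=> i j /eqP; rewrite eqn_pmul2l// => /eqP.
move=> n; rewrite mem_filter mem_index_iota ltnS; apply/idP/idP.
  move=> /andP[/andP[/dvdnP[k ->] Pn] /andP[n0 nN]].
  apply/mapP; exists k; last by rewrite mulnC.
  rewrite mem_filter mulnC Pn mem_index_iota ltnS /= leq_divRL// nN andbT.
  by move: n0; rewrite muln_gt0 => /andP[].
move=> /mapP[k]; rewrite mem_filter mem_index_iota ltnS => /and3P[Pk k0 kN] ->.
by rewrite dvdn_mulr// Pk muln_gt0 p0 k0/= mulnC -leq_divRL.
Qed.

(** Removing the multiples of p: they are p times the remaining integers up to N / p. *)
Lemma rough_sum_cons p ps N s : prime p -> all prime ps -> p \notin ps ->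
  rough_sum (p :: ps) N s = rough_sum ps N s - ipow p s * rough_sum ps (N %/ p) s.
Proof.
move=> pp aps pps; have p0 := prime_gt0 pp.
rewrite /rough_sum [in RHS](bigID (fun n => (p %| n)%N)) /=.
have -> : \sum_(1 <= n < N.+1 | rough ps n && (p %| n)%N) ipow n s =
    ipow p s * \sum_(1 <= n < (N %/ p).+1 | rough ps n) ipow n s.
  under eq_bigl do rewrite andbC.
  rewrite sum_multiples// mulr_sumr.
  rewrite big_nat_cond [RHS]big_nat_cond; apply: eq_big => m.
    by rewrite rough_mul.
  by move=> /andP[/andP[m0 _] _]; rewrite ipowM.
rewrite addrAC subrr add0r; apply: eq_bigl => n.
by rewrite /rough /= andbC.
Qed.

Lemma rough_sum_nil N s : rough_sum [::] N s = psum N s.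
Proof. by []. Qed.

(** Multiplying zeta by prod (1 - p^-s) removes the multiples of the primes p exactly; for
    partial sums there is an error, which comes from truncation only. *)
Definition sieve_err ps N s := psum N s * eprod ps s - rough_sum ps N s.

Lemma sieve_err_nil N s : sieve_err [::] N s = 0.
Proof. by rewrite /sieve_err /eprod big_nil mulr1 rough_sum_nil subrr. Qed.

(** By [rough_sum_cons], adding a prime contributes the integers between N / p and N. *)
Lemma sieve_err_cons p ps N s : prime p -> all prime ps -> p \notin ps ->
  sieve_err (p :: ps) N s = (1 - ipow p s) * sieve_err ps N s
    - ipow p s * (rough_sum ps N s - rough_sum ps (N %/ p) s).
Proof.
by move=> pp aps pps; rewrite /sieve_err rough_sum_cons// /eprod big_cons; ring.
Qed.

Definition vshift s t := s + 'i * t%:C.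

Lemma Re_vshift s t : Re (vshift s t) = Re s.
Proof. by rewrite /vshift; case: s => a b /=; ring. Qed.

Lemma Im_vshift s t : Im (vshift s t) = Im s + t.
Proof. by rewrite /vshift; case: s => a b /=; ring. Qed.

Lemma ipow_vshift n s t : ipow n (vshift s t) = ipow n s * cis (- (t * ln (n%:R : R))).
Proof. by rewrite ipowD ipow_it. Qed.

Definition ipow_terms s (ns : seq nat) : seq (R[i] * nat) := [seq (ipow n s, n) | n <- ns].

Lemma ipow_terms_snd s ns : [seq p.2 | p <- ipow_terms s ns] = ns.
Proof. by rewrite -map_comp map_id_in. Qed.

Lemma dpoly_ipow_terms s ns t : dpoly (ipow_terms s ns) t = \sum_(n <- ns) ipow n (vshift s t).
Proof. by rewrite /dpoly big_map; apply: eq_bigr => n _; rewrite ipow_vshift. Qed.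

Lemma norm2_ipow_terms s ns : norm2 (ipow_terms s ns) = \sum_(n <- ns) rpow n (2 * Re s).
Proof. by rewrite /norm2 big_map; apply: eq_bigr => n _; rewrite /= nm_ipow rpow_sq. Qed.

Lemma norm2_ge0 l : 0 <= norm2 l.
Proof. by apply: sumr_ge0 => p _; exact: sqr_ge0. Qed.

Lemma mean_square_le l N X b : (0 < N)%N -> ln (X%:R : R) <= N%:R ->
  uniq [seq p.2 | p <- l] -> all (fun p => (0 < p.2 <= X)%N) l ->
  64 * (X%:R / N%:R) ^+ 2 <= b ->
  (1 - b) * norm2 l <= avg N (fun t => nm (dpoly l t) ^+ 2) <= (1 + b) * norm2 l.
Proof.
move=> N0 lnX ul al hb; have := mean_square N0 lnX ul al.
have : 64 * (X%:R / N%:R) ^+ 2 * norm2 l <= b * norm2 l by rewrite ler_wpM2r ?norm2_ge0.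
by move=> h1 h2; have := le_trans h2 h1; rewrite ler_distl; lra.
Qed.

(** N large in terms of X makes all frequencies up to X asymptotically orthogonal. *)
Lemma mean_square_asymp X b : 0 < b -> exists N0, forall N, (N0 <= N)%N -> forall l,
  uniq [seq p.2 | p <- l] -> all (fun p => (0 < p.2 <= X)%N) l ->
  (1 - b) * norm2 l <= avg N (fun t => nm (dpoly l t) ^+ 2) <= (1 + b) * norm2 l.
Proof.
move=> b0; have [n1 h1] := nat_above (ln (X%:R : R)).
have [n2 h2] := nat_above (64 * X%:R ^+ 2 / b : R).
exists (maxn n1 n2).+1 => N; rewrite gtn_max => /andP[N1 N2] l ul al.
have N0 : (0 < N)%N by exact: leq_ltn_trans N1.
have N0' : (1 : R) <= N%:R by rewrite ler1n.
apply: (mean_square_le N0 _ ul al).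
  by rewrite (le_trans (ltW h1))// ler_nat ltnW.
rewrite expr_div_n mulrA ler_pdivrMr ?exprn_gt0//; last by lra.
have h3 : 64 * X%:R ^+ 2 / b <= N%:R by rewrite (le_trans (ltW h2))// ler_nat ltnW.
rewrite ler_pdivrMr// in h3; apply: le_trans h3 _.
rewrite mulrC ler_wpM2l ?(ltW b0)// expr2 ler_peMl//; lra.
Qed.

Lemma sum_rpow_tail (P : pred nat) x x1 m n : 1 / 2 < x1 -> x1 <= x -> (0 < m)%N ->
  \sum_(m.+1 <= k < n | P k) rpow k (2 * x) <= rpow m (2 * x1 - 1) / (2 * x1 - 1).
Proof.
move=> x1h x1x m0; have a0 : 0 < 2 * x1 - 1 by lra.
apply: le_trans (rpow_tail n a0 m0).
rewrite [leRHS](bigID P)/= -[leLHS]addr0; apply: lerD.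
  apply: ler_sum => k _; apply: rpow_antimono; lra.
by apply: sumr_ge0 => k _; exact: rpow_ge0.
Qed.

Lemma nm_sub_sq z w : nm (z - w) ^+ 2 <= 2 * nm z ^+ 2 + 2 * nm w ^+ 2.
Proof.
apply: (@le_trans _ _ ((nm z + nm w) ^+ 2)).
  by rewrite lerXn2r ?nnegrE ?addr_ge0 ?nm_ge0// nmB.
have := sqr_ge0 (nm z - nm w); rewrite sqrrB sqrrD; lra.
Qed.

Lemma nm_one_sub_ipow p s : 0 <= Re s -> nm (1 - ipow p s) <= 2.
Proof.
move=> s0; rewrite (le_trans (nmB _ _))// nm1 nm_ipow.
have := @rpow_le1 _ p _ s0; lra.
Qed.

Lemma rough_sum_diff ps m n s : (m <= n)%N ->
  rough_sum ps n s - rough_sum ps m s =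
  \sum_(k <- [seq k <- index_iota m.+1 n.+1 | rough ps k]) ipow k s.
Proof.
by move=> mn; rewrite big_filter /rough_sum (@big_cat_nat _ _ _ m.+1)//= addrAC subrr add0r.
Qed.

(** Each prime adds a Dirichlet polynomial over the integers between Y / p and Y; its mean
    square is at most a tail of the sum of n^-2x, which is small for large Y since x > 1/2. *)
Lemma sieve_err_small ps x1 : 1 / 2 < x1 -> all prime ps -> uniq ps ->
  forall e, 0 < e -> exists Y0, forall Y, (Y0 <= Y)%N -> exists N0, forall N, (N0 <= N)%N ->
  forall s, x1 <= Re s ->
    avg N (fun t => nm (sieve_err ps Y (vshift s t)) ^+ 2) <= e.
Proof.
move=> x1h; elim: ps => [|p ps ih] /=.
  move=> _ _ e e0; exists 0%N => N _; exists 1%N => N' N'0 s _.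
  apply: (@le_trans _ _ (avg N' (fun=> 0))); last by rewrite avg_cst// ltW.
  by apply: avg_le => i j _ _; rewrite sieve_err_nil nm0 expr0n.
move=> /andP[pp aps] /andP[pps ups] e e0.
have p0 := prime_gt0 pp.
have e160 : 0 < e / 16 by rewrite divr_gt0.
have [Y0 hY0] := ih aps ups _ e160.
have a0 : 0 < 2 * x1 - 1 by lra.
have e80 : 0 < e * (2 * x1 - 1) / 8 by rewrite divr_gt0// mulr_gt0.
have [m0 hm0] := rpow_small a0 e80.
exists (maxn Y0 (p * m0.+1)) => Y; rewrite geq_max => /andP[YY0 yp].
have [N1 hN1] := hY0 Y YY0.
have [N2 hN2] := @mean_square_asymp Y 1 ltr01.
exists (maxn 1 (maxn N1 N2)) => N; rewrite !geq_max => /and3P[N0 NN1 NN2] s hs.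
set q := (Y %/ p)%N.
have qm : (m0.+1 <= q)%N by rewrite leq_divRL// mulnC.
have qy : (q <= Y)%N by exact: leq_div.
pose ns := [seq k <- index_iota q.+1 Y.+1 | rough ps k].
have h1 := hN1 N NN1 s hs.
have /andP[_ h2] : (1 - 1) * norm2 (ipow_terms s ns) <= avg N (fun t => nm (dpoly (ipow_terms s ns) t) ^+ 2)
    <= (1 + 1) * norm2 (ipow_terms s ns).
  apply: hN2 => //; first by rewrite ipow_terms_snd filter_uniq// iota_uniq.
  apply/allP => -[z n] /mapP[k]; rewrite mem_filter mem_index_iota ltnS => /and3P[_ k1 k2] [_ ->] /=.
  by rewrite k2 andbT (leq_trans _ k1).
have h3 : norm2 (ipow_terms s ns) <= e / 8.
  rewrite norm2_ipow_terms big_filter.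
  apply: le_trans (sum_rpow_tail _ _ x1h hs _) _; first exact: leq_trans qm.
  rewrite ler_pdivrMr//; apply: ltW; apply: lt_le_trans (hm0 q _) _.
    exact: ltnW.
  lra.
apply: (@le_trans _ _ (avg N (fun t => 8 * nm (sieve_err ps Y (vshift s t)) ^+ 2 +
   2 * nm (dpoly (ipow_terms s ns) t) ^+ 2))).
  apply: avg_le => i j _ _; set t := sample _ _ _ _.
  rewrite sieve_err_cons// rough_sum_diff// -/ns -dpoly_ipow_terms.
  rewrite (le_trans (nm_sub_sq _ _))// (nmM (1 - _)) (nmM (ipow p _)) !exprMn.
  have s0 : 0 <= Re (vshift s t) by rewrite Re_vshift; lra.
  have b1 : nm (1 - ipow p (vshift s t)) ^+ 2 <= 4.
    rewrite (_ : 4 = 2 ^+ 2); last by ring.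
    by rewrite lerXn2r ?nnegrE ?nm_ge0// nm_one_sub_ipow.
  have b2 : nm (ipow p (vshift s t)) ^+ 2 <= 1.
    by rewrite expr_le1 ?nm_ge0// nm_ipow rpow_le1.
  have := sqr_ge0 (nm (sieve_err ps Y (vshift s t))).
  have := sqr_ge0 (nm (dpoly (ipow_terms s ns) t)).
  move: b1 b2; move: (nm (1 - _) ^+ 2) (nm (ipow _ _) ^+ 2) (nm (sieve_err _ _ _) ^+ 2)
    (nm (dpoly _ _) ^+ 2) => A B C D hA hB hD hC.
  have : A * C <= 4 * C by rewrite ler_wpM2r.
  have : B * D <= 1 * D by rewrite ler_wpM2r.
  lra.
rewrite avgD !avgZ; lra.
Qed.

End Sieve.

(** * Fejer weights *)

Section Weights.
Variable R : realType.
Implicit Types (x y e t r a b : R) (z w s : R[i]) (l : seq (R[i] * nat)).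
Variable chi : nat -> R.
Hypothesis chi_sq : forall p, chi p ^+ 2 = 1.
Variable J : nat.
Hypothesis J0 : (0 < J)%N.

Lemma nm_chi p : nm (chi p)%:C = 1.
Proof. by rewrite nmr sign_norm1. Qed.

(** The unimodular number that is to be brought close to 1. *)
Definition phase p t : R[i] := (chi p)%:C * cis (- (t * ln (p%:R : R))).

Lemma nm_phase p t : nm (phase p t) = 1.
Proof. by rewrite nmM nm_chi nm_cis mulr1. Qed.

Definition inv_sqrtJ : R := (Num.sqrt J%:R)^-1.

Lemma inv_sqrtJ_sq : inv_sqrtJ ^+ 2 = J%:R^-1.
Proof. by rewrite exprVn sqr_sqrtr. Qed.

Lemma inv_sqrtJ_ge0 : 0 <= inv_sqrtJ.
Proof. by rewrite invr_ge0 sqrtr_ge0. Qed.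

(** Its squared modulus is the Fejer kernel of order J in the phase, as a function of
    mean 1. *)
Definition fejer_root p t : R[i] := inv_sqrtJ%:C * \sum_(j < J) phase p t ^+ j.

(** [fejer_root] as a Dirichlet polynomial, over the powers of p. *)
Definition fejer_terms p : seq (R[i] * nat) :=
  [seq (inv_sqrtJ%:C * (chi p)%:C ^+ j, (p ^ j)%N) | j <- index_iota 0 J].

Lemma cisMn x n : cis (n%:R * x) = cis x ^+ n.
Proof.
rewrite -!cexp_cis -cexpMn; congr cexp.
by rewrite rmorphM rmorph_nat; ring.
Qed.

Lemma dpoly_fejer_terms p t : (0 < p)%N -> dpoly (fejer_terms p) t = fejer_root p t.
Proof.
move=> p0; rewrite /dpoly big_map big_mkord /fejer_root mulr_sumr; apply: eq_bigr => j _ /=.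
rewrite /phase exprMn -mulrA; congr (_ * (_ * _)).
by rewrite -cisMn natrX lnXn ?ltr0n// -mulr_natl; congr cis; ring.
Qed.

Lemma norm2_fejer_terms p : norm2 (fejer_terms p) = 1.
Proof.
rewrite /norm2 big_map (eq_bigr (fun=> J%:R^-1)) => [|j _]; last first.
  by rewrite /= nmM nmX nm_chi expr1n mulr1 nmr ger0_norm ?inv_sqrtJ_ge0// inv_sqrtJ_sq.
rewrite sumr_const_nat subn0 -[_ *+ J]mulr_natr mulVf// pnatr_eq0 -lt0n//.
Qed.

(** Product of Dirichlet polynomials, without collecting terms. *)
Definition mul_terms (l1 l2 : seq (R[i] * nat)) : seq (R[i] * nat) :=
  [seq (p.1 * q.1, (p.2 * q.2)%N) | p <- l1, q <- l2].

Lemma dpoly_mul_terms l1 l2 t :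
  all (fun p => (0 < p.2)%N) l1 -> all (fun p => (0 < p.2)%N) l2 ->
  dpoly (mul_terms l1 l2) t = dpoly l1 t * dpoly l2 t.
Proof.
move=> /allP a1 /allP a2; rewrite /dpoly big_allpairs_dep mulr_suml.
rewrite big_seq_cond [RHS]big_seq_cond; apply: eq_bigr => p; rewrite andbT => pl.
rewrite mulr_sumr big_seq_cond [RHS]big_seq_cond; apply: eq_bigr => q; rewrite andbT => ql.
rewrite -[(_, _).1]/(p.1 * q.1) -[(_, _).2]/(p.2 * q.2)%N lnM_nat ?(a1 _ pl) ?(a2 _ ql)//.
by rewrite [RHS]mulrACA -cisD; congr (_ * cis _); ring.
Qed.

Lemma norm2_mul_terms l1 l2 : norm2 (mul_terms l1 l2) = norm2 l1 * norm2 l2.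
Proof.
rewrite /norm2 big_allpairs_dep mulr_suml; apply: eq_bigr => p _.
by rewrite mulr_sumr; apply: eq_bigr => q _; rewrite /= nmM exprMn.
Qed.

Lemma mul_terms_snd l1 l2 : [seq p.2 | p <- mul_terms l1 l2] =
  [seq (m * n)%N | m <- [seq p.2 | p <- l1], n <- [seq p.2 | p <- l2]].
Proof.
by elim: l1 => //= p l1 ih; rewrite map_cat ih -!map_comp.
Qed.

Definition weighted_terms ps l := foldr (fun p L => mul_terms (fejer_terms p) L) l ps.
Definition fejer_prod (ps : seq nat) t : R[i] := \prod_(p <- ps) fejer_root p t.

Definition nodvd q l := all (fun p => ~~ (q %| p.2)%N) l.

Lemma mem_fejer_terms p u : u \in fejer_terms p -> exists2 j, (j < J)%N & u.2 = (p ^ j)%N.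
Proof. by move=> /mapP[j]; rewrite mem_index_iota => /andP[_ jJ] ->; exists j. Qed.

Lemma weighted_terms_pos ps l : all prime ps -> all (fun p => (0 < p.2)%N) l ->
  all (fun p => (0 < p.2)%N) (weighted_terms ps l).
Proof.
move=> + al; elim: ps => //= p ps ih /andP[pp aps].
apply/allP => u /allpairsP[[v w] /= [hv hw ->]] /=.
have [j _ ->] := mem_fejer_terms hv.
by rewrite muln_gt0 expn_gt0 prime_gt0//=; move/allP: (ih aps); apply.
Qed.

Lemma weighted_terms_nodvd ps l q : all prime ps -> prime q -> q \notin ps -> nodvd q l ->
  nodvd q (weighted_terms ps l).
Proof.
move=> + qq + ql; elim: ps => //= p ps ih /andP[pp aps].
rewrite inE negb_or => /andP[qp qps].
apply/allP => u /allpairsP[[v w] /= [hv hw ->]] /=.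
have [j _ ->] := mem_fejer_terms hv.
rewrite Euclid_dvdM// negb_or; apply/andP; split.
  by rewrite Euclid_dvdX// dvdn_prime2// (negbTE qp).
by move/allP: (ih aps qps); apply.
Qed.

(** Unique factorisation: the power of p in a product p^j m with m prime to p determines j,
    then m. So multiplication by the Fejer roots creates no coincidence of frequencies,
    which is what keeps the norm and the mean square unchanged. *)
Lemma weighted_terms_uniq ps l : all prime ps -> uniq ps -> all (fun p => (0 < p.2)%N) l ->
  (forall q, q \in ps -> nodvd q l) -> uniq [seq p.2 | p <- l] ->
  uniq [seq p.2 | p <- weighted_terms ps l].
Proof.
move=> + + al + ul; elim: ps => //= p ps ih /andP[pp aps] /andP[pps ups] hq.
have u2 : uniq [seq p.2 | p <- weighted_terms ps l].
  by apply: ih => // q qps; apply: hq; rewrite inE qps orbT.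
have pos := weighted_terms_pos aps al.
have nd : nodvd p (weighted_terms ps l) by apply: weighted_terms_nodvd => //; apply: hq; rewrite inE eqxx.
rewrite mul_terms_snd; apply: allpairs_uniq => //.
  rewrite -map_comp map_inj_uniq ?iota_uniq// => i j /= /eqP.
  by rewrite eqn_exp2l ?prime_gt1// => /eqP.
have lg m j : m \in [seq p.2 | p <- weighted_terms ps l] -> logn p (p ^ j * m) = j.
  move=> /mapP[u uw ->]; rewrite lognM; [|by rewrite expn_gt0 prime_gt0|exact: (allP pos u uw)].
  by rewrite pfactorK// lognE; move/allP: nd => /(_ u uw) /negbTE ->; rewrite !andbF addn0.
move=> -[a1 b1] [a2 b2] /allpairsP[[c1 d1] /= [hc1 hd1 [-> ->]]].
move=> /allpairsP[[c2 d2] /= [hc2 hd2 [-> ->]]] e.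
move/mapP: hc1 e => [v1 hv1 ->]; move/mapP: hc2 => [v2 hv2 ->].
have [j1 _ ->] := mem_fejer_terms hv1; have [j2 _ ->] := mem_fejer_terms hv2 => e.
have := congr1 (logn p) e; rewrite !lg// => jj.
move/eqP: e; rewrite jj eqn_pmul2l ?expn_gt0 ?prime_gt0// => /eqP -> //.
Qed.

Lemma dpoly_weighted_terms ps l t : all prime ps -> all (fun p => (0 < p.2)%N) l ->
  dpoly (weighted_terms ps l) t = fejer_prod ps t * dpoly l t.
Proof.
move=> + al; elim: ps => [|p ps ih] /=; first by rewrite /fejer_prod big_nil mul1r.
move=> /andP[pp aps]; have p0 := prime_gt0 pp.
rewrite dpoly_mul_terms ?weighted_terms_pos//; last first.
  by apply/allP => u /mem_fejer_terms [j _ ->]; rewrite expn_gt0 p0.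
by rewrite ih// dpoly_fejer_terms// /fejer_prod big_cons mulrA.
Qed.

Lemma norm2_weighted_terms ps l : norm2 (weighted_terms ps l) = norm2 l.
Proof. by elim: ps => //= p ps ih; rewrite norm2_mul_terms norm2_fejer_terms mul1r. Qed.

Definition weighted_bound (ps : seq nat) := (\prod_(p <- ps) p ^ J)%N.

Lemma weighted_terms_bound ps l X : all prime ps -> all (fun p => (p.2 <= X)%N) l ->
  all (fun p => (p.2 <= weighted_bound ps * X)%N) (weighted_terms ps l).
Proof.
move=> + al; elim: ps => [|p ps ih] /=; first by rewrite /weighted_bound big_nil mul1n.
move=> /andP[pp aps].
apply/allP => u /allpairsP[[v w] /= [hv hw ->]] /=.
have [j jJ ->] := mem_fejer_terms hv.
rewrite /weighted_bound big_cons -mulnA; apply: leq_mul.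
  by rewrite leq_pexp2l ?prime_gt0// ltnW.
by move/allP: (ih aps); apply.
Qed.

Definition fejer_wt ps t : R := nm (fejer_prod ps t) ^+ 2.

Lemma fejer_wt_ge0 ps t : 0 <= fejer_wt ps t. Proof. exact: sqr_ge0. Qed.

Lemma nm_fejer_root_sq p t : nm (fejer_root p t) ^+ 2 <= J%:R.
Proof.
have J0' : (0 : R) < J%:R by rewrite ltr0n.
rewrite nmM exprMn nmr ger0_norm ?inv_sqrtJ_ge0// inv_sqrtJ_sq ler_pdivrMl// -expr2.
rewrite lerXn2r ?nnegrE ?nm_ge0// (le_trans (nm_sum _ _ _))//.
rewrite (eq_bigr (fun=> 1)) => [|j _]; last by rewrite nmX nm_phase expr1n.
by rewrite sumr_const card_ord.
Qed.

Lemma fejer_wt_le ps t : fejer_wt ps t <= J%:R ^+ size ps.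
Proof.
rewrite /fejer_wt /fejer_prod; elim: ps => [|p ps ih]; first by rewrite big_nil nm1 expr1n.
by rewrite big_cons nmM exprMn [leRHS]exprS ler_pM ?sqr_ge0 ?nm_fejer_root_sq.
Qed.

(** The geometric sum in [fejer_root] times (phase - 1) telescopes to a bounded quantity,
    while it was normalised by the square root of J. *)
Lemma fejer_concentrated ps p t : uniq ps -> p \in ps ->
  fejer_wt ps t * nm (phase p t - 1) ^+ 2 <= 4 / J%:R * fejer_wt (rem p ps) t.
Proof.
move=> ups pps; have J0' : (0 : R) < J%:R by rewrite ltr0n.
have -> : fejer_wt ps t = nm (fejer_root p t) ^+ 2 * fejer_wt (rem p ps) t.
  by rewrite /fejer_wt /fejer_prod (perm_big _ (perm_to_rem pps)) big_cons nmM exprMn.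
rewrite mulrAC ler_wpM2r ?fejer_wt_ge0// -exprMn -nmM.
have -> : fejer_root p t * (phase p t - 1) = inv_sqrtJ%:C * (phase p t ^+ J - 1).
  by rewrite /fejer_root subrX1 -mulrA; congr (_ * _); rewrite mulrC.
rewrite nmM exprMn nmr ger0_norm ?inv_sqrtJ_ge0// inv_sqrtJ_sq mulrC ler_wpM2r ?invr_ge0//.
rewrite (_ : 4 = 2 ^+ 2); last by ring.
rewrite lerXn2r ?nnegrE ?nm_ge0// (le_trans (nmB _ _))// nmX nm_phase expr1n nm1; lra.
Qed.

(** By unique factorisation the product of the polynomial and the Fejer roots is again a
    Dirichlet polynomial with distinct frequencies and the same norm. *)
Lemma fejer_mean_square X ps : all prime ps -> uniq ps ->
  exists N0, forall N, (N0 <= N)%N -> forall l,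
  uniq [seq p.2 | p <- l] -> all (fun p => (0 < p.2 <= X)%N) l ->
  (forall q, q \in ps -> nodvd q l) ->
  1 / 2 * norm2 l <= avg N (fun t => fejer_wt ps t * nm (dpoly l t) ^+ 2) <= 2 * norm2 l.
Proof.
move=> aps ups.
have [N0 hN0] := @mean_square_asymp R (weighted_bound ps * X) (1 / 2) ltac:(by rewrite divr_gt0).
exists N0 => N NN l ul al nd.
have al1 : all (fun p : R[i] * nat => (0 < p.2)%N) l.
  by apply: sub_all al => u /andP[].
have al2 : all (fun p : R[i] * nat => (p.2 <= X)%N) l.
  by apply: sub_all al => u /andP[].
have := hN0 N NN (weighted_terms ps l) (weighted_terms_uniq aps ups al1 nd ul).
rewrite norm2_weighted_terms.
have -> : avg N (fun t => nm (dpoly (weighted_terms ps l) t) ^+ 2) =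
    avg N (fun t => fejer_wt ps t * nm (dpoly l t) ^+ 2).
  by congr avg; apply/funext => t; rewrite dpoly_weighted_terms// nmM exprMn.
have h : all (fun p : R[i] * nat => (0 < p.2 <= weighted_bound ps * X)%N) (weighted_terms ps l).
  have := weighted_terms_pos aps al1; have := weighted_terms_bound aps al2.
  by move=> /allP b1 /allP b2; apply/allP => u uw; rewrite b1 ?b2.
move=> /(_ h) /andP[h1 h2]; have := norm2_ge0 l => n0.
by apply/andP; split; lra.
Qed.

Lemma norm2_one : norm2 [:: (1 : R[i], 1%N)] = 1.
Proof. by rewrite /norm2 big_seq1 /= nm1 expr1n. Qed.

Lemma dpoly_one t : dpoly [:: (1 : R[i], 1%N)] t = 1.
Proof. by rewrite /dpoly big_seq1 /= ln1 mulr0 oppr0 /cis cos0 sin0 mul1r. Qed.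

Lemma fejer_mean ps : all prime ps -> uniq ps ->
  exists N0, forall N, (N0 <= N)%N -> 1 / 2 <= avg N (fejer_wt ps) <= 2.
Proof.
move=> aps ups; have [N0 hN0] := fejer_mean_square 1 aps ups.
exists N0 => N NN; have := hN0 N NN [:: (1, 1%N)] erefl erefl.
rewrite norm2_one !mulr1.
have -> : avg N (fun t => fejer_wt ps t * nm (dpoly [:: (1 : R[i], 1%N)] t) ^+ 2) = avg N (fejer_wt ps).
  by congr avg; apply/funext => t; rewrite dpoly_one nm1 expr1n mulr1.
apply=> q qps; rewrite /nodvd /= andbT dvdn1.
by have /allP/(_ q qps)/prime_gt1 := aps; case: q {qps} => [|[]].
Qed.

Lemma fejer_mean_close ps p : all prime ps -> uniq ps -> p \in ps ->
  exists N0, forall N, (N0 <= N)%N ->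
    avg N (fun t => fejer_wt ps t * nm (phase p t - 1) ^+ 2) <= 8 / J%:R.
Proof.
move=> aps ups pps.
have aps' : all prime (rem p ps) by apply/allP => q /mem_rem; move/allP: aps; apply.
have [N0 hN0] := fejer_mean aps' (rem_uniq p ups).
exists N0 => N NN; have /andP[_ h] := hN0 N NN.
apply: (@le_trans _ _ (avg N (fun t => 4 / J%:R * fejer_wt (rem p ps) t))).
  by apply: avg_le => i j _ _; exact: fejer_concentrated.
rewrite avgZ; have : 0 <= 4 / J%:R :> R by rewrite divr_ge0.
have -> : 8 / J%:R = 4 / J%:R * 2 :> R by ring.
by move=> J4; rewrite ler_wpM2l.
Qed.

End Weights.

(** * The mean square of the mollified error *)

Section MeanSquareEta.
Variable R : realType.
Implicit Types (x y e t r a b : R) (z w s : R[i]) (l : seq (R[i] * nat)).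

Lemma ln_le_linear N : (20 <= N)%N -> ln ((4 * N)%:R : R) <= N%:R.
Proof.
move=> N20; have N0 : (20 : R) <= N%:R by rewrite ler_nat.
have p0 : (0 : R) < (4 * N)%:R by rewrite natrM; lra.
rewrite -ler_expR lnK ?posrE// natrM.
have -> : expR (N%:R : R) = expR (N%:R / 2) ^+ 2.
  by rewrite expr2 -expRD -splitr.
have h := expR_ge1Dx (N%:R / 2 : R).
rewrite expr2; nra.
Qed.

(** At heights up to 3N the series for eta is within O(N^-x) of its partial sum of length 4N
    ([eta_approx]). The difference to the short sum is then a Dirichlet polynomial whose
    length is proportional to N, where [mean_square] still gives a bound by a constant
    times the norm. *)
Lemma eta_altsum_mean_square x1 m e b : 1 / 2 < x1 -> (0 < m)%N -> 64 * 4 ^+ 2 <= b ->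
  (1 + b) * (rpow m (2 * x1 - 1) / (2 * x1 - 1)) <= e / 4 -> 0 < e ->
  exists N0, forall N, (N0 <= N)%N -> forall s, x1 <= Re s <= 1 -> `|Im s| <= 1 ->
    avg N (fun t => nm (eta (vshift s t) - altsum m.+1 (vshift s t)) ^+ 2) <= e.
Proof.
move=> x1h m0 hb hT e0.
have e360 : 0 < Num.min 1 (e / 36) by rewrite lt_min ltr01 divr_gt0.
have x10 : 0 < x1 by lra.
have [n0 hn0] := rpow_small x10 e360.
exists (maxn (maxn 20 m) n0) => N; rewrite !geq_max => /andP[/andP[N20 Nm] Nn0] s /andP[s1 s2] ims.
have N0 : (0 < N)%N by exact: leq_trans N20.
have N20' : (20 : R) <= N%:R by rewrite ler_nat.
have N0' : (0 : R) < N%:R by lra.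
have p4 : (0 < 4 * N)%N by rewrite muln_gt0.
(* The terms between m and 4N; heights are below 3N, so 4N terms satisfy the hypothesis of
   [eta_approx]. *)
pose el : seq (R[i] * nat) := [seq ((-1) ^+ k.+1 * ipow k s, k) | k <- index_iota m.+1 (4 * N)].
have eln : norm2 el <= rpow m (2 * x1 - 1) / (2 * x1 - 1).
  rewrite /norm2 big_map /=; apply: le_trans (sum_rpow_tail xpredT (4 * N) x1h s1 m0).
  apply: ler_sum => k _.
  by rewrite nmM nmX nmN nm1 expr1n mul1r nm_ipow rpow_sq.
have /andP[_ hms] : (1 - b) * norm2 el <= avg N (fun t => nm (dpoly el t) ^+ 2)
     <= (1 + b) * norm2 el.
  apply: (@mean_square_le _ el N (4 * N) b) => //.
  - exact: ln_le_linear.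
  - by rewrite -map_comp map_id_in ?iota_uniq.
  - apply/allP => -[z n] /mapP[k]; rewrite mem_index_iota => /andP[k1 k2] [_ ->] /=.
    by rewrite (leq_trans _ k1)//= ltnW.
  by rewrite natrM mulfK// gt_eqF.
apply: (@le_trans _ _ (avg N (fun t => e / 2 + 2 * nm (dpoly el t) ^+ 2))).
  apply: avg_le => i j ii jj; set t := sample _ _ _ _.
  have tN : t <= 3 * N%:R /\ N%:R <= t.
    have iN : (i%:R : R) <= N%:R * N%:R by rewrite -natrM ler_nat ltnW.
    have jN : (j%:R : R) <= N%:R * N%:R by rewrite -natrM ler_nat ltnW.
    have i0 : (0 : R) <= i%:R by []. have j0 : (0 : R) <= j%:R by [].
    have h : (i%:R - j%:R) / N%:R <= (N%:R : R) by rewrite ler_pdivrMr//; lra.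
    have h' : - (N%:R : R) <= (i%:R - j%:R) / N%:R by rewrite ler_pdivlMr//; lra.
    by rewrite /t /sample natrM; split; lra.
  have sup0 : 0 < Re (vshift s t) by rewrite Re_vshift; lra.
  have hN : Re (vshift s t) + `|Im (vshift s t)| <= (4 * N)%:R.
    rewrite Re_vshift Im_vshift natrM.
    by have := ler_normD (Im s) t; rewrite (ger0_norm (_ : 0 <= t)); lra.
  have h1 := eta_approx sup0 p4 hN.
  have h2 : altsum (4 * N) (vshift s t) - altsum m.+1 (vshift s t) = dpoly el t.
    rewrite /altsum (@big_cat_nat _ _ _ m.+1)//=; last first.
      by apply: (leq_ltn_trans Nm); rewrite ltn_Pmull.
    rewrite addrAC subrr add0r /dpoly big_map; apply: eq_bigr => k _ /=.
    by rewrite ipow_vshift mulrA.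
  rewrite (_ : eta _ - _ = (eta (vshift s t) - altsum (4 * N) (vshift s t)) + dpoly el t); last first.
    by rewrite -h2; ring.
  have := nm_sub_sq (eta (vshift s t) - altsum (4 * N) (vshift s t)) (- dpoly el t).
  rewrite opprK nmN => /le_trans; apply; rewrite lerD2r.
  have h3 : rpow (4 * N) (Re (vshift s t)) <= Num.min 1 (e / 36).
    rewrite Re_vshift; apply: le_trans (rpow_antimono _ s1) _; apply/ltW/hn0.
    by rewrite (leq_trans Nn0)// leq_pmull.
  move: h3; rewrite le_min => /andP[h3 h4].
  have := rpow_ge0 (4 * N) (Re (vshift s t)) => h5.
  have h6 := nm_ge0 (eta (vshift s t) - altsum (4 * N) (vshift s t)).
  apply: (@le_trans _ _ (2 * (3 * rpow (4 * N) (Re (vshift s t))) ^+ 2)).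
    by rewrite ler_pM2l// lerXn2r// nnegrE//; lra.
  rewrite expr2; move: h3 h4 h5; move: (rpow _ _) => q h3 h4 h5.
  have : q * q <= q by rewrite ler_piMr.
  lra.
rewrite avgD avg_cst// avgZ; move: eln hT hms.
have b0 : 0 <= 1 + b by rewrite addr_ge0// (le_trans _ hb)// mulr_ge0// exprn_ge0.
move: (rpow m _ / _) (norm2 el) (avg N _) => T n2 A h1 h2 h3.
have := ler_wpM2l b0 h1; lra.
Qed.

(** For Re s > 1 this is kappa (zeta prod (1 - p^-s) - 1), a Dirichlet series over integers
    free of the primes ps, apart from the factor 2^-s in kappa. *)
Definition mollified_err ps s : R[i] := eta s * eprod ps s - kappa s.

Lemma eprod_bound ps s : 0 <= Re s -> nm (eprod ps s) <= 2 ^+ size ps.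
Proof.
move=> s0; rewrite /eprod; elim: ps => [|p ps ih]; first by rewrite big_nil nm1.
by rewrite big_cons nmM [leRHS]exprS ler_pM ?nm_ge0 ?nm_one_sub_ipow.
Qed.

Lemma rough1 ps : all prime ps -> rough ps 1.
Proof.
move=> aps; apply/allP => p /(allP aps) /prime_gt1; rewrite dvdn1.
by case: p => [|[]].
Qed.

Lemma rough_nodvd ps (ns : seq nat) s q : q \in ps ->
  nodvd q (ipow_terms s [seq k <- ns | rough ps k]).
Proof.
move=> qps; apply/allP => u /mapP[k]; rewrite mem_filter => /andP[/allP rk _] -> /=.
exact: rk.
Qed.

Lemma rough_sum_sub1 ps N s : all prime ps -> (0 < N)%N ->
  rough_sum ps N s - 1 = \sum_(k <- [seq k <- index_iota 2 N.+1 | rough ps k]) ipow k s.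
Proof.
move=> aps N0; rewrite -rough_sum_diff//; congr (_ - _).
by rewrite /rough_sum big_mkcond big_nat1 rough1// ipow1.
Qed.

Lemma nm_sum5_sq z0 z1 z2 z3 z4 :
  nm (z0 + z1 + z2 + z3 + z4 : R[i]) ^+ 2 <=
  5 * (nm z0 ^+ 2 + nm z1 ^+ 2 + nm z2 ^+ 2 + nm z3 ^+ 2 + nm z4 ^+ 2).
Proof.
have h : nm (z0 + z1 + z2 + z3 + z4) <= nm z0 + nm z1 + nm z2 + nm z3 + nm z4.
  by do 4 (rewrite (le_trans (nmD _ _))// lerD2r).
apply: (@le_trans _ _ ((nm z0 + nm z1 + nm z2 + nm z3 + nm z4) ^+ 2)).
  by rewrite lerXn2r ?nnegrE ?nm_ge0// !addr_ge0 ?nm_ge0.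
move: (nm z0) (nm z1) (nm z2) (nm z3) (nm z4) => a b c d e.
have := sqr_ge0 (a - b); have := sqr_ge0 (a - c); have := sqr_ge0 (a - d).
have := sqr_ge0 (a - e); have := sqr_ge0 (b - c); have := sqr_ge0 (b - d).
have := sqr_ge0 (b - e); have := sqr_ge0 (c - d); have := sqr_ge0 (c - e).
have := sqr_ge0 (d - e); lra.
Qed.

(** An integer > 1 free of the primes up to M exceeds M. *)
Lemma rough_rpow_tail ps M x1 x N : (0 < M)%N ->
  (forall n, (1 < n)%N -> rough ps n -> (M < n)%N) -> 1 / 2 < x1 -> x1 <= x ->
  \sum_(k <- [seq k <- index_iota 2 N.+1 | rough ps k]) rpow k (2 * x) <=
  rpow M (2 * x1 - 1) / (2 * x1 - 1).
Proof.
move=> M0 hM x1h x1x; rewrite big_filter.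
apply: le_trans (sum_rpow_tail xpredT N.+1 x1h x1x M0).
rewrite [leRHS](big_nat_widenl _ 2)//= [leRHS]big_mkcond [leLHS]big_mkcond /=.
rewrite big_nat_cond [leRHS]big_nat_cond; apply: ler_sum => k /andP[/andP[k1 _] _].
case: ifP => [rk|_]; last by case: ifP => // _; exact: rpow_ge0.
by rewrite (hM _ k1 rk).
Qed.

(** The main part consists of two polynomials over integers > M free of the primes ps, where
    [fejer_mean_square] applies; the weight is bounded by J^|ps|, so that the truncation
    errors need only have small unweighted mean square. *)
Lemma mollified_mean_square chi J ps x1 M e : (forall p, chi p ^+ 2 = 1 :> R) -> (0 < J)%N ->
  1 / 2 < x1 -> all prime ps -> uniq ps -> (0 < M)%N ->
  (forall n, (1 < n)%N -> rough ps n -> (M < n)%N) -> 0 < e ->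
  exists N0, forall N, (N0 <= N)%N -> forall s, x1 <= Re s <= 1 -> `|Im s| <= 1 ->
    avg N (fun t => fejer_wt chi J ps t * nm (mollified_err ps (vshift s t)) ^+ 2) <=
    50 * (rpow M (2 * x1 - 1) / (2 * x1 - 1)) + e.
Proof.
move=> chi_sq J0 x1h aps ups M0 hM e0.
have a0 : 0 < 2 * x1 - 1 by lra.
pose W : R := J%:R ^+ size ps.
have W0 : 0 < W by rewrite exprn_gt0// ltr0n.
pose PB : R := 2 ^+ size ps.
have PB0 : 0 < PB by rewrite exprn_gt0.
pose e1 := e / (50 * W); have e10 : 0 < e1 by rewrite divr_gt0// mulr_gt0.
pose e2 := e / (10 * W * PB ^+ 2).
have e20 : 0 < e2 by rewrite divr_gt0// !mulr_gt0// exprn_gt0.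
have [Y0 hY0] := sieve_err_small x1h aps ups e10.
have [b hb] : exists b : R, 64 * 4 ^+ 2 <= b by exists (64 * 4 ^+ 2).
have b0 : 0 < 1 + b by rewrite ltr_pwDl// (le_trans _ hb)// mulr_ge0// exprn_ge0.
have e30 : 0 < e2 / 4 / (1 + b) * (2 * x1 - 1).
  by apply: mulr_gt0 => //; rewrite divr_gt0// divr_gt0.
have [Y1 hY1] := rpow_small a0 e30.
pose Y := (maxn Y0 Y1).+1.
have YY0 : (Y0 <= Y)%N by rewrite leqW// leq_maxl.
have YY1 : (Y1 <= Y)%N by rewrite leqW// leq_maxr.
have Y2 : (Y <= 2 * Y)%N by rewrite leq_pmull.
have [N1 hN1] := hY0 Y YY0.
have [N2 hN2] := hY0 (2 * Y)%N (leq_trans YY0 Y2).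
have [N3 hN3] := fejer_mean_square chi_sq J0 (2 * Y) aps ups.
have hT : (1 + b) * (rpow (2 * Y) (2 * x1 - 1) / (2 * x1 - 1)) <= e2 / 4.
  have h := hY1 (2 * Y)%N (leq_trans YY1 Y2).
  have : rpow (2 * Y) (2 * x1 - 1) / (2 * x1 - 1) <= e2 / 4 / (1 + b).
    by rewrite ler_pdivrMr// ltW.
  by rewrite ler_pdivlMr// mulrC.
have [N4 hN4] := eta_altsum_mean_square x1h (ltn0Sn _ : 0 < 2 * Y)%N hb hT e20.
exists (maxn 1 (maxn (maxn N1 N2) (maxn N3 N4))) => N.
rewrite !geq_max => /and3P[N0 /andP[NN1 NN2] /andP[NN3 NN4]] s /andP[s1 s2] ims.
have s12 : x1 <= Re s <= 1 by rewrite s1.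
have g1 := hN1 N NN1 s s1; have g2 := hN2 N NN2 s s1.
have g4 := hN4 N NN4 s s12 ims.
pose ns K := [seq k <- index_iota 2 K.+1 | rough ps k].
set T := rpow M (2 * x1 - 1) / _.
have g3 K : (K <= 2 * Y)%N ->
    avg N (fun t => fejer_wt chi J ps t * nm (dpoly (ipow_terms s (ns K)) t) ^+ 2) <= 2 * T.
  move=> KY; have /andP[_ h] : 1 / 2 * norm2 (ipow_terms s (ns K)) <=
      avg N (fun t => fejer_wt chi J ps t * nm (dpoly (ipow_terms s (ns K)) t) ^+ 2) <=
      2 * norm2 (ipow_terms s (ns K)).
    apply: hN3 => //.
    - by rewrite ipow_terms_snd filter_uniq// iota_uniq.
    - apply/allP => -[z n] /mapP[k]; rewrite mem_filter mem_index_iota ltnS => /and3P[_ k1 k2] [_ ->] /=.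
      by rewrite (leq_trans k2 KY) (leq_trans _ k1).
    - by move=> q qps; exact: rough_nodvd.
  apply: le_trans h _; rewrite ler_pM2l// norm2_ipow_terms.
  exact: rough_rpow_tail.
have WW t : fejer_wt chi J ps t <= W by exact: fejer_wt_le.
have wt0 t := fejer_wt_ge0 chi J ps t.
apply: (@le_trans _ _ (avg N (fun t =>
   5 * (fejer_wt chi J ps t * nm (dpoly (ipow_terms s (ns (2 * Y)%N)) t) ^+ 2)
   + 5 * W * nm (sieve_err ps (2 * Y) (vshift s t)) ^+ 2
   + 20 * (fejer_wt chi J ps t * nm (dpoly (ipow_terms s (ns Y)) t) ^+ 2)
   + 20 * W * nm (sieve_err ps Y (vshift s t)) ^+ 2
   + 5 * W * PB ^+ 2 * nm (eta (vshift s t) - altsum (2 * Y).+1 (vshift s t)) ^+ 2))).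
  apply: avg_le => i j _ _; set t := sample _ _ _ _; set v := vshift s t.
  have v0 : 0 <= Re v by rewrite Re_vshift; lra.
  pose k2 := 2 * ipow 2 v.
  have k2b : nm k2 ^+ 2 <= 4.
    rewrite (_ : 4 = 2 ^+ 2); last by ring.
    rewrite lerXn2r ?nnegrE ?nm_ge0// nmM nm_nat nm_ipow.
    by have := @rpow_le1 R 2 _ v0; lra.
  (* The partial sum of eta of length 2Y is the partial sum of zeta of length 2Y minus
     2^(1-s) times that of length Y; both are multiplied by the sieving product. *)
  have -> : mollified_err ps v = dpoly (ipow_terms s (ns (2 * Y)%N)) t + sieve_err ps (2 * Y) v
     - k2 * dpoly (ipow_terms s (ns Y)) t - k2 * sieve_err ps Y v
     + (eta v - altsum (2 * Y).+1 v) * eprod ps v.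
    rewrite !dpoly_ipow_terms -!rough_sum_sub1//.
    by rewrite altsum_even /mollified_err /sieve_err /kappa -/k2; ring.
  have := nm_sum5_sq (dpoly (ipow_terms s (ns (2 * Y)%N)) t) (sieve_err ps (2 * Y) v)
     (- (k2 * dpoly (ipow_terms s (ns Y)) t)) (- (k2 * sieve_err ps Y v))
     ((eta v - altsum (2 * Y).+1 v) * eprod ps v).
  rewrite !nmN (nmM k2) (nmM k2) (nmM (eta v - _)) !exprMn.
  have pb : nm (eprod ps v) ^+ 2 <= PB ^+ 2.
    by rewrite lerXn2r ?nnegrE ?nm_ge0 ?(ltW PB0)// eprod_bound.
  move: (sqr_ge0 (nm (dpoly (ipow_terms s (ns (2 * Y)%N)) t))) (sqr_ge0 (nm (sieve_err ps (2 * Y) v)))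
    (sqr_ge0 (nm (dpoly (ipow_terms s (ns Y)) t))) (sqr_ge0 (nm (sieve_err ps Y v)))
    (sqr_ge0 (nm (eta v - altsum (2 * Y).+1 v))) (WW t) (wt0 t) k2b pb.
  move: (nm (dpoly (ipow_terms s (ns (2 * Y)%N)) t) ^+ 2) (nm (sieve_err ps (2 * Y) v) ^+ 2)
    (nm (dpoly (ipow_terms s (ns Y)) t) ^+ 2) (nm (sieve_err ps Y v) ^+ 2)
    (nm (eta v - altsum (2 * Y).+1 v) ^+ 2) (fejer_wt chi J ps t) (nm k2 ^+ 2) (nm (eprod ps v) ^+ 2)
    => A1 B1 A2 B2 E w k p A10 B10 A20 B20 E0 wW w0 hk hp.
  move: (PB ^+ 2) (sqr_ge0 PB) hp => q q0 hp h.
  apply: le_trans (ler_wpM2l w0 h) _.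
  have c1 : w * B1 <= W * B1 by rewrite ler_wpM2r.
  have c2 : k * A2 <= 4 * A2 by rewrite ler_wpM2r.
  have c3 : w * (k * A2) <= w * (4 * A2) by rewrite ler_wpM2l.
  have c4 : w * (k * B2) <= W * (4 * B2).
    apply: (@le_trans _ _ (w * (4 * B2))); first by rewrite ler_wpM2l// ler_wpM2r.
    by rewrite ler_wpM2r// mulr_ge0.
  have c5 : w * (E * p) <= W * (E * q).
    apply: (@le_trans _ _ (w * (E * q))); first by rewrite ler_wpM2l// ler_wpM2l.
    by rewrite ler_wpM2r// mulr_ge0.
  lra.
rewrite !avgD !avgZ.
have := g3 _ (leqnn _); have := g3 _ Y2.
have i1 : W * e1 = e / 50 by rewrite /e1; field; rewrite gt_eqF.
have i2 : W * PB ^+ 2 * e2 = e / 10.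
  by rewrite /e2; field; rewrite !gt_eqF.
have j1 : W * avg N (fun t => nm (sieve_err ps (2 * Y) (vshift s t)) ^+ 2) <= W * e1.
  by rewrite ler_pM2l.
have j2 : W * avg N (fun t => nm (sieve_err ps Y (vshift s t)) ^+ 2) <= W * e1.
  by rewrite ler_pM2l.
have j3 : W * PB ^+ 2 * avg N (fun t => nm (eta (vshift s t) - altsum (2 * Y).+1 (vshift s t)) ^+ 2)
   <= W * PB ^+ 2 * e2.
  by rewrite ler_pM2l// mulr_gt0// exprn_gt0.
lra.
Qed.

End MeanSquareEta.

(** * The sequence of primes *)

Section Primes.

Lemma prime_above_ex m : exists p, prime p && (m < p)%N.
Proof. by have [p mp pp] := prime_above m; exists p; rewrite pp. Qed.

Definition next_prime m := ex_minn (prime_above_ex m).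

Fixpoint nth_prime n := if n is n'.+1 then next_prime (nth_prime n') else 2%N.

Lemma next_primeP m : [/\ prime (next_prime m), (m < next_prime m)%N &
  forall p, prime p -> (m < p)%N -> (next_prime m <= p)%N].
Proof.
rewrite /next_prime; case: ex_minnP => p /andP[pp mp] h; split => // q pq mq.
by apply: h; rewrite pq.
Qed.

Lemma nth_prime_prime n : prime (nth_prime n).
Proof. by case: n => [//|n] /=; have [] := next_primeP (nth_prime n). Qed.

Lemma nth_prime_lt n : (nth_prime n < nth_prime n.+1)%N.
Proof. by rewrite /=; have [] := next_primeP (nth_prime n). Qed.

Lemma nth_prime_mono m n : (m <= n)%N -> (nth_prime m <= nth_prime n)%N.
Proof.
move=> mn; rewrite -(subnK mn); elim: (n - m)%N => [//|k ih].
by rewrite addSn (leq_trans ih)// ltnW// nth_prime_lt.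
Qed.

Lemma nth_prime_ltn m n : (m < n)%N -> (nth_prime m < nth_prime n)%N.
Proof. by move=> mn; apply: leq_trans (nth_prime_mono mn); exact: nth_prime_lt. Qed.

Lemma nth_prime_inj : injective nth_prime.
Proof.
move=> m n e; have [mn|nm'|//] := ltngtP m n.
  by have := nth_prime_ltn mn; rewrite e ltnn.
by have := nth_prime_ltn nm'; rewrite e ltnn.
Qed.

Lemma nth_prime_ge n : (n.+2 <= nth_prime n)%N.
Proof.
elim: n => [//|n ih]; exact: leq_ltn_trans ih (nth_prime_lt n).
Qed.

Lemma nth_prime_gt0 n : (0 < nth_prime n)%N.
Proof. exact: prime_gt0 (nth_prime_prime n). Qed.

Lemma nth_prime_surj p M : prime p -> (p < nth_prime M)%N ->
  exists2 j, (j < M)%N & p = nth_prime j.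
Proof.
move=> pp; elim: M => [|M ih] /= h.
  by have := prime_gt1 pp; rewrite leqNgt h.
have [hM|Mp] := ltnP p (nth_prime M).
  by have [j jM ->] := ih hM; exists j => //; exact: ltnW.
exists M => //; apply/eqP; rewrite eqn_leq Mp andbT leqNgt; apply/negP => Mp'.
have [_ _ /(_ p pp Mp')] := next_primeP (nth_prime M).
by rewrite leqNgt h.
Qed.

Definition first_primes M := [seq nth_prime j | j <- iota 0 M].

Lemma first_primes_prime M : all prime (first_primes M).
Proof. by apply/allP => p /mapP[j _ ->]; exact: nth_prime_prime. Qed.

Lemma first_primes_uniq M : uniq (first_primes M).
Proof. by rewrite map_inj_uniq ?iota_uniq//; exact: nth_prime_inj. Qed.

Lemma size_first_primes M : size (first_primes M) = M.
Proof. by rewrite size_map size_iota. Qed.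

(** The smallest prime factor of n is at least the prime number M (counted from 0), which
    exceeds M. *)
Lemma rough_first_primes M n : (1 < n)%N -> rough (first_primes M) n -> (M < n)%N.
Proof.
move=> n1 /allP h; have pp := pdiv_prime n1.
have [hM|Mp] := ltnP (pdiv n) (nth_prime M).
  have [j jM e] := nth_prime_surj pp hM.
  have pin : pdiv n \in first_primes M by rewrite e map_f// mem_iota.
  by have := h _ pin; rewrite pdiv_dvd.
apply: leq_trans (pdiv_leq (ltnW n1)); apply: leq_trans Mp.
by apply: leq_trans (nth_prime_ge M).
Qed.

Section Divergence.
Variable R : realType.
Implicit Types (x y e t r a b : R).

Definition rough_harmonic ps N : R := \sum_(1 <= n < N.+1 | rough ps n) (n%:R)^-1.

(** The multiples of p carry at most a share 1 / p of the sum. *)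
Lemma rough_harmonic_cons p ps N : prime p -> all prime ps -> p \notin ps ->
  (1 - (p%:R)^-1) * rough_harmonic ps N <= rough_harmonic (p :: ps) N.
Proof.
move=> pp aps pps; have p0 := prime_gt0 pp.
rewrite /rough_harmonic mulrBl mul1r lerBlDr.
rewrite [leLHS](bigID (fun n => (p %| n)%N)) /= addrC; apply: lerD.
  by rewrite le_eqVlt; apply/orP; left; apply/eqP; apply: eq_bigl => n; rewrite /rough/= andbC.
under eq_bigl do rewrite andbC.
rewrite sum_multiples//.
apply: (@le_trans _ _ ((p%:R)^-1 * \sum_(1 <= n < (N %/ p).+1 | rough ps n) (n%:R)^-1)).
  rewrite mulr_sumr le_eqVlt; apply/orP; left; apply/eqP.
  rewrite big_nat_cond [RHS]big_nat_cond; apply: eq_big => m.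
    by rewrite rough_mul.
  by rewrite natrM invfM.
rewrite ler_wpM2l ?invr_ge0// [leRHS](@big_cat_nat _ _ _ (N %/ p).+1)//=; last first.
  by rewrite ltnS leq_div.
by rewrite lerDl sumr_ge0// => n _; rewrite invr_ge0.
Qed.

(** Euler's argument in finite form. *)
Lemma rough_harmonic_prod ps N : all prime ps -> uniq ps ->
  \prod_(p <- ps) (1 - (p%:R)^-1) * \sum_(1 <= n < N.+1) (n%:R)^-1 <= rough_harmonic ps N.
Proof.
elim: ps => [|p ps ih] /=; first by rewrite big_nil mul1r.
move=> /andP[pp aps] /andP[pps ups]; rewrite big_cons.
apply: le_trans (rough_harmonic_cons N pp aps pps).
rewrite -mulrA ler_wpM2l ?ih// subr_ge0 invf_le1 ?ltr0n ?prime_gt0// ler1n prime_gt0//.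
Qed.

Lemma harmonic_ge_ln N : ln (N.+1%:R : R) <= \sum_(1 <= n < N.+1) (n%:R)^-1.
Proof.
elim: N => [|N ih]; first by rewrite big_geq// ln1.
rewrite big_nat_recr//=.
have -> : ln (N.+2%:R : R) = ln (N.+1%:R) + ln (1 + N.+1%:R^-1).
  rewrite -lnM; [|by rewrite posrE ltr0n|by rewrite posrE addr_gt0// invr_gt0].
  by congr ln; rewrite -[N.+2%:R]natr1 mulrDr mulr1 divff// pnatr_eq0.
apply: lerD => //; apply: le_ln1Dx.
by rewrite (lt_trans (ltrN10 _))// invr_gt0.
Qed.

Lemma rough_harmonic_first_primes M : rough_harmonic (first_primes M) M = 1 \/ M = 0%N.
Proof.
case: M => [|M]; [by right|left].
rewrite /rough_harmonic big_ltn_cond// rough1 ?first_primes_prime// invr1.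
rewrite big_nat_cond big1 ?addr0// => n /andP[/andP[n1 n2] rn].
by have := rough_first_primes n1 rn; rewrite ltnNge -ltnS n2.
Qed.

(** Sieving the first M primes from the integers up to M leaves only 1, so the harmonic sum
    is at most prod (1 - 1/p)^-1 <= exp(2 sum 1/p), while it is at least log M. *)
Lemma prime_sum_diverges (b : R) : exists M, b <= \sum_(j < M) (nth_prime j)%:R^-1.
Proof.
apply: contrapT => hn.
have hb M : \sum_(j < M) (nth_prime j)%:R^-1 <= b.
  by rewrite leNgt; apply/negP => h; apply: hn; exists M; exact: ltW.
have [M hM] := nat_above (expR (expR (2 * b))).
have [h|h0] := rough_harmonic_first_primes M; last first.
  by move: hM; rewrite h0 ltNge expR_ge0.
have := rough_harmonic_prod M (first_primes_prime M) (first_primes_uniq M).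
rewrite h leNgt => /negP; apply.
have e1 : expR (- (2 * b)) <= \prod_(p <- first_primes M) (1 - (p%:R)^-1 : R).
  apply: (@le_trans _ _ (\prod_(p <- first_primes M) expR (- (2 * (p%:R)^-1)))).
    rewrite -expR_sum ler_expR sumrN lerN2 -mulr_sumr ler_pM2l//.
    by rewrite big_map -(subn0 M) -/(index_iota 0 M) big_mkord.
  rewrite big_seq_cond [leRHS]big_seq_cond; apply: ler_prod => p /andP[pM _].
  rewrite expR_ge0 /= expRN -[leLHS]mul1r ler_pdivrMr ?expR_gt0//.
  have p2 : (2 : R) <= p%:R by rewrite ler_nat prime_gt1// (allP (first_primes_prime M)).
  have i2 : (p%:R)^-1 <= (2^-1 : R) by rewrite lef_pV2 ?posrE//; lra.
  have i0 : 0 < ((p%:R)^-1 : R) by rewrite invr_gt0; lra.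
  have := expR_ge1Dx (2 * (p%:R)^-1 : R); move: i2 i0; move: (_^-1) (expR _) => u E.
  by move=> i2 i0 hE; nra.
have e2 := harmonic_ge_ln M.
have e3 : expR (2 * b) < \sum_(1 <= n < M.+1) (n%:R)^-1 :> R.
  apply: lt_le_trans e2; rewrite -[ltLHS]expRK ltr_ln ?posrE ?expR_gt0 ?ltr0n//.
  by rewrite (lt_le_trans hM)// ler_nat.
have : expR (- (2 * b)) * expR (2 * b) < expR (- (2 * b)) * \sum_(1 <= n < M.+1) (n%:R)^-1.
  by rewrite ltr_pM2l ?expR_gt0.
rewrite -expRD addNr expR0 => /lt_le_trans; apply.
by rewrite ler_wpM2r// sumr_ge0// => n _; rewrite invr_ge0.
Qed.

End Divergence.
End Primes.

(** * Euler products with signs *)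

Section SignedProduct.
Variable R : realType.
Implicit Types (x y e t r a b : R) (z w s c : R[i]).

(** For e = 1 and z = p^-s this is the Euler factor of zeta(2s) / zeta(s)^2. *)
Definition efactor e z : R[i] := (1 - e%:C * z) / (1 + e%:C * z).

Definition tprod (eps : nat -> R) M s : R[i] :=
  \prod_(n < M) efactor (eps n) (ipow (nth_prime n) s).

Lemma rpow2_half : rpow 2 (1 / 2) <= 3 / 4 :> R.
Proof.
have h : rpow 2 (1 / 2) ^+ 2 = 1 / 2 :> R.
  by rewrite rpow_sq (_ : 2 * (1 / 2) = 1) ?rpow_x1//; field.
by have := rpow_ge0 2 (1 / 2 : R); rewrite expr2 in h; nra.
Qed.

Lemma rpow_prime_le n x : 1 / 2 <= x -> rpow (nth_prime n) x <= 3 / 4.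
Proof.
move=> hx; apply: le_trans rpow2_half.
apply: (@le_trans _ _ (rpow 2 x)); last exact: rpow_antimono.
by apply: rpow_le => //; [lra|exact: prime_gt1 (nth_prime_prime n)].
Qed.

Lemma efactor_den e z : e ^+ 2 = 1 -> nm z <= 3 / 4 -> 1 / 4 <= nm (1 + e%:C * z).
Proof.
move=> e2 hz; have he : nm (e%:C * z) <= 3 / 4.
  by rewrite nmM nmr sign_norm1// mul1r.
have := nm_lB 1 (- (e%:C * z)); rewrite nm1 nmN opprK; lra.
Qed.

Lemma efactor_le e z : e ^+ 2 = 1 -> nm z <= 3 / 4 -> nm (efactor e z) <= 8.
Proof.
move=> e2 hz; have h := efactor_den e2 hz.
rewrite /efactor nmM nmV ler_pdivrMr; last by lra.
have := @efactor_den (- e) z ltac:(by rewrite sqrrN) hz.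
have := nmD 1 (- (e%:C * z)).
have : nm (e%:C * z) <= 3 / 4.
  by rewrite nmM nmr sign_norm1// mul1r.
rewrite nmN nm1; lra.
Qed.

Lemma cdiff_tprod eps M s : (forall n, eps n ^+ 2 = 1) -> 1 / 2 <= Re s ->
  cdiff (tprod eps M) s.
Proof.
move=> e2 hs; apply: cdiff_prod => n _; apply: cdiff_div.
- rewrite -nm_gt0.
  have := @efactor_den (eps n) (ipow (nth_prime n) s) (e2 n).
  by rewrite nm_ipow rpow_prime_le// => /(_ isT); lra.
- apply: cdiffB; first exact: cdiff_cst.
  by apply: cdiffM; [exact: cdiff_cst|exact: cdiff_ipow].
apply: cdiffD; first exact: cdiff_cst.
by apply: cdiffM; [exact: cdiff_cst|exact: cdiff_ipow].
Qed.

Lemma prod_pairs (I : comPzSemiRingType) (F : nat -> I) m j :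
  \prod_(n < m + 2 * j) F n =
  \prod_(n < m) F n * \prod_(i < j) (F (m + 2 * i)%N * F (m + 2 * i).+1).
Proof.
elim: j => [|j ih]; first by rewrite muln0 addn0 big_ord0 mulr1.
rewrite [in RHS]big_ord_recr /= mulrA -ih.
by rewrite mulnS addnCA add2n !big_ord_recr /= mulrA.
Qed.

Section Limit.
Variables (eps : nat -> R) (n1 : nat).
Hypothesis eps_sq : forall n, eps n ^+ 2 = 1.
Hypothesis eps_even : forall i, eps (n1 + 2 * i)%N = 1.
Hypothesis eps_odd : forall i, eps (n1 + 2 * i).+1 = -1.

Let K : R := 32 * 3.
Let K0 : 0 <= K. Proof. exact: mulr_ge0. Qed.
Let B : R := 8 ^+ n1 * expR K.
Let B0 : 0 < B. Proof. by rewrite mulr_gt0 ?expR_gt0// exprn_gt0. Qed.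

Let region s := 1 / 2 <= Re s /\ `|Im s| <= 1.
Let d s i : R := rpow (nth_prime (n1 + 2 * i)) (Re s) - rpow (nth_prime (n1 + 2 * i).+1) (Re s).

Let d_ge0 s i : region s -> 0 <= d s i.
Proof.
move=> [hs _]; rewrite subr_ge0 rpow_le ?nth_prime_gt0 ?nth_prime_mono//; lra.
Qed.

Let sum_d s i j : region s ->
  \sum_(k < j) d s (i + k) <= rpow (nth_prime (n1 + 2 * i)) (Re s).
Proof.
move=> hs.
suff h : \sum_(k < j) d s (i + k) <= rpow (nth_prime (n1 + 2 * i)) (Re s)
    - rpow (nth_prime (n1 + 2 * (i + j))) (Re s).
  by apply: le_trans h _; rewrite gerBl rpow_ge0.
elim: j => [|j ih]; first by rewrite big_ord0 addn0 subrr.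
rewrite big_ord_recr /=.
have : rpow (nth_prime (n1 + 2 * (i + j.+1))) (Re s) <=
    rpow (nth_prime (n1 + 2 * (i + j)).+1) (Re s).
  apply: rpow_le; rewrite ?nth_prime_gt0//; first by case: hs => *; lra.
  by apply: nth_prime_mono; rewrite addnS mulnS addnCA add2n.
move: ih; rewrite /d; lra.
Qed.

Let pairf s i := efactor 1 (ipow (nth_prime (n1 + 2 * i)) s) *
  efactor (-1) (ipow (nth_prime (n1 + 2 * i).+1) s).

Let pair_close s i : region s -> nm (pairf s i - 1) <= K * d s i.
Proof.
move=> hs; have [h1 h2] := hs.
have x1 : nm (ipow (nth_prime (n1 + 2 * i)) s) <= 3 / 4 by rewrite nm_ipow rpow_prime_le.
have x2 : nm (ipow (nth_prime (n1 + 2 * i).+1) s) <= 3 / 4 by rewrite nm_ipow rpow_prime_le.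
have s0 : 0 < Re s by lra.
have hd := ipow_diff s0 (nth_prime_gt0 (n1 + 2 * i)) (ltnW (nth_prime_lt (n1 + 2 * i))).
have d1 := @efactor_den 1 _ (expr1n _ 2) x1.
have d2 := @efactor_den (-1) _ ltac:(by rewrite sqrrN expr1n) x2.
rewrite /pairf /efactor; move: x1 x2 hd d1 d2.
move: (ipow _ s) (ipow _ s) => v u x1 x2 hd d1 d2.
rewrite rmorphN rmorph1 !mulN1r !mul1r opprK in d1 d2 *.
have u0 : 1 + u != 0 by rewrite -nm_gt0; lra.
have v0 : 1 - v != 0 by rewrite -nm_gt0; lra.
have -> : (1 - u) / (1 + u) * ((1 + v) / (1 - v)) - 1 =
    (2 * (v - u)) / ((1 + u) * (1 - v)) by field; rewrite v0 u0.
rewrite nmM nmV !nmM nm_nat nmBC.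
have dd : 1 / 16 <= nm (1 + u) * nm (1 - v).
  apply: (@le_trans _ _ (1 / 4 * (1 / 4))); first by lra.
  by apply: ler_pM => //; lra.
rewrite ler_pdivrMr; last by lra.
have cc : 1 + `|Im s| / Re s <= 3.
  suff : `|Im s| / Re s <= 2 by lra.
  rewrite ler_pdivrMr//; lra.
have dge := d_ge0 i hs.
have e1 : nm (u - v) <= 3 * d s i.
  by apply: le_trans hd _; rewrite ler_wpM2r.
have e2 : K * d s i * (1 / 16) <= K * d s i * (nm (1 + u) * nm (1 - v)).
  by rewrite ler_wpM2l// mulr_ge0.
apply: le_trans e2; rewrite /K; lra.
Qed.

Let tj j s := tprod eps (n1 + 2 * j) s.

Let tjS j s : tj j.+1 s = tj j s * pairf s j.
Proof.
rewrite /tj /tprod !(prod_pairs (fun n => efactor (eps n) (ipow (nth_prime n) s))).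
by rewrite big_ord_recr /= eps_even eps_odd mulrA.
Qed.

Let tj_bound j s : region s -> nm (tj j s) <= B.
Proof.
move=> hs; have [h1 h2] := hs.
have h : nm (tj j s) <= 8 ^+ n1 * expR (K * \sum_(k < j) d s (0 + k)).
  elim: j => [|j ih].
    rewrite big_ord0 mulr0 expR0 mulr1 /tj muln0 addn0 /tprod nm_prod.
    apply: (@le_trans _ _ (\prod_(i < n1) 8)); last by rewrite prodr_const card_ord.
    by apply: ler_prod => i _; rewrite nm_ge0 efactor_le// nm_ipow rpow_prime_le.
  rewrite tjS nmM big_ord_recr /= add0n mulrDr expRD mulrA.
  apply: ler_pM; rewrite ?nm_ge0//.
  apply: le_trans (expR_ge1Dx _).
  have := pair_close j hs; have := nmD 1 (pairf s j - 1); rewrite subrKC nm1; lra.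
apply: le_trans h _; rewrite ler_pM2l ?exprn_gt0// ler_expR -[leRHS]mulr1 ler_wpM2l//.
apply: le_trans (sum_d 0 j hs) _; apply: rpow_le1; lra.
Qed.

Let tj_cauchy i j s : region s ->
  nm (tj (i + j) s - tj i s) <= B * (K * rpow (nth_prime (n1 + 2 * i)) (Re s)).
Proof.
move=> hs.
have h : nm (tj (i + j) s - tj i s) <= B * (K * \sum_(k < j) d s (i + k)).
  elim: j => [|j ih]; first by rewrite addn0 subrr nm0 big_ord0 !mulr0.
  rewrite addnS tjS big_ord_recr /= (mulrDr K) (mulrDr B).
  rewrite (_ : _ - _ = (tj (i + j) s - tj i s) + tj (i + j) s * (pairf s (i + j) - 1)); last by ring.
  rewrite (le_trans (nmD _ _))// lerD// nmM.
  by apply: ler_pM; rewrite ?nm_ge0 ?tj_bound ?pair_close.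
apply: le_trans h _; rewrite ler_pM2l// ler_wpM2l//.
exact: sum_d.
Qed.

Let small e : 0 < e -> exists i0, forall i, (i0 <= i)%N -> forall s, region s ->
  B * (K * rpow (nth_prime (n1 + 2 * i)) (Re s)) < e.
Proof.
move=> e0; have BK0 : 0 <= B * K by rewrite mulr_ge0// ltW.
have BK1 : 0 < B * K + 1 by lra.
have h12 : 0 < 1 / 2 :> R by lra.
have [i0 hi0] := @rpow_small R (1 / 2) (e / (B * K + 1)) h12 ltac:(by rewrite divr_gt0).
exists i0 => i ii s [hs _]; rewrite mulrA.
have h : rpow (nth_prime (n1 + 2 * i)) (Re s) < e / (B * K + 1).
  apply: le_lt_trans (rpow_antimono _ hs) _; apply: hi0.
  apply: leq_trans ii _; apply: leq_trans (nth_prime_ge _); lia.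
rewrite ltr_pdivlMr// in h; apply: le_lt_trans h.
by rewrite mulrC ler_wpM2l ?rpow_ge0// lerDl.
Qed.

(** A pair of factors with opposite signs differs from 1 by a multiple of
    |p^-s - q^-s| for consecutive primes p < q. For real parts x >= 1/2 this is at most a
    multiple of p^-x - q^-x, and these differences telescope, uniformly in the region. *)
Lemma tprod_lim_exists : exists Q : R[i] -> R[i],
  (forall s, region s -> (fun j => tprod eps (n1 + 2 * j) s) @ \oo --> Q s) /\
  (forall e, 0 < e -> exists i0, forall i, (i0 <= i)%N -> forall s, region s ->
     nm (tprod eps (n1 + 2 * i) s - Q s) <= e).
Proof.
pose Q s : R[i] := get [set z : R[i] | (fun j => tj j s) @ \oo --> z].
have cQ s : region s -> (fun j => tj j s) @ \oo --> Q s.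
  move=> hs; rewrite /Q; case: xgetP => [z _ /= //|] h; exfalso.
  have [|z hz] := @nm_cauchy_cvg R (fun j => tj j s); last exact: (h z).
  move=> e e0; have e20 : 0 < e / 2 by rewrite divr_gt0.
  have [i0 hi0] := small e20; exists i0 => n m nn nm'.
  have := hi0 i0 (leqnn _) s hs.
  have := tj_cauchy i0 (n - i0) hs; have := tj_cauchy i0 (m - i0) hs.
  rewrite !subnKC// => h1 h2 h3.
  have := nmB (tj n s - tj i0 s) (tj m s - tj i0 s).
  rewrite (_ : _ - _ - _ = tj n s - tj m s); last by ring.
  lra.
exists Q; split=> // e e0; have [i0 hi0] := small e0.
exists i0 => i ii s hs; rewrite nmBC.
have hc := cvgn_sub (cQ s hs) (cvgn_cst (tj i s)).
apply: (cvgn_nm_le hc (n0 := i)) => n ni /=.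
have := tj_cauchy i (n - i) hs; rewrite subnKC// => h.
by apply: le_trans h _; apply/ltW/hi0.
Qed.

Lemma tprod_lim_cdiff (Q : R[i] -> R[i]) s :
  (forall s, region s -> (fun j => tprod eps (n1 + 2 * j) s) @ \oo --> Q s) ->
  1 / 2 < Re s -> `|Im s| < 1 -> cdiff Q s.
Proof.
move=> cQ h1 h2; pose r := Num.min (Re s - 1 / 2) (1 - `|Im s|).
have r0 : 0 < r by rewrite lt_min !subr_gt0 h1.
have [ra rb] : r <= Re s - 1 / 2 /\ r <= 1 - `|Im s| by rewrite !ge_min !lexx orbT.
have reg w : nm (w - s) <= r -> region w.
  by move=> h; split; [have := Re_near h; lra|have := Im_near h; lra].
apply: (@cdiff_lim _ tj Q s r B) => //.
- by move=> j w /reg [hw _]; exact: cdiff_tprod.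
- by move=> j w /reg hw; exact: tj_bound.
by move=> w /reg hw; exact: cQ.
Qed.

End Limit.
End SignedProduct.

(** * Signs moving the product across 1 *)

Section RealSide.
Variable R : realType.
Implicit Types (x y e t r a b : R) (z w s : R[i]).

Definition rfactor r : R := (1 - r) / (1 + r).

Lemma rfactor_gt0 r : 0 <= r <= 3 / 4 -> 0 < rfactor r.
Proof. by move=> /andP[h1 h2]; rewrite divr_gt0//; lra. Qed.

Lemma rfactor_le1 r : 0 <= r <= 3 / 4 -> rfactor r <= 1.
Proof. by move=> /andP[h1 h2]; rewrite ler_pdivrMr ?mul1r; lra. Qed.

Lemma rfactor_anti r a : 0 <= r -> r <= a -> a <= 3 / 4 -> rfactor a <= rfactor r.
Proof.
move=> h1 h2 h3; rewrite /rfactor ler_pdivrMr; last by lra.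
by rewrite mulrAC ler_pdivlMr; [nra|lra].
Qed.

Lemma rfactor_anti_lt r a : 0 <= r -> r < a -> a <= 3 / 4 -> rfactor a < rfactor r.
Proof.
move=> h1 h2 h3; rewrite /rfactor ltr_pdivrMr; last by lra.
by rewrite mulrAC ltr_pdivlMr; [nra|lra].
Qed.

Lemma rfactorV_ge r : 0 <= r <= 3 / 4 -> 1 + r <= (rfactor r)^-1.
Proof.
move=> /andP[h1 h2]; rewrite /rfactor invf_div ler_pdivlMr; [nra|lra].
Qed.

Lemma rfactorV_le r : 0 <= r <= 3 / 4 -> (rfactor r)^-1 <= expR (8 * r).
Proof.
move=> /andP[h1 h2]; apply: le_trans (expR_ge1Dx _).
by rewrite /rfactor invf_div ler_pdivrMr; [nra|lra].
Qed.

Definition prpow x n : R := rpow (nth_prime n) x.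

Section Fixed.
Variable x : R.
Hypothesis hx : 1 / 2 <= x.

Lemma prpow_range n : 0 <= prpow x n <= 3 / 4.
Proof. by rewrite rpow_ge0 rpow_prime_le. Qed.

Lemma prpow_anti m n : (m <= n)%N -> prpow x n <= prpow x m.
Proof.
move=> mn; apply: rpow_le; rewrite ?nth_prime_gt0 ?nth_prime_mono//.
by apply: le_trans hx; rewrite divr_ge0.
Qed.

Lemma rfactor_prpow_mono m n : (m <= n)%N -> rfactor (prpow x m) <= rfactor (prpow x n).
Proof.
move=> mn; apply: rfactor_anti; [by have /andP[] := prpow_range n|exact: prpow_anti|].
by have /andP[] := prpow_range m.
Qed.

(** The pairs of factors with signs +1, -1 at consecutive primes, at a real point x. *)
Definition altprod m j : R :=
  \prod_(i < j) (rfactor (prpow x (m + 2 * i)) * (rfactor (prpow x (m + 2 * i).+1))^-1).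

Let bgt n : 0 < rfactor (prpow x n). Proof. exact/rfactor_gt0/prpow_range. Qed.

Lemma pair_le1 m : rfactor (prpow x m) * (rfactor (prpow x m.+1))^-1 <= 1.
Proof. by rewrite ler_pdivrMr// mul1r rfactor_prpow_mono. Qed.

Lemma altprod_ge0 m j : 0 <= altprod m j.
Proof. by apply: prodr_ge0 => i _; rewrite divr_ge0// ltW. Qed.

Lemma altprodS m j :
  altprod m j.+1 = altprod m j * (rfactor (prpow x (m + 2 * j)) * (rfactor (prpow x (m + 2 * j).+1))^-1).
Proof. by rewrite /altprod big_ord_recr. Qed.

Lemma altprod_le1 m j : altprod m j <= 1.
Proof.
elim: j => [|j ih]; first by rewrite /altprod big_ord0.
by rewrite altprodS mulr_ile1 ?altprod_ge0 ?pair_le1// divr_ge0// ltW.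
Qed.

Lemma altprod_first m j : (0 < j)%N -> altprod m j <= rfactor (prpow x m) * (rfactor (prpow x m.+1))^-1.
Proof.
case: j => // j _; elim: j => [|j ih].
  by rewrite /altprod big_ord_recl big_ord0 mulr1 /= muln0 addn0.
rewrite altprodS; apply: le_trans ih; rewrite ler_piMr ?altprod_ge0//.
exact: pair_le1.
Qed.

(** Regrouped as b_m (b_(m+2) / b_(m+1)) ..., all factors after the first are at least 1. *)
Lemma altprod_ge m j : rfactor (prpow x m) <= altprod m j.
Proof.
have h : rfactor (prpow x m) <= altprod m j * rfactor (prpow x (m + 2 * j)).
  elim: j => [|j ih]; first by rewrite /altprod big_ord0 mul1r muln0 addn0.
  apply: le_trans ih _; rewrite altprodS mulnS.
  rewrite -mulrA ler_wpM2l ?altprod_ge0// -mulrA ler_peMr ?(ltW (bgt _))//.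
  rewrite mulrC ler_pdivlMr// mul1r; apply: rfactor_prpow_mono.
  by rewrite addnCA add2n.
apply: le_trans h _; rewrite ler_piMr ?altprod_ge0//.
exact/rfactor_le1/prpow_range.
Qed.

(** The factors with sign -1 for the primes with index in [k, n). *)
Definition negprod k n : R := \prod_(k <= i < n) (rfactor (prpow x i))^-1.

(** Each factor is at least 1 + p^-x, so that the product exceeds the sum. *)
Lemma negprod_ge k n : 1 + \sum_(k <= i < n) prpow x i <= negprod k n.
Proof.
rewrite /negprod; have [nk|kn] := leqP n k; first by rewrite !big_geq// addr0.
rewrite -(subnK (ltnW kn)); elim: (n - k)%N => [|j ih].
  by rewrite !big_geq// addr0.
rewrite addSn !big_nat_recr ?leq_addl//=.
have h1 := rfactorV_ge (prpow_range (j + k)); have /andP[h2 _] := prpow_range (j + k).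
have h3 : 0 <= \sum_(k <= i < j + k) prpow x i.
  by apply: sumr_ge0 => i _; have /andP[] := prpow_range i.
move: ih h1 h2 h3.
set S := \sum_(_ <= _ < _) _; set P := \prod_(_ <= _ < _) _.
set b := (rfactor _)^-1; set p := prpow x _ => h0 h1 h2 h3.
apply: (@le_trans _ _ ((1 + S) * (1 + p))); first by nra.
by apply: ler_pM => //; lra.
Qed.

Lemma negprodS k n : (k <= n)%N -> negprod k n.+1 = negprod k n * (rfactor (prpow x n))^-1.
Proof. by move=> kn; rewrite /negprod big_nat_recr. Qed.

End Fixed.

(** At y > x every p^-y is at most p_k^-(y-x) p^-x: the block loses a power of its first prime. *)
Lemma negprod_le x y k n : 1 / 2 <= x -> x <= y ->
  negprod y k n <= expR (8 * rpow (nth_prime k) (y - x) * \sum_(k <= i < n) prpow x i).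
Proof.
move=> hx xy; have hy : 1 / 2 <= y by lra.
rewrite mulr_sumr expR_sum /negprod big_nat_cond [leRHS]big_nat_cond.
apply: ler_prod => i /andP[/andP[ki _] _].
have b0 := rfactor_gt0 (prpow_range hy i).
rewrite invr_ge0 (ltW b0)/=; apply: le_trans (rfactorV_le (prpow_range hy i)) _.
rewrite ler_expR -mulrA ler_wpM2l// /prpow.
have -> : rpow (nth_prime i) y = rpow (nth_prime i) (y - x) * rpow (nth_prime i) x.
  by rewrite -rpowD subrK.
rewrite ler_wpM2r ?rpow_ge0// rpow_le ?subr_ge0 ?nth_prime_gt0//.
exact: nth_prime_mono.
Qed.

(** Alternating signs, interrupted by a block of signs -1 for the indices in [k, n1). *)
Definition sign_pattern k n1 n : R :=
  if (n < k)%N then (-1) ^+ n else if (n < n1)%N then -1 else (-1) ^+ (n - n1).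

Lemma sign_pattern_sq k n1 n : sign_pattern k n1 n ^+ 2 = 1.
Proof.
by rewrite /sign_pattern; case: ifP => _; [|case: ifP => _]; rewrite ?sqrr_sign// sqrrN expr1n.
Qed.

Lemma sign_pattern_even k n1 i : (k <= n1)%N -> sign_pattern k n1 (n1 + 2 * i) = 1.
Proof.
move=> kn; rewrite /sign_pattern.
have -> : (n1 + 2 * i < k)%N = false by lia.
have -> : (n1 + 2 * i < n1)%N = false by lia.
by rewrite addKn exprM sqrrN !expr1n.
Qed.

Lemma sign_pattern_odd k n1 i : (k <= n1)%N -> sign_pattern k n1 (n1 + 2 * i).+1 = -1.
Proof.
move=> kn; rewrite /sign_pattern.
have -> : ((n1 + 2 * i).+1 < k)%N = false by lia.
have -> : ((n1 + 2 * i).+1 < n1)%N = false by lia.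
by rewrite -addnS addKn exprS exprM sqrrN !expr1n mulr1.
Qed.

Lemma efactor1_real r : efactor 1 r%:C = (rfactor r)%:C.
Proof.
by rewrite /efactor /rfactor rmorphM fmorphV rmorphB rmorphD rmorph1 !mul1r.
Qed.

Lemma efactorN1_real r : efactor (-1) r%:C = ((rfactor r)^-1)%:C.
Proof.
rewrite /efactor /rfactor invf_div rmorphM fmorphV rmorphB rmorphD rmorphN rmorph1.
by rewrite !mulN1r opprK.
Qed.

Lemma realM a b : (a * b)%:C = a%:C * b%:C :> R[i].
Proof. exact: rmorphM. Qed.

Lemma real_prod I (r : seq I) P (F : I -> R) :
  (\prod_(i <- r | P i) F i)%:C = \prod_(i <- r | P i) (F i)%:C :> R[i].
Proof. exact: rmorph_prod. Qed.

Lemma tprod_real k n1 j x : (2 * k <= n1)%N ->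
  tprod (sign_pattern (2 * k) n1) (n1 + 2 * j) x%:C =
  (altprod x 0 k * negprod x (2 * k) n1 * altprod x n1 j)%:C.
Proof.
move=> kn; set F := fun n => efactor (sign_pattern (2 * k) n1 n) (ipow (nth_prime n) x%:C).
rewrite /tprod (prod_pairs F) !realM; congr (_ * _).
  rewrite -(big_mkord xpredT F) (@big_cat_nat _ _ _ (2 * k))//= big_mkord.
  congr (_ * _).
    rewrite -[(2 * k)%N]add0n (prod_pairs F) big_ord0 mul1r real_prod.
    apply: eq_bigr => i _; rewrite /F realM -efactor1_real -efactorN1_real /prpow -!ipow_real.
    congr (efactor _ _ * efactor _ _).
      rewrite /sign_pattern add0n ltn_mul2l /= ltn_ord exprM sqrrN !expr1n//.
    rewrite /sign_pattern add0n; have -> : ((2 * i).+1 < 2 * k)%N.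
      by have := ltn_ord i; lia.
    by rewrite exprS exprM sqrrN !expr1n mulr1.
  rewrite /negprod real_prod big_nat_cond [RHS]big_nat_cond; apply: eq_bigr => i.
  rewrite andbT => /andP[h1 h2].
  by rewrite /F -efactorN1_real /prpow -ipow_real /sign_pattern ltnNge h1 h2.
rewrite real_prod; apply: eq_bigr => i _.
rewrite /F realM -efactor1_real -efactorN1_real /prpow -!ipow_real.
by rewrite sign_pattern_even// sign_pattern_odd.
Qed.

(** The block starts so far out that passing from x to y makes its product almost 1, and it
    is stopped as soon as its product at x exceeds what the two alternating parts can take
    away. Stopping at the first such place keeps the block bounded at x, hence near 1 at y,
    where the first pair of the alternating part stays a fixed amount below 1. *)
Lemma sign_change x y : 1 / 2 < x -> x < y -> y < 1 -> exists k n1 (b : R),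
  [/\ (2 * k <= n1)%N, b < 1 & forall j,
    altprod y 0 k * negprod y (2 * k) n1 * altprod y n1 j <= b /\
    2 <= altprod x 0 k * negprod x (2 * k) n1 * altprod x n1 j].
Proof.
move=> x0 xy y1.
have hx : 1 / 2 <= x by lra. have hy : 1 / 2 <= y by lra.
have bx n : 0 < rfactor (prpow x n) by exact/rfactor_gt0/prpow_range.
have by' n : 0 < rfactor (prpow y n) by exact/rfactor_gt0/prpow_range.
have [b0 b0E] : exists b0, b0 = rfactor (prpow x 0) by eexists.
have b00 : 0 < b0 by rewrite b0E.
have b01 : b0 <= 1 by rewrite b0E; exact/rfactor_le1/prpow_range.
have b02 : 0 < b0 ^+ 2 by rewrite exprn_gt0.
(* Each of the two alternating products is at least b0 at x, so a block of size H brings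
   the product to 2; U bounds the first block that reaches H. *)
have [H HE] : exists H, H = 2 / b0 ^+ 2 by eexists.
have [U UE] : exists U, U = H / b0 by eexists.
have H0 : 0 < H by rewrite HE divr_gt0.
have U0 : 0 < U by rewrite UE divr_gt0.
have H2 : 2 <= H by rewrite HE ler_pdivlMr//; rewrite ler_piMr// expr_le1// ltW.
have [c cE] : exists c, c = rfactor (prpow y 0) * (rfactor (prpow y 1))^-1 by eexists.
have c0 : 0 < c by rewrite cE divr_gt0.
have c1 : c < 1.
  rewrite cE ltr_pdivrMr// mul1r; apply: rfactor_anti_lt.
  - by have /andP[] := prpow_range hy 1.
  - rewrite /prpow /rpow ltr_expR ltrN2 ltr_pM2l; last by lra.
    by rewrite ltr_ln ?posrE ?ltr0n ?nth_prime_gt0// ltr_nat nth_prime_ltn.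
  - by have /andP[] := prpow_range hy 0.
(* A block of size exp(g) at y moves the value from c to at most (1 + c) / 2 < 1. *)
have [g gE] : exists g, g = ln ((1 + c) / (2 * c)) by eexists.
have g0 : 0 < g by rewrite gE ln_gt0// ltr_pdivlMr ?mulr_gt0//; lra.
have d0 : 0 < y - x by rewrite subr_gt0.
have [n0 hn0] := rpow_small d0 (divr_gt0 g0 (mulr_gt0 (ltr0Sn R 7) U0)).
have [k kE] : exists k, k = n0.+1 by eexists.
have hk : 8 * rpow (nth_prime (2 * k)) (y - x) * U <= g.
  have := hn0 (nth_prime (2 * k)).
  have h : (n0 <= nth_prime (2 * k))%N.
    apply: leq_trans (nth_prime_ge _).
    by rewrite kE mul2n -addnn addSnnS -!addnS leq_addr.
  move=> /(_ h); rewrite ltr_pdivlMr ?mulr_gt0// => /ltW.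
  by rewrite mulrCA mulrA.
(* The first end of the block at which its product reaches H. *)
have [n1 n1P minP] : exists2 n1, (2 * k <= n1)%N && (H <= negprod x (2 * k) n1) &
    forall n, (2 * k <= n)%N && (H <= negprod x (2 * k) n) -> (n1 <= n)%N.
  suff ex : exists n, (2 * k <= n)%N && (H <= negprod x (2 * k) n).
    by case: (ex_minnP ex) => n h1 h2; exists n.
  have [M hM] := prime_sum_diverges (H + (2 * k)%:R).
  have sle n : \sum_(i < n) (nth_prime i)%:R^-1 <= n%:R :> R.
    apply: (@le_trans _ _ (\sum_(i < n) 1)); last by rewrite sumr_const card_ord.
    by apply: ler_sum => i _; rewrite invf_le1 ?ler1n ?ltr0n nth_prime_gt0.
  have kM : (2 * k <= M)%N.
    rewrite leqNgt; apply/negP => Mk.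
    have := sle M; have : (M%:R : R) <= (2 * k)%:R by rewrite ler_nat ltnW.
    lra.
  exists M; rewrite kM/=; apply: le_trans (negprod_ge hx _ _).
  have h2 := sle (2 * k)%N.
  move: hM; rewrite -(big_mkord xpredT (fun i => (nth_prime i)%:R^-1)).
  rewrite (@big_cat_nat _ _ _ (2 * k))//= big_mkord.
  have : \sum_(2 * k <= i < M) (nth_prime i)%:R^-1 <= \sum_(2 * k <= i < M) prpow x i :> R.
    apply: ler_sum => i _; rewrite -rpow_x1 ?nth_prime_gt0//.
    by apply: rpow_antimono; lra.
  lra.
have /andP[kn1 hH] := n1P.
exists k, n1, ((1 + c) / 2); split => //; first by lra.
have hU : negprod x (2 * k) n1 <= U.
  case: n1 n1P minP kn1 hH => [|n] n1P minP kn1 hH.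
    by rewrite /negprod big_geq// (le_trans _ (_ : 1 <= U))// UE ler_pdivlMr//; lra.
  have [kn|nk] := leqP (2 * k) n; last first.
    by move: hH; rewrite /negprod big_geq//; lra.
  rewrite negprodS//; have bl : negprod x (2 * k) n < H.
    rewrite ltNge; apply/negP => h; have := minP n; rewrite kn h => /(_ isT).
    by rewrite ltnn.
  rewrite UE; apply: ler_pM.
  - by apply: prodr_ge0 => i _; rewrite invr_ge0 ltW.
  - by rewrite invr_ge0 ltW.
  - exact: ltW.
  - by rewrite b0E lef_pV2 ?posrE// rfactor_prpow_mono.
move=> j; split.
  have h1 : altprod y 0 k <= c by rewrite cE; apply: (@altprod_first _ hy 0%N); rewrite kE.
  have h2 : negprod y (2 * k) n1 <= (1 + c) / (2 * c).
    apply: le_trans (negprod_le _ _ hx (ltW xy)) _.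
    rewrite -[leRHS]lnK ?posrE ?divr_gt0 ?mulr_gt0//; last by lra.
    rewrite ler_expR -gE; apply: le_trans hk; rewrite ler_wpM2l//.
      by rewrite mulr_ge0// rpow_ge0.
    by have := negprod_ge hx (2 * k) n1; lra.
  have h3 := altprod_le1 hy n1 j; have h4 := altprod_ge0 hy n1 j.
  have h5 := altprod_ge0 hy 0 k.
  have h6 : 0 <= negprod y (2 * k) n1 by apply: prodr_ge0 => i _; rewrite invr_ge0 ltW.
  apply: (@le_trans _ _ (c * ((1 + c) / (2 * c)) * 1)); last first.
    by rewrite mulr1 le_eqVlt; apply/orP; left; apply/eqP; field; rewrite gt_eqF.
  by apply: ler_pM => //; [rewrite mulr_ge0|rewrite ler_pM].
have h1 := altprod_ge hx 0 k; rewrite -b0E in h1; have h3 := altprod_ge hx n1 j.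
have h4 : b0 <= altprod x n1 j by apply: le_trans h3; rewrite b0E; exact: rfactor_prpow_mono.
have -> : 2 = b0 * H * b0 by rewrite HE; field; rewrite gt_eqF.
apply: ler_pM; rewrite ?mulr_ge0 ?(ltW b00) ?(ltW H0)//.
by apply: ler_pM; rewrite ?(ltW b00) ?(ltW H0).
Qed.

End RealSide.

(** * A zero of the signed product *)

Section SignedZero.
Variable R : realType.
Implicit Types (x y e t r a b : R) (z w s c : R[i]).

Lemma circle_min F c r : 0 <= r -> (forall w, nm (w - c) = r -> ccont F w) ->
  (forall w, nm (w - c) = r -> F w != 0) ->
  exists2 m : R, 0 < m & forall w, nm (w - c) = r -> m <= nm (F w).
Proof.
move=> r0 cF F0; pose S := [set w | nm (w - c) = r].
have cn w : {for w, continuous (fun w => nm (w - c))}.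
  by apply: ccont_nm; apply: ccontB; [exact: ccont_id|exact: ccont_cst].
have cS : compact S.
  apply: (@subclosed_compact _ _ [set w | nm (w - c) <= r]).
  - have -> : S = (fun w => nm (w - c)) @^-1` [set r] by [].
    apply: closed_comp; last exact: closed_eq.
    by move=> w _; exact: cn.
  - exact: compact_cdisc.
  - by move=> w /= ->.
have [||c0] := compact_EVT_min (f := fun w => nm (F w)) _ cS.
- by exists (c + r%:C); rewrite /S/= addrAC subrr add0r nmr ger0_norm.
- by apply: continuous_in_subspaceT => w; rewrite inE => wS; apply/ccont_nm/cF.
rewrite inE => c0S h; exists (nm (F c0)); first by rewrite nm_gt0 F0.
by move=> w wS; apply: h; rewrite inE.
Qed.

Lemma real_ivt (Q : R[i] -> R[i]) x y v : x <= y ->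
  (forall t, x <= t <= y -> ccont Q t%:C) ->
  v <= Re (Q x%:C) -> Re (Q y%:C) <= v ->
  exists2 t, x <= t <= y & Re (Q t%:C) = v.
Proof.
move=> xy cQ h1 h2.
have [||t] := @IVT R (fun t => Re (Q t%:C)) x y v xy.
- apply: continuous_in_subspaceT => t; rewrite inE /= in_itv/= => /cQ ct.
  apply/cvgrPdist_lt => e e0; have [d d0 hd] := ct _ e0.
  apply/nbhs_ballP; exists d => // t' /= tt'.
  rewrite -normrN opprB; apply: le_lt_trans (hd t'%:C _).
    by rewrite -raddfB; exact: Re_le_nm.
  by rewrite -rmorphB nmr distrC.
- by rewrite ge_min le_max h1 h2 orbT.
by rewrite in_itv/= => h <-; exists t.
Qed.

(** The limit product Q is at least 2 at sigma - delta / 2 and less than 1 at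
    sigma + delta / 2; being real on the axis it takes the value 1 at some c, and 1 - Q is
    bounded below on a small circle about c. Uniform approximation carries both facts to
    the finite products, with one fixed m for all large M. *)
Lemma signed_product_zero (sigma delta : R) : 1 / 2 < sigma -> sigma < 1 ->
  0 < delta -> delta < (sigma - 1 / 2) / 3 -> delta < 1 - sigma ->
  exists (eps : nat -> R) (c r m B : R),
  [/\ forall n, eps n ^+ 2 = 1, `|c - sigma| <= delta / 2, 0 < r /\ 2 * r <= delta / 4,
      0 < m /\ 0 <= B & forall M0, exists2 M, (M0 <= M)%N &
        [/\ nm (1 - tprod eps M c%:C) <= m,
            forall w, nm (w - c%:C) = r -> 3 * m <= nm (1 - tprod eps M w) &
            forall w, nm (w - c%:C) <= r -> nm (tprod eps M w) <= B]].
Proof.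
move=> hs1 hs2 d0 d1 d2.
pose x := sigma - delta / 2; pose y := sigma + delta / 2.
have hx : 1 / 2 < x by rewrite /x; lra.
have hy : y < 1 by rewrite /y; lra.
have xy : x < y by rewrite /x /y; lra.
have [k [n1 [b [kn b1 hb]]]] := sign_change hx xy hy.
pose eps := @sign_pattern R (2 * k) n1.
have e2 n : eps n ^+ 2 = 1 by exact: sign_pattern_sq.
have ee i : eps (n1 + 2 * i)%N = 1 by exact: sign_pattern_even.
have eo i : eps (n1 + 2 * i).+1 = -1 by exact: sign_pattern_odd.
have [Q [cQ uQ]] := tprod_lim_exists e2 ee eo.
have dQ s : 1 / 2 < Re s -> `|Im s| < 1 -> cdiff Q s by exact: tprod_lim_cdiff cQ.
have reg t : 1 / 2 < t -> 1 / 2 <= Re t%:C /\ `|Im t%:C| <= 1.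
  by move=> h; rewrite /= normr0; split; [exact: ltW|].
have Qr t : 1 / 2 < t -> forall e, 0 < e -> exists j,
    nm ((altprod t 0 k * negprod t (2 * k) n1 * altprod t n1 j)%:C - Q t%:C) <= e.
  move=> h e e0; have [i0 hi0] := uQ _ e0; exists i0.
  by have := hi0 _ (leqnn _) _ (reg _ h); rewrite tprod_real.
have Qim t : 1 / 2 < t -> Im (Q t%:C) = 0.
  move=> h; apply/eqP; rewrite -normr_eq0 eq_le normr_ge0 andbT.
  apply/ler_addgt0Pr => e e0; rewrite add0r; have [j hj] := Qr _ h _ e0.
  apply: le_trans hj; apply: le_trans (Im_le_nm _); by rewrite raddfB/= sub0r normrN.
have Q2 : 2 <= Re (Q x%:C).
  apply/ler_addgt0Pr => e e0; have [j hj] := Qr _ hx _ e0.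
  have [_ hj2] := hb j; have := le_trans (Re_le_nm _) hj.
  by rewrite raddfB/= ler_distl => /andP[h1 h2]; lra.
have hy' : 1 / 2 < y by lra.
have Qb : Re (Q y%:C) <= b.
  apply/ler_addgt0Pr => e e0; have [j hj] := Qr _ hy' _ e0.
  have [hj2 _] := hb j; have := le_trans (Re_le_nm _) hj.
  by rewrite raddfB/= ler_distl => /andP[h1 h2]; lra.
have [|||c /andP[xc cy] Qc] := @real_ivt Q x y 1 (ltW xy).
- move=> t /andP[h1 h2]; apply: cdiff_cont; apply: dQ => /=; [lra|by rewrite normr0].
- lra.
- lra.
have hc : 1 / 2 < c by lra.
have Qc1 : Q c%:C = 1.
  by apply/eqP; rewrite eq_complex /= Qc Qim// !eqxx.
have near w : nm (w - c%:C) <= 2 * delta -> 1 / 2 < Re w /\ `|Im w| < 1.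
  move=> h; have := Re_near h; have := Im_near h.
  by rewrite /= normr0 add0r => h1 h2; rewrite /x in xc; split; lra.
have dF w : nm (w - c%:C) <= 2 * delta -> cdiff (fun s => 1 - Q s) w.
  by move=> /near[h1 h2]; apply: cdiffB; [exact: cdiff_cst|exact: dQ].
(* The value at y, which differs from 1, shows that 1 - Q is not identically zero. *)
have [||d dd hd] := isolated_zeros _ dF; first by rewrite mulr_gt0.
  exists y%:C; first split.
  - by rewrite -rmorphB nmr ger0_norm ?subr_ge0//; rewrite /y /x in xc *; lra.
  - apply/eqP => h; move: Qb; rewrite h Qc1 /=; lra.
  - by rewrite subr_eq0; apply/eqP => h; move: Qb; rewrite -h /=; lra.
pose r := Num.min (d / 2) (delta / 8).
have r0 : 0 < r by rewrite lt_min !divr_gt0.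
have [ra rb] : r <= d / 2 /\ r <= delta / 8 by rewrite !ge_min !lexx orbT.
have [||m0 m00 hm] := @circle_min (fun s => 1 - Q s) c%:C r (ltW r0).
- by move=> w wr; apply: cdiff_cont; apply: dF; lra.
- move=> w wr; apply: hd; last by lra.
  by apply/eqP => h; move: wr; rewrite h subrr nm0; lra.
have [B B0 hB] := bounded_on_disc (mulr_ge0 (ler0n _ 2) (ltW d0)) dF.
exists eps, c, r, (m0 / 4), (1 + B + m0 / 4); split => //.
- by rewrite ler_distl; rewrite /x /y in xc cy; lra.
- by split => //; lra.
- by split; rewrite ?divr_gt0//; lra.
move=> M0; have [i0 hi0] := uQ (m0 / 4) ltac:(by rewrite divr_gt0).
exists (n1 + 2 * maxn i0 M0)%N.
  by apply: leq_trans (leq_maxr i0 M0) _; rewrite mul2n -addnn addnCA leq_addr.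
have hi := hi0 _ (leq_maxl i0 M0).
split; first by rewrite -Qc1 nmBC; apply: hi; exact: reg.
  move=> w wr; have /near [h1 h2] : nm (w - c%:C) <= 2 * delta by lra.
  have := hi w (conj (ltW h1) (ltW h2)); have := hm _ wr.
  set q := tprod _ _ _ => h3 h4.
  have -> : 1 - q = (1 - Q w) - (q - Q w) by ring.
  have := nm_lB (1 - Q w) (q - Q w); lra.
move=> w wr; have wr' : nm (w - c%:C) <= 2 * delta by lra.
have /near [h1 h2] := wr'.
have := hi w (conj (ltW h1) (ltW h2)); have := hB _ wr'.
set q := tprod _ _ _ => h3 h4.
have -> : q = 1 - (1 - Q w) + (q - Q w) by ring.
have := nmD (1 - (1 - Q w)) (q - Q w); have := nmB 1 (1 - Q w).
by rewrite nm1; lra.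
Qed.

End SignedZero.

(** * From the signed product to vertical shifts *)

Section EulerComparison.
Variable R : realType.
Implicit Types (x y e t r a b : R) (z w s c : R[i]).

(** For Re s > 1 truncation does not matter in the limit. *)
Lemma cvg_rough_sum ps s : all prime ps -> uniq ps -> 1 < Re s ->
  (fun N => rough_sum ps N s) @ \oo --> zeta s * eprod ps s.
Proof.
move=> + + s1; elim: ps => [_ _|p ps ih /=/andP[pp aps] /andP[pps ups]].
  rewrite /eprod big_nil mulr1.
  by apply: (cvgn_ext _ (cvg_zeta s1)) => N; rewrite rough_sum_nil.
have {}ih := ih aps ups.
have hd : (fun N => rough_sum ps (N %/ p) s) @ \oo --> zeta s * eprod ps s.
  apply/cvgn_nmP => e e0; have [n0 hn] := (cvgn_nmP _ _).1 ih e e0.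
  exists (n0 * p)%N => n nn0; apply: hn.
  by rewrite leq_divRL ?prime_gt0.
have h := cvgn_sub ih (cvgn_mul (cvgn_cst (ipow p s)) hd).
have -> : zeta s * eprod (p :: ps) s =
    zeta s * eprod ps s - ipow p s * (zeta s * eprod ps s).
  by rewrite /eprod big_cons; ring.
by apply: cvgn_ext h => N; rewrite rough_sum_cons.
Qed.

(** The left side is a sum over integers > M free of the primes ps. *)
Lemma euler_tail ps M x1 s : all prime ps -> uniq ps -> (0 < M)%N ->
  (forall n, (1 < n)%N -> rough ps n -> (M < n)%N) ->
  1 / 2 < x1 -> x1 <= Re s ->
  nm (zeta (2 * s) * eprod ps (2 * s) - 1) <= rpow M (2 * x1 - 1) / (2 * x1 - 1).
Proof.
move=> aps ups M0 hM x1h s1.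
have s2 : 1 < Re (2 * s) by rewrite Re_mul2; lra.
have h := cvgn_sub (cvg_rough_sum aps ups s2) (cvgn_cst 1).
apply: (@cvgn_nm_le _ _ _ _ 1%N h) => N N0.
rewrite rough_sum_sub1//; apply: le_trans (nm_sum _ _ _) _.
have -> : \sum_(k <- [seq k <- index_iota 2 N.+1 | rough ps k]) nm (ipow k (2 * s)) =
    \sum_(k <- [seq k <- index_iota 2 N.+1 | rough ps k]) rpow k (2 * Re s).
  by apply: eq_bigr => k _; rewrite nm_ipow Re_mul2.
exact: rough_rpow_tail.
Qed.

Lemma prod_close M (A B : nat -> R[i]) b e : 1 <= b -> 0 <= e ->
  (forall n, (n < M)%N -> [/\ nm (A n) <= b, nm (B n) <= b & nm (A n - B n) <= e]) ->
  nm (\prod_(n < M) A n - \prod_(n < M) B n) <= M%:R * b ^+ M * e.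
Proof.
move=> b1 e0; have b0 : 0 <= b by lra.
elim: M => [_|M ih h]; first by rewrite !big_ord0 subrr nm0 !mul0r.
rewrite !big_ord_recr /=; have {}ih := ih (fun n nM => h n (ltnW nM)).
have [hA hB hAB] := h M (ltnSn M).
move: ih; set P := \prod_(n < M) A n; set Q := \prod_(n < M) B n => ih.
have hP : nm P <= b ^+ M.
  rewrite /P nm_prod (_ : b ^+ M = \prod_(i < M) b); last by rewrite prodr_const card_ord.
  apply: ler_prod => i _.
  by rewrite nm_ge0; have [] := h i (ltnW (ltn_ord i)).
have -> : P * A M - Q * B M = P * (A M - B M) + (P - Q) * B M by ring.
apply: le_trans (nmD _ _) _; rewrite !nmM.
have h1 : nm P * nm (A M - B M) <= b ^+ M * e by apply: ler_pM; rewrite ?nm_ge0.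
have h2 : nm (P - Q) * nm (B M) <= M%:R * b ^+ M * e * b by apply: ler_pM; rewrite ?nm_ge0.
have h3 : b ^+ M * e <= b ^+ M.+1 * e by rewrite ler_wpM2r// exprS ler_peMl// exprn_ge0.
apply: le_trans (lerD h1 h2) _; rewrite -natr1 !mulrDl mul1r addrC.
by rewrite lerD// exprS le_eqVlt; apply/orP; left; apply/eqP; ring.
Qed.

Lemma efactor_lipschitz e z w : e ^+ 2 = 1 -> nm z <= 3 / 4 -> nm w <= 3 / 4 ->
  nm (efactor e z - efactor e w) <= 32 * nm (z - w).
Proof.
move=> e2 hz hw; have dz := efactor_den e2 hz; have dw := efactor_den e2 hw.
have z0 : 1 + e%:C * z != 0 by rewrite -nm_gt0; lra.
have w0 : 1 + e%:C * w != 0 by rewrite -nm_gt0; lra.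
have -> : efactor e z - efactor e w =
    (2 * e%:C) * (w - z) * ((1 + e%:C * z)^-1 * (1 + e%:C * w)^-1).
  by rewrite /efactor; field; rewrite z0 w0.
have he : nm e%:C = 1 by rewrite nmr sign_norm1.
rewrite (nmM _ (_ * _)) (nmM _ (w - z)) (nmM 2) he (nm_nat R 2) (nmM (_)^-1) !nmV mulr1.
have inv4 (u : R) : 1 / 4 <= u -> u^-1 <= 4.
  move=> h; have -> : 4 = (1 / 4)^-1 :> R by rewrite div1r invrK.
  by rewrite lef_pV2 ?posrE//; lra.
have h : (nm (1 + e%:C * z))^-1 * (nm (1 + e%:C * w))^-1 <= 4 * 4.
  by apply: ler_pM; rewrite ?invr_ge0 ?nm_ge0 ?inv4.
rewrite (nmBC z w); have h0 := nm_ge0 (w - z).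
apply: (@le_trans _ _ (2 * nm (w - z) * (4 * 4))); last by lra.
by apply: ler_wpM2l h; rewrite mulr_ge0.
Qed.

(** The sign of a prime, looked up by its position among the first M primes; any other p
    gets the sign of index M, so that the value is always a sign. *)
Definition prime_sign (eps : nat -> R) M p := eps (index p (first_primes M)).

Lemma prime_signE eps M n : (n < M)%N -> prime_sign eps M (nth_prime n) = eps n.
Proof.
move=> nM; rewrite /prime_sign index_map; last exact: nth_prime_inj.
congr eps; have := @index_uniq _ 0%N n (iota 0 M).
by rewrite size_iota nth_iota// => ->//; exact: iota_uniq.
Qed.

Lemma first_primes_prod M (F : nat -> R[i]) :
  \prod_(p <- first_primes M) F p = \prod_(n < M) F (nth_prime n).
Proof. by rewrite big_map -(big_mkord xpredT (fun n => F (nth_prime n))) /index_iota subn0. Qed.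

Lemma tprod_shift eps M s t e : (forall n, eps n ^+ 2 = 1) -> 1 / 2 <= Re s -> 0 <= e ->
  (forall n, (n < M)%N -> nm (phase (prime_sign eps M) (nth_prime n) t - 1) <= e) ->
  nm (tprod (fun=> 1) M (vshift s t) - tprod eps M s) <= M%:R * 8 ^+ M * (32 * e).
Proof.
move=> e2 hs e0 hz; rewrite /tprod.
pose A n := efactor 1 (ipow (nth_prime n) (vshift s t)).
pose B n := efactor (eps n) (ipow (nth_prime n) s).
have n1 : (1 : R) ^+ 2 = 1 by rewrite expr1n.
have np n : nm (ipow (nth_prime n) s) <= 3 / 4 by rewrite nm_ipow rpow_prime_le.
apply: (@prod_close M A B) => [||n nM]; [lra|by rewrite mulr_ge0|].
have ne : nm (eps n)%:C = 1 by rewrite nmr sign_norm1.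
have hB : B n = efactor 1 ((eps n)%:C * ipow (nth_prime n) s).
  by rewrite /B /efactor !mul1r.
have hA : ipow (nth_prime n) (vshift s t) =
    (eps n)%:C * ipow (nth_prime n) s * phase (prime_sign eps M) (nth_prime n) t.
  rewrite /phase prime_signE// ipow_vshift.
  have : (eps n)%:C * (eps n)%:C = 1 :> R[i] by rewrite -rmorphM -expr2 e2.
  move: (ipow _ _) (cis _) => u v h.
  by rewrite -[LHS]mul1r -h; ring.
have n2 : nm (ipow (nth_prime n) (vshift s t)) <= 3 / 4 by rewrite nm_ipow Re_vshift rpow_prime_le.
have n3 : nm ((eps n)%:C * ipow (nth_prime n) s) <= 3 / 4 by rewrite nmM ne mul1r.
split; [exact: efactor_le|exact: efactor_le|].
rewrite hB /A; apply: le_trans (efactor_lipschitz n1 n2 n3) _.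
rewrite ler_pM2l// hA -[X in _ - X]mulr1 -mulrBr nmM.
apply: le_trans (_ : 1 * e <= _); last by rewrite mul1r.
by apply: ler_pM; rewrite ?nm_ge0 ?hz//; lra.
Qed.

(** From 1 - p^-2s = (1 - p^-s) (1 + p^-s). *)
Lemma eprod_twice M s : 1 / 2 <= Re s ->
  eprod (first_primes M) s ^+ 2 = eprod (first_primes M) (2 * s) * tprod (fun=> 1) M s.
Proof.
move=> hs; rewrite /eprod /tprod !first_primes_prod expr2 -!big_split /=.
apply: eq_bigr => n _; rewrite ipow2 /efactor mul1r.
have h : nm (ipow (nth_prime n) s) <= 3 / 4 by rewrite nm_ipow rpow_prime_le.
have : 1 + ipow (nth_prime n) s != 0.
  by rewrite -nm_gt0; have := nm_lB 1 (- ipow (nth_prime n) s); rewrite nm1 nmN opprK; lra.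
by move: (ipow _ _) => u u0; field.
Qed.

Lemma eprod_neq0 M s : 1 / 2 <= Re s -> eprod (first_primes M) s != 0.
Proof.
move=> hs; rewrite /eprod first_primes_prod; apply/prodf_neq0 => n _.
have h : nm (ipow (nth_prime n) s) <= 3 / 4 by rewrite nm_ipow rpow_prime_le.
by rewrite -nm_gt0; have := nm_lB 1 (ipow (nth_prime n) s); rewrite nm1; lra.
Qed.

Lemma cdiff_vshift t s : cdiff (fun w => vshift w t) s.
Proof. by apply: cdiffD; [exact: cdiff_id|exact: cdiff_cst]. Qed.

Lemma cdiff_eprod ps s : cdiff (eprod ps) s.
Proof.
by apply: cdiff_prod => p _; apply: cdiffB; [exact: cdiff_cst|exact: cdiff_ipow].
Qed.

Lemma nm_kappa_ge s x2 : Re s <= x2 -> 2 * rpow 2 x2 - 1 <= nm (kappa s).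
Proof.
move=> h; rewrite /kappa; have := nm_lB (2 * ipow 2 s) 1.
rewrite nmBC nm1 (nmM 2) (nm_nat R 2) nm_ipow.
by have := rpow_antimono 2 h; lra.
Qed.

Variable f : R[i] -> R[i].
Hypothesis f_zeta2 : is_zeta2_diag f.

(** After multiplication by the square of the mollifier, zeta^2 becomes the square of a
    number close to 1, and zeta(2s) a number close to 1 times the finite part of the Euler
    product of zeta(2s) / zeta(s)^2. *)
Lemma mollified_identity M z : 1 / 2 < Re z < 1 ->
  eprod (first_primes M) z ^+ 2 * (2 * f z) =
  (1 + mollified_err (first_primes M) z / kappa z) ^+ 2
  - zeta (2 * z) * eprod (first_primes M) (2 * z) * tprod (fun=> 1) M z.
Proof.
move=> z12; have /andP[z1 z2] := z12; have k0 := kappa_neq0 z2.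
have [_ h] := zeta2_diag_strip f_zeta2 z12.
rewrite -mulrA -eprod_twice ?(ltW z1)//.
have -> : 2 * f z = zeta2_numer z / kappa z ^+ 2.
  by rewrite -h; field.
by rewrite /zeta2_numer /mollified_err; field.
Qed.

(** The three error terms come from the mollified error, from the tail of the Euler product
    of zeta(2s), and from the deviation of the phases. *)
Lemma mollified_close M s t (m B x1 x2 eY eC : R) : 1 / 2 < x1 -> x2 < 1 -> x1 <= Re s <= x2 ->
  (0 < M)%N -> 0 < m -> 0 <= eY -> 0 <= eC -> 0 <= B ->
  let k0 := 2 * rpow 2 x2 - 1 in
  0 < k0 -> 2 * (eY / k0) + (eY / k0) ^+ 2 <= m / 4 ->
  rpow M (2 * x1 - 1) / (2 * x1 - 1) * (B + 1) <= m / 4 ->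
  M%:R * 8 ^+ M * (32 * eC) <= m / 4 -> M%:R * 8 ^+ M * (32 * eC) <= 1 ->
  forall eps, (forall n, eps n ^+ 2 = 1) -> nm (tprod eps M s) <= B ->
  (forall n, (n < M)%N -> nm (phase (prime_sign eps M) (nth_prime n) t - 1) <= eC) ->
  nm (mollified_err (first_primes M) (vshift s t)) <= eY ->
  nm (eprod (first_primes M) (vshift s t) ^+ 2 * (2 * f (vshift s t)) - (1 - tprod eps M s)) < m.
Proof.
move=> hx1 hx2 /andP[s1 s2] M0 m0 eY0 eC0 B0 k0 kpos hY hM hC hC1 eps e2 hB hz hE.
have hs : 1 / 2 < Re s by lra.
have hz12 : 1 / 2 < Re (vshift s t) < 1 by rewrite Re_vshift; apply/andP; split; lra.
rewrite mollified_identity//.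
have hP := tprod_shift e2 (ltW hs) eC0 hz.
have := @euler_tail (first_primes M) M x1 (vshift s t) (first_primes_prime M)
  (first_primes_uniq M) M0 (@rough_first_primes M) hx1.
rewrite Re_vshift => /(_ s1) hT.
have hK : k0 <= nm (kappa (vshift s t)) by apply: nm_kappa_ge; rewrite Re_vshift.
have hU : nm (mollified_err (first_primes M) (vshift s t) / kappa (vshift s t)) <= eY / k0.
  rewrite nmM nmV; apply: ler_pM; rewrite ?nm_ge0 ?invr_ge0 ?nm_ge0//.
  by rewrite lef_pV2 ?posrE//; lra.
move: hU hT hP; set U := mollified_err _ _ / _; set T := _ * eprod _ _.
set P := tprod (fun=> 1) _ _; set Q := tprod eps M s => hU hT hP.
have -> : (1 + U) ^+ 2 - T * P - (1 - Q) = (2 * U + U ^+ 2) - ((T - 1) * P + (P - Q)) by ring.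
have h1 : nm (2 * U + U ^+ 2) <= m / 4.
  apply: le_trans (nmD _ _) _; rewrite (nmM 2) (nm_nat R 2) (nmX U 2); apply: le_trans hY.
  by apply: lerD; rewrite ?ler_pM2l// lerXn2r ?nnegrE ?nm_ge0 ?divr_ge0 ?(ltW kpos).
have h2 : nm P <= B + 1.
  have -> : P = Q + (P - Q) by ring.
  by apply: le_trans (nmD _ _) _; lra.
have h3 : nm ((T - 1) * P) <= m / 4.
  by rewrite nmM; apply: le_trans hM; apply: ler_pM; rewrite ?nm_ge0.
have := nmB (2 * U + U ^+ 2) ((T - 1) * P + (P - Q)).
have := nmD ((T - 1) * P) (P - Q); lra.
Qed.

(** Twice the function E^2 zeta_2 along the shift is within m of the signed model on the disc,
    which is at most m at c and at least 3m on the circle. *)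
Lemma zero_at_good_shift M t (c r m B x1 x2 eY eC : R) : 1 / 2 < x1 -> x2 < 1 ->
  0 < r -> x1 <= c - r -> c + r <= x2 ->
  (0 < M)%N -> 0 < m -> 0 <= eY -> 0 <= eC -> 0 <= B ->
  let k0 := 2 * rpow 2 x2 - 1 in
  0 < k0 -> 2 * (eY / k0) + (eY / k0) ^+ 2 <= m / 4 ->
  rpow M (2 * x1 - 1) / (2 * x1 - 1) * (B + 1) <= m / 4 ->
  M%:R * 8 ^+ M * (32 * eC) <= m / 4 -> M%:R * 8 ^+ M * (32 * eC) <= 1 ->
  forall eps, (forall n, eps n ^+ 2 = 1) ->
  nm (1 - tprod eps M c%:C) <= m ->
  (forall w, nm (w - c%:C) = r -> 3 * m <= nm (1 - tprod eps M w)) ->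
  (forall w, nm (w - c%:C) <= r -> nm (tprod eps M w) <= B) ->
  (forall n, (n < M)%N -> nm (phase (prime_sign eps M) (nth_prime n) t - 1) <= eC) ->
  (forall w, nm (w - c%:C) <= r -> nm (mollified_err (first_primes M) (vshift w t)) <= eY) ->
  exists2 w, nm (w - c%:C) < r & holomorphic_at f (vshift w t) /\ f (vshift w t) = 0.
Proof.
move=> hx1 hx2 r0 cr1 cr2 M0 m0 eY0 eC0 B0 k0 kpos hY hM hC hC1 eps e2 hc hw hB hz hE.
have reg w : nm (w - c%:C) <= r -> x1 <= Re w <= x2.
  by move=> h; have := Re_near h; have := Re_near_le h; rewrite /= => *; apply/andP; split; lra.
have reg' w : nm (w - c%:C) <= r -> 1 / 2 < Re (vshift w t) < 1.
  by move=> /reg /andP[*]; rewrite Re_vshift; apply/andP; split; lra.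
pose G w := eprod (first_primes M) (vshift w t) ^+ 2 * (2 * f (vshift w t)).
have close w : nm (w - c%:C) <= r -> nm (G w - (1 - tprod eps M w)) < m.
  by move=> h; apply: (mollified_close hx1 hx2 (reg w h) M0 m0 eY0 eC0 B0 kpos hY hM hC hC1 e2
    (hB w h) hz (hE w h)).
have hol w : nm (w - c%:C) <= r -> holomorphic_at f (vshift w t).
  by move=> h; have [] := zeta2_diag_strip f_zeta2 (reg' w h).
have [||| w wr Gw] := @exists_zero R G c%:C r (2 * m) r0.
- move=> w h; apply: cdiffM.
    apply: cdiffX; apply: (@cdiff_comp _ (eprod (first_primes M)) (fun w => vshift w t)).
      exact: cdiff_eprod.
    exact: cdiff_vshift.
  apply: cdiffM; first exact: cdiff_cst.
  apply: (@cdiff_comp _ f (fun w => vshift w t)); last exact: cdiff_vshift.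
  have /holomorphic_cdiff[d d0 hd] := hol w h.
  by apply: hd; rewrite subrr nm0.
- move=> w h; have := close w ltac:(by rewrite h); have := hw w h.
  have := nm_lB (1 - tprod eps M w) (- (G w - (1 - tprod eps M w))).
  by rewrite nmN opprK (addrC _ (G w - _)) subrK; lra.
- have := close c%:C ltac:(by rewrite subrr nm0 ltW).
  have := nmD (G c%:C - (1 - tprod eps M c%:C)) (1 - tprod eps M c%:C).
  by rewrite subrK; lra.
exists w => //; split; first exact/hol/ltW.
have /andP[h1 h2] := reg' w (ltW wr).
move: Gw; rewrite /G => /eqP; rewrite mulf_eq0 expf_eq0 /= (negbTE (eprod_neq0 M (ltW h1))) /=.
by rewrite mulf_eq0 pnatr_eq0 /= => /eqP.
Qed.

End EulerComparison.

(** * The proportion of good shifts *)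

Section GoodShifts.
Variable R : realType.
Implicit Types (x y e t r : R) (z w s : R[i]).

Lemma avg_sum (I : Type) (l : seq I) N (phi : I -> R -> R) :
  avg N (fun t => \sum_(i <- l) phi i t) = \sum_(i <- l) avg N (phi i).
Proof.
elim: l => [|i l ih].
  rewrite big_nil /avg big1 ?mulr0// => j _; rewrite big1// => k _.
  by rewrite big_nil.
rewrite big_cons -ih -avgD; congr (avg N); apply/funext => t.
by rewrite big_cons.
Qed.

Lemma avg_rmean N n (g : R -> R[i] -> R) z r :
  avg N (fun t => rmean n (g t) z r) = rmean n (fun w => avg N (g ^~ w)) z r.
Proof. by rewrite /rmean avgZ avg_sum. Qed.

Lemma eventually_all (l : seq nat) (P : nat -> nat -> Prop) :
  (forall p, p \in l -> exists N0, forall N, (N0 <= N)%N -> P p N) ->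
  exists N0, forall N, (N0 <= N)%N -> forall p, p \in l -> P p N.
Proof.
elim: l => [_|p l ih h]; first by exists 0%N.
have [N1 h1] := ih (fun q ql => h q (mem_behead (s := p :: l) ql)).
have [N2 h2] := h p (mem_head _ _).
exists (maxn N1 N2) => N; rewrite geq_max => /andP[n1 n2] q.
by rewrite inE => /orP[/eqP->|]; [exact: h2|exact: h1].
Qed.

(** The shifts t for which the comparison with the signed product applies on the whole disc. *)
Definition good_shift (chi : nat -> R) ps (c r eC eY : R) t :=
  (forall p, p \in ps -> nm (phase chi p t - 1) <= eC) /\
  (forall w, nm (w - c%:C) <= r -> nm (mollified_err ps (vshift w t)) <= eY).

Lemma cdiff_mollified_err ps t s : 0 < Re s -> cdiff (fun w => mollified_err ps (vshift w t)) s.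
Proof.
move=> s0; apply: (@cdiff_comp _ (mollified_err ps) (fun w => vshift w t)); last exact: cdiff_vshift.
apply: cdiffB; last exact: cdiff_kappa.
apply: cdiffM; last exact: cdiff_eprod.
by apply: cdiff_eta; rewrite Re_vshift.
Qed.

(** Each bad t is charged: to a phase at distance > eC from 1, whose second weighted
    moment is at most 8 / J, or to a point of the disc where the mollified error exceeds eY. In the latter
    case the mean of its square over the circle of radius 2r is at least eY^2 / 16
    ([cauchy_mean_bound]), and this average can be interchanged with the average over t. *)
Lemma good_shift_mean (chi : nat -> R) J ps M (c r x1 eC eY : R) :
  (forall p, chi p ^+ 2 = 1) -> (0 < J)%N -> all prime ps -> uniq ps -> (0 < M)%N ->
  (forall n, (1 < n)%N -> rough ps n -> (M < n)%N) ->
  1 / 2 < x1 -> 0 < r -> 2 * r <= 1 -> x1 <= c - 2 * r -> c + 2 * r <= 1 ->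
  0 < eC -> 0 < eY ->
  (size ps)%:R * (8 / J%:R / eC ^+ 2) <= 1 / 8 ->
  50 * (rpow M (2 * x1 - 1) / (2 * x1 - 1)) <= eY ^+ 2 / 256 ->
  exists N0, forall N, (N0 <= N)%N -> 1 / 4 <=
    avg N (fun t => if `[< good_shift chi ps c r eC eY t >] then fejer_wt chi J ps t else 0).
Proof.
move=> chi_sq J0 aps ups M0 hM x1h r0 r1 cr1 cr2 eC0 eY0 hC hY.
have eY2 : 0 < eY ^+ 2 by rewrite exprn_gt0.
have eC2 : 0 < eC ^+ 2 by rewrite exprn_gt0.
have [N1 hN1] := fejer_mean chi_sq J0 aps ups.
have [N2 hN2] := eventually_all (fun p pps => fejer_mean_close chi_sq J0 aps ups pps).
have [N3 hN3] := mollified_mean_square chi_sq J0 x1h aps ups M0 hM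
  (divr_gt0 eY2 (ltr0Sn R 255)).
exists (maxn (maxn N1 N2) N3) => N; rewrite !geq_max => /andP[/andP[n1 n2] n3].
have /andP[h1 _] := hN1 _ n1; have h2 := hN2 _ n2.
have r20 : 0 < 2 * r by rewrite mulr_gt0.
have reg w : nm (w - c%:C) <= 2 * r -> x1 <= Re w <= 1 /\ `|Im w| <= 1.
  move=> h; have := Re_near h; have := Re_near_le h; have := Im_near h => /=.
  rewrite normr0 add0r => k1 k2 k3; clear -k1 k2 k3 cr1 cr2 r1.
  by split; [apply/andP; split|]; lra.
pose g t w := fejer_wt chi J ps t * nm (mollified_err ps (vshift w t)) ^+ 2.
have h3 n : avg N (fun t => rmean n (g t) c%:C (2 * r)) <= eY ^+ 2 / 128.
  rewrite avg_rmean -[leRHS](rmean_cst n _ c%:C (2 * r)).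
  apply: rmean_le => [|w hw]; first exact: ltW.
  have [k1 k2] := reg w ltac:(by rewrite hw).
  by apply: le_trans (hN3 N n3 w k1 k2) _; lra.
have mb t : exists n0, forall n, (n0 <= n)%N ->
    ~ (forall w, nm (w - c%:C) <= r -> nm (mollified_err ps (vshift w t)) <= eY) ->
    eY ^+ 2 / 16 <= rmean n (fun w => nm (mollified_err ps (vshift w t)) ^+ 2) c%:C (2 * r).
  have [hg|/existsNP[z /not_implyP[zr /negP]]] :=
      pselect (forall w, nm (w - c%:C) <= r -> nm (mollified_err ps (vshift w t)) <= eY).
    by exists 0%N.
  rewrite -ltNge => hz.
  have df w : nm (w - c%:C) <= 2 * r -> cdiff (fun w => mollified_err ps (vshift w t)) w.
    by move=> /reg[/andP[k1 k2] _]; apply: cdiff_mollified_err; lra.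
  have zr' : nm (z - c%:C) <= 2 * r / 2 by lra.
  have [n0 hn] := cauchy_mean_bound r20 df zr' (divr_gt0 eY0 (ltr0Sn R 1)).
  exists n0 => n nn0 _; apply: le_trans (rmean_sq_le _ _ _ _).
  have h := hn n nn0; move: h; set m := rmean _ _ _ _ => h.
  have hm : eY / 4 <= m by lra.
  have -> : eY ^+ 2 / 16 = (eY / 4) ^+ 2 by field.
  have eY4 : 0 <= eY / 4 by rewrite divr_ge0// ltW.
  by rewrite lerXn2r// nnegrE// (le_trans eY4).
have [n0 hn0] := choice mb.
(* One number of points on the circle serves all t, as there are finitely many samples. *)
pose n := (\max_(i < N * N) \max_(j < N * N) n0 (sample R N i j))%N.
have hn (i j : nat) : (i < N * N)%N -> (j < N * N)%N -> (n0 (sample R N i j) <= n)%N.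
  move=> hi hj; rewrite /n.
  apply: leq_trans (leq_bigmax (F := fun i : 'I_(N * N) => \max_(j < N * N) n0 (sample R N i j))%N (Ordinal hi)).
  exact: (leq_bigmax (F := fun j : 'I_(N * N) => n0 (sample R N i j)) (Ordinal hj)).
pose G t := if `[< good_shift chi ps c r eC eY t >] then fejer_wt chi J ps t else 0.
pose S t := \sum_(p <- ps) (eC ^+ 2)^-1 * (fejer_wt chi J ps t * nm (phase chi p t - 1) ^+ 2).
pose T t := 16 / eY ^+ 2 * rmean n (g t) c%:C (2 * r).
have hS : avg N S <= 1 / 8.
  rewrite /S avg_sum; apply: le_trans hC.
  rewrite (_ : _ * _ = \sum_(p <- ps) 8 / J%:R / eC ^+ 2); last first.
    by rewrite big_const_seq count_predT iter_addr_0 mulr_natl.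
  rewrite big_seq [leRHS]big_seq; apply: ler_sum => p pps; rewrite avgZ mulrC.
  by rewrite ler_wpM2r ?invr_ge0 ?(ltW eC2)//; exact: h2.
have hT : avg N T <= 1 / 8.
  rewrite /T avgZ; apply: le_trans (ler_wpM2l _ (h3 n)) _; first by rewrite divr_ge0// ltW.
  by rewrite le_eqVlt; apply/orP; left; apply/eqP; field; rewrite gt_eqF.
suff : avg N (fejer_wt chi J ps) <= avg N (fun t => G t + (S t + T t)) 
  by rewrite !avgD; clear -h1 hS hT; lra.
apply: avg_le => i j hi hj; set t := sample R N i j.
have w0 := fejer_wt_ge0 chi J ps t.
have S0 p : 0 <= (eC ^+ 2)^-1 * (fejer_wt chi J ps t * nm (phase chi p t - 1) ^+ 2).
  by apply: mulr_ge0; [rewrite invr_ge0 ltW|apply: mulr_ge0 => //; exact: sqr_ge0].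
have S1 : 0 <= S t by apply: sumr_ge0 => p _; exact: S0.
have Tge : 16 / eY ^+ 2 * (fejer_wt chi J ps t * (eY ^+ 2 / 16)) = fejer_wt chi J ps t.
  by field; rewrite gt_eqF.
have TE : T t = 16 / eY ^+ 2 *
    (fejer_wt chi J ps t * rmean n (fun w => nm (mollified_err ps (vshift w t)) ^+ 2) c%:C (2 * r)).
  by rewrite /T /g rmeanZ.
have T1 : 0 <= T t.
  rewrite TE; apply: mulr_ge0; first by rewrite divr_ge0// ltW.
  apply: mulr_ge0 => //; apply: mulr_ge0; first by rewrite invr_ge0 exprn_ge0.
  by apply: sumr_ge0 => k _; exact: sqr_ge0.
rewrite /G; case: asboolP => hg; first by rewrite lerDl addr_ge0.
rewrite add0r; have [hp|] := pselect (forall p, p \in ps -> nm (phase chi p t - 1) <= eC).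
  have hq : ~ (forall w, nm (w - c%:C) <= r -> nm (mollified_err ps (vshift w t)) <= eY).
    by move=> h; apply: hg; split.
  have h := hn0 t n (hn _ _ hi hj) hq.
  suff : fejer_wt chi J ps t <= T t by move=> hT'; rewrite (le_trans hT')// lerDr.
  by rewrite TE -{1}Tge !ler_wpM2l// divr_ge0// ltW.
move=> /existsNP[p /not_implyP[pps /negP]]; rewrite -ltNge => hp.
suff : fejer_wt chi J ps t <= S t by move=> hS'; rewrite (le_trans hS')// lerDl.
apply: le_trans (_ : (eC ^+ 2)^-1 * (fejer_wt chi J ps t * nm (phase chi p t - 1) ^+ 2) <= _).
  rewrite mulrC ler_pdivlMr//; apply: ler_wpM2l => //.
  by rewrite lerXn2r ?nnegrE ?nm_ge0 ?(ltW eC0)// ltW.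
rewrite /S (big_rem p pps)/= lerDl; apply: sumr_ge0 => q _; exact: S0.
Qed.

(** Write the first index as a N + b with a, b < N. For fixed b and j the sample points
    increase with a in steps of 1, and by the pigeonhole principle some such column contains
    its share of the good points. *)
Lemma good_column N (phi : R -> R) (g : pred R) (W : R) : (0 < N)%N -> 0 < W ->
  (forall t, phi t <= if g t then W else 0) -> 1 / 4 <= avg N phi ->
  exists b j : nat, [/\ (b < N)%N, (j < N * N)%N &
    N%:R / (8 * W) <= (count (fun a => g (sample R N (a * N + b) j)) (iota 0 N))%:R].
Proof.
move=> N0 W0 hphi havg; apply: contrapT => hn.
have K0 : 0 < (N * N)%:R :> R by rewrite ltr0n muln_gt0 N0.
have hc b j : (b < N)%N -> (j < N * N)%N ->
    (count (fun a => g (sample R N (a * N + b) j)) (iota 0 N))%:R <= N%:R / (8 * W).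
  move=> hb hj; rewrite leNgt; apply/negP => h; apply: hn; exists b, j; split => //.
  exact: ltW.
have hcol (j : nat) : (j < N * N)%N -> \sum_(i < N * N) phi (sample R N i j) <= (N * N)%:R / 8.
  move=> hj.
  rewrite -(big_mkord xpredT (fun i : nat => phi (sample R N i j))) big_nat_mul.
  have -> : \sum_(0 <= a < N) \sum_(a * N <= i < a.+1 * N) phi (sample R N i j) =
      \sum_(0 <= b < N) \sum_(0 <= a < N) phi (sample R N (a * N + b) j).
    rewrite exchange_big_nat /=; apply: eq_bigr => a _.
    rewrite -{1}[(a * N)%N]add0n big_addn (_ : a.+1 * N - a * N = N)%N; last by rewrite mulSn addnK.
    by apply: eq_bigr => b _; rewrite addnC.
  rewrite (_ : _ / 8 = \sum_(0 <= b < N) N%:R / 8); last first.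
    by rewrite sumr_const_nat subn0 -[RHS]mulr_natl natrM mulrA.
  rewrite big_nat [leRHS]big_nat; apply: ler_sum => b /= hb.
  have h := hc b j hb hj.
  apply: (@le_trans _ _ (\sum_(0 <= a < N) if g (sample R N (a * N + b) j) then W else 0)).
    by apply: ler_sum => a _; exact: hphi.
  rewrite -big_mkcond /= big_const_seq iter_addr_0 /index_iota subn0.
  rewrite -[X in X <= _]mulr_natr; apply: le_trans (ler_wpM2l (ltW W0) h) _.
  by rewrite le_eqVlt; apply/orP; left; apply/eqP; field; rewrite gt_eqF.
move: havg; rewrite /avg exchange_big /=; apply/negP; rewrite -ltNge.
have h : \sum_(j < N * N) \sum_(i < N * N) phi (sample R N i j) <= (N * N)%:R * ((N * N)%:R / 8).
  have -> : (N * N)%:R * ((N * N)%:R / 8) = \sum_(j < N * N) (N * N)%:R / 8 :> R.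
    by rewrite sumr_const card_ord -[RHS]mulr_natl.
  by apply: ler_sum => j _; exact: hcol.
apply: le_lt_trans (ler_wpM2l _ h) _; first by rewrite invr_ge0 sqr_ge0.
move: K0; set K := (N * N)%:R => K0; clearbody K.
have -> : (K ^+ 2)^-1 * (K * (K / 8)) = 1 / 8 by field; rewrite gt_eqF.
by lra.
Qed.

End GoodShifts.

(** * Counting the zeros *)

Section Main.
Variable R : realType.
Implicit Types (x y e t r : R) (z w s : R[i]).

Lemma kappa_bound_gt0 x : x < 1 -> 0 < 2 * rpow 2 x - 1.
Proof.
move=> x1; have : rpow 2 1 < rpow 2 x :> R.
  by rewrite /rpow ltr_expR ltrN2 ltr_pM2r// ln_gt0// ltr1n.
by rewrite rpow_x1//; lra.
Qed.

Lemma sample_block N a b j : (0 < N)%N ->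
  sample R N (a * N + b) j = (2 * N)%:R + a%:R + (b%:R - j%:R) / N%:R.
Proof.
move=> N0; rewrite /sample natrD natrM; field.
by rewrite pnatr_eq0 -lt0n.
Qed.

Lemma sample_block_range N i b j : (i < N)%N -> (b < N)%N -> (j < N * N)%N ->
  N%:R <= sample R N (i * N + b) j /\ sample R N (i * N + b) j <= 3 * N%:R.
Proof.
move=> iN bN jN; have N0 : (0 < N)%N by apply: leq_ltn_trans bN.
have N0' : 0 < N%:R :> R by rewrite ltr0n.
have i1 : i%:R + 1 <= N%:R :> R by rewrite natr1 ler_nat.
have q1 : (b%:R - j%:R) / N%:R <= 1 :> R.
  rewrite ler_pdivrMr// mul1r; have : b%:R <= N%:R :> R by rewrite ler_nat ltnW.
  by have : 0 <= j%:R :> R by []; lra.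
have q2 : - N%:R <= (b%:R - j%:R) / N%:R :> R.
  rewrite ler_pdivlMr// mulNr -natrM; have : j%:R <= (N * N)%:R :> R by rewrite ler_nat ltnW.
  by have : 0 <= b%:R :> R by []; lra.
have i0 : 0 <= i%:R :> R by [].
by rewrite sample_block// natrM; lra.
Qed.

Lemma counting_ge (A : set R[i]) (l : seq R[i]) : uniq l ->
  (forall z, z \in l -> A z) -> ((size l)%:R%:E <= counting A :> \bar R)%E.
Proof.
move=> ul lA; rewrite /counting; case: asboolP => fA; last exact: leey.
rewrite lee_fin ler_nat; apply: uniq_leq_size => // z /lA Az.
by have := in_fset_set fA z; rewrite (mem_set Az).
Qed.

Lemma limf_einf_gt0 (F : R -> \bar R) b T0 : 0 < b ->
  (forall T, T0 < T -> (b%:E <= F T)%E) -> (0 < limf_einf F (pinfty_nbhs R))%E.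
Proof.
move=> b0 h; rewrite limf_einfE; apply: (@lt_le_trans _ _ b%:E); first by rewrite lte_fin.
apply: le_trans (ereal_sup_ubound _); last first.
  by exists [set T | T0 < T] => //; exists T0; split => //; exact: num_real.
by apply: le_ereal_inf_tmp => _ [T /= T0T <-]; exact: h.
Qed.

Variable f : R[i] -> R[i].
Hypothesis f_zeta2 : is_zeta2_diag f.

(** The zeros found for the points of one column are distinct, because the points are 1
    apart and the height of each zero differs by less than r <= 1/2 from that of its point. *)
Lemma many_zeros (sigma delta : R) : 1 / 2 < sigma -> sigma < 1 ->
  0 < delta -> delta < (sigma - 1 / 2) / 3 -> delta < 1 - sigma ->
  exists2 b : R, 0 < b & exists N1, forall N, (N1 <= N)%N -> exists l : seq R[i],
    [/\ uniq l, b * N%:R <= (size l)%:R &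
      forall z, z \in l -> zeros_in f (sigma - delta) (sigma + delta) (4 * N)%:R z].
Proof.
move=> hs1 hs2 d0 d1 d2.
have [eps [c [r [m [B [e2 cs [r0 r4] [m0 B0] hQ]]]]]] := signed_product_zero hs1 hs2 d0 d1 d2.
have [cs1 cs2] : sigma - delta / 2 <= c /\ c <= sigma + delta / 2.
  by move: cs; rewrite ler_distl => /andP[].
have r21 : 2 * r <= 1 by lra.
have cr1 : c + 2 * r <= 1 by lra.
have cr0 : c - 2 * r <= c - r by lra.
(* The parameters are chosen in the order eY, M, eC, J: the mollified error must be small
   relative to m, then M makes the tails small relative to eY, the tolerance eC for the
   phases depends on M, and the order J of the Fejer kernels on all of these. *)
pose x1 := c - 2 * r; pose x2 := c + r.
have hx1 : 1 / 2 < x1 by rewrite /x1; lra.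
have hx2 : x2 < 1 by rewrite /x2; lra.
have [k0 k0E] : exists k0, k0 = 2 * rpow 2 x2 - 1 by eexists.
have kpos : 0 < k0 by rewrite k0E kappa_bound_gt0.
pose u := Num.min 1 (m / 12).
have u0 : 0 < u by rewrite lt_min ltr01 divr_gt0.
have [u1 u2] : u <= 1 /\ u <= m / 12 by rewrite !ge_min !lexx orbT.
have [eY eYE] : exists eY, eY = k0 * u by eexists.
have eY0 : 0 < eY by rewrite eYE mulr_gt0.
have hY : 2 * (eY / k0) + (eY / k0) ^+ 2 <= m / 4.
  have -> : eY / k0 = u by rewrite eYE; field; rewrite gt_eqF.
  by rewrite expr2; clear -u0 u1 u2; nra.
pose a := 2 * x1 - 1.
have a0 : 0 < a by rewrite /a; lra.
pose tT := Num.min (eY ^+ 2 / 256 / 50) (m / 4 / (B + 1)).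
have B1 : 0 < B + 1 by lra.
have eY2 : 0 < eY ^+ 2 by rewrite exprn_gt0.
have tT0 : 0 < tT by rewrite lt_min (divr_gt0 (divr_gt0 eY2 (ltr0Sn R 255)) (ltr0Sn R 49)) !divr_gt0.
have [tT1 tT2] : tT <= eY ^+ 2 / 256 / 50 /\ tT <= m / 4 / (B + 1) by rewrite !ge_min !lexx orbT.
have [M0 hM0] := rpow_small a0 (mulr_gt0 a0 tT0).
have [M MM0 [hc hw hB]] := hQ (maxn M0 1).
have Mpos : (0 < M)%N by apply: leq_trans MM0; rewrite leq_maxr.
have hT : rpow M a / a <= tT.
  rewrite ler_pdivrMr// mulrC ltW// hM0//.
  by apply: leq_trans MM0; rewrite leq_maxl.
have hT1 : 50 * (rpow M a / a) <= eY ^+ 2 / 256 by lra.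
have hT2 : rpow M a / a * (B + 1) <= m / 4.
  by rewrite -ler_pdivlMr//; apply: le_trans hT _.
pose v := Num.min 1 (m / 4).
have v0 : 0 < v by rewrite lt_min ltr01 divr_gt0.
have [v1 v2] : v <= 1 /\ v <= m / 4 by rewrite !ge_min !lexx orbT.
have [P PE] : exists P : R, P = M%:R * 8 ^+ M by eexists.
have P0 : 0 < P by rewrite PE mulr_gt0 ?ltr0n// exprn_gt0.
have [eC eCE] : exists eC, eC = v / (P * 32) by eexists.
have eC0 : 0 < eC by rewrite eCE divr_gt0// mulr_gt0.
have hC : P * (32 * eC) = v by rewrite eCE; field; rewrite gt_eqF.
have eC2 : 0 < eC ^+ 2 by rewrite exprn_gt0.
have [J hJ] := nat_above (M%:R * 64 / eC ^+ 2).
have Jpos : 0 < J%:R :> R.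
  by apply: le_lt_trans hJ; rewrite divr_ge0 ?mulr_ge0// ltW.
have hJ' : (size (first_primes M))%:R * (8 / J%:R / eC ^+ 2) <= 1 / 8.
  rewrite size_first_primes.
  have -> : M%:R * (8 / J%:R / eC ^+ 2) = M%:R * 64 / eC ^+ 2 / J%:R / 8 :> R.
    by field; rewrite !gt_eqF.
  by rewrite ler_pM2r ?invr_gt0// ler_pdivrMr// mul1r ltW.
pose chi := prime_sign eps M.
have chi_sq p : chi p ^+ 2 = 1 by exact: e2.
have J0 : (0 < J)%N by rewrite -(ltr0n R).
have [N0 hN0] := good_shift_mean chi_sq J0 (first_primes_prime M) (first_primes_uniq M) Mpos
  (@rough_first_primes M) hx1 r0 r21 (lexx _) cr1 eC0 eY0 hJ' hT1.
pose W : R := J%:R ^+ M.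
have W0 : 0 < W by rewrite exprn_gt0.
exists (8 * W)^-1; first by rewrite invr_gt0 mulr_gt0.
exists (maxn N0 1) => N; rewrite geq_max => /andP[NN0 Npos].
pose good t := good_shift chi (first_primes M) c r eC eY t.
have hphi t : (if `[< good t >] then fejer_wt chi J (first_primes M) t else 0) <=
    if `[< good t >] then W else 0.
  case: ifP => // _; apply: le_trans (fejer_wt_le chi_sq J0 _ _) _.
  by rewrite size_first_primes.
have [b [j [bN jN hcount]]] := good_column Npos W0 hphi (hN0 N NN0).
pose t (i : nat) := sample R N (i * N + b) j.
have tE (i : nat) : t i = (2 * N)%:R + i%:R + (b%:R - j%:R) / N%:R by exact: sample_block.
have kpos' : 0 < 2 * rpow 2 x2 - 1 by rewrite -k0E.
have hY' : 2 * (eY / (2 * rpow 2 x2 - 1)) + (eY / (2 * rpow 2 x2 - 1)) ^+ 2 <= m / 4.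
  by rewrite -k0E.
have hC1 : M%:R * 8 ^+ M * (32 * eC) <= m / 4 by rewrite -PE hC.
have hC2 : M%:R * 8 ^+ M * (32 * eC) <= 1 by rewrite -PE hC.
have zex (i : nat) : exists w, good (t i) ->
    [/\ nm (w - c%:C) < r, holomorphic_at f (vshift w (t i)) & f (vshift w (t i)) = 0].
  have [[g1 g2]|ng] := pselect (good (t i)); last by exists 0 => /ng.
  have hz n : (n < M)%N -> nm (phase (prime_sign eps M) (nth_prime n) (t i) - 1) <= eC.
    by move=> nM; apply: g1; rewrite map_f// mem_iota.
  have [w wr [h1 h2]] := @zero_at_good_shift R f f_zeta2 M (t i) c r m B x1 x2 eY eC
    hx1 hx2 r0 cr0 (lexx _) Mpos m0 (ltW eY0) (ltW eC0) B0 kpos' hY' hT2 hC1 hC2 eps e2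
    hc hw hB hz g2.
  by exists w.
have [zf hzf] := choice zex.
have N0' : 0 < N%:R :> R by rewrite ltr0n.
have imw (i : nat) : good (t i) -> `|Im (zf i)| < r.
  move=> /hzf[h _ _]; apply: le_lt_trans h.
  by have := Im_le_nm (zf i - c%:C); rewrite raddfB /= subr0.
exists [seq vshift (zf i) (t i) | i <- iota 0 N & `[< good (t i) >]]; split.
- rewrite map_inj_in_uniq ?filter_uniq ?iota_uniq// => i i'.
  rewrite !mem_filter => /andP[/asboolP gi _] /andP[/asboolP gi' _] /(congr1 (@Im R)).
  rewrite !Im_vshift !tE => h.
  have h1 := imw _ gi; have h2 := imw _ gi'.
  move: h1 h2; rewrite !ltr_norml => /andP[h1 h2] /andP[h3 h4].
  have [k1 k2] : (i%:R < i'%:R + 1 :> R) /\ (i'%:R < i%:R + 1 :> R).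
    by clear -h h1 h2 h3 h4 r21; lra.
  by move: k1 k2; rewrite !natr1 !ltr_nat !ltnS => k1 k2; apply/eqP; rewrite eqn_leq k1.
- by rewrite size_map size_filter mulrC.
move=> z zl; have [i + ->] := seq.mapP zl.
rewrite mem_filter mem_iota /= add0n => /andP[/asboolP gi iN].
have [h1 h2 h3] := hzf i gi; have h4 := imw i gi.
split => //.
  rewrite Re_vshift; have := Re_near (ltW h1); have := Re_near_le (ltW h1) => /= k1 k2.
  by clear -k1 k2 cs1 cs2 r4 d0; apply/andP; split; lra.
have [t1 t2] := sample_block_range iN bN jN; have n1 : 1 <= N%:R :> R by rewrite ler1n.
rewrite Im_vshift natrM; move: h4 t1 t2; rewrite ltr_norml -/(t i) => /andP[h4 h5] t1 t2.
by clear -h4 h5 t1 t2 n1 r21; apply/andP; split; lra.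
Qed.

End Main.

Theorem theorem3 (R : realType) (f : R[i] -> R[i]) (f_zeta2 : is_zeta2_diag f)
    (sigma0 : R) (sigma0_bounds : 1 / 2 < sigma0 < 1) :
  exists2 delta0 : R, 0 < delta0 &
    forall delta : R, 0 < delta < delta0 ->
      (0 < limf_einf
             (fun T : R => (T^-1)%:E *
                zero_count f (sigma0 - delta)%R (sigma0 + delta)%R T)
             (pinfty_nbhs R))%E.
Proof.
have /andP[hs1 hs2] := sigma0_bounds.
exists (Num.min ((sigma0 - 1 / 2) / 3) (1 - sigma0)).
  by rewrite lt_min divr_gt0//; lra.
move=> delta /andP[d0]; rewrite lt_min => /andP[d1 d2].
have [b b0 [N1 hN1]] := many_zeros f_zeta2 hs1 hs2 d0 d1 d2.
apply: (@limf_einf_gt0 _ _ (b / 8) (8 * N1.+1%:R)); first by rewrite divr_gt0.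
move=> T hT.
have N11 : 1 <= N1.+1%:R :> R by rewrite ler1n.
have T0 : 0 < T by lra.
pose N := Num.truncn (T / 4).
have /andP[hN hN'] : N%:R <= T / 4 < N.+1%:R by apply: truncn_itv; rewrite divr_ge0// ltW.
have hNS : N.+1%:R = N%:R + 1 :> R by rewrite natr1.
have NN1 : (N1 <= N)%N.
  rewrite -ltnS -(ltr_nat R) hNS; have : N1.+1%:R = N1%:R + 1 :> R by rewrite natr1.
  by lra.
have [l [ul sl hl]] := hN1 N NN1.
rewrite lee_pdivlMl// -EFinM; apply: le_trans (counting_ge ul _); last first.
  move=> z /hl[h1 h2 h3 /andP[h4 h5]]; split=> //; apply/andP; split=> //.
  by apply: le_trans h5 _; rewrite natrM; lra.
rewrite lee_fin; apply: le_trans sl.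
have : T <= 8 * N%:R by lra.
move=> h; rewrite mulrCA ler_pM2l//; lra.
Qed.
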